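(* Fix a real $\theta>0$ and, for each $N\ge 1$, let $\sigma=\sigma_N$ be a random Ewens permutation of size $N$ with parameter $\theta$. Let $x\in[0,1]$. Then, almost surely, $$\lim_{N\to\infty} F^{(N)}_{\sigma}(x)=\frac{1-(1-x)^2}{2}.$$ Moreover, define the rescaled fluctuations $$Z^{(N)}_\sigma(x):=\sqrt{N}\,\Big(F^{(N)}_\sigma(x)-\mathbb{E}\big(F^{(N)}_\sigma(x)\big)\Big).$$ Then, for any $x_1,\dots,x_r\in[0,1]$, the vector $(Z^{(N)}_\sigma(x_1),\dots,Z^{(N)}_\sigma(x_r))$ converges in distribution, as $N\to\infty$, towards a Gaussian vector $(G(x_1),\dots,G(x_r))$ with covariance matrix $(K(x_i,x_j))_{1\le i,j\le r}$, where $$K(x,y)=\int_0^{\min(x,y)}t(1-t)\,dt-\int_{0}^{x}\int_{0}^{y}\min(t,u)\,\big(1-\max(t,u)\big)\,du\,dt .$$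
   Context: For $\theta>0$, the Ewens measure on the symmetric group $S_N$ is $\mu_N(\{\sigma\})=\frac{\theta^{\#(\sigma)}}{\theta(\theta+1)\cdots(\theta+N-1)}$, where $\#(\sigma)$ is the number of cycles of $\sigma$. A random Ewens permutation of size $N$ is a random element of $S_N$ with law $\mu_N$. For the almost sure statement, the permutations $\sigma_N$ ($N\ge1$) are defined on a common probability space, with arbitrary joint law. For $\sigma\in S_N$ and $1\le i\le N$, let $B^{\mathrm{ex},N}_i(\sigma)=1$ if $\sigma(i)\ge i$ and $B^{\mathrm{ex},N}_i(\sigma)=0$ if $\sigma(i)<i$. For $x\in[0,1]$ such that $Nx$ is an integer, set $F^{(N)}_\sigma(x)=\frac1N\sum_{i=1}^{Nx}B^{\mathrm{ex},N}_i(\sigma)$ (so $F^{(N)}_\sigma(0)=0$), and extend $F^{(N)}_\sigma$ to a continuous function on $[0,1]$ which is affine between $i/N$ and $(i+1)/N$ for each $0\le i\le N-1$. *)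

(* Defs.v *)
From mathcomp Require Import all_boot all_order all_algebra fingroup perm.
From mathcomp Require Import all_classical all_reals all_analysis.

Set Implicit Arguments.
Unset Strict Implicit.
Unset Printing Implicit Defensive.

Import Order.TTheory GRing.Theory Num.Theory.
Import numFieldTopology.Exports numFieldNormedType.Exports.

Local Open Scope classical_set_scope.
Local Open Scope ring_scope.

(* [porbits s] is the set of all cycles of [s], fixed points included. *)
Definition ewens (R : realType) (theta : R) (N : nat) (s : 'S_N) : R :=
  theta ^+ #|porbits s| / \prod_(i < N) (theta + i%:R).

Definition ewens_permutation (R : realType) (theta : R) (N : nat)
    (d : measure_display) (T : measurableType d) (P : probability T R)
    (sigma : T -> 'S_N) : Prop :=
  forall s : 'S_N, measurable (sigma @^-1` [set s]) /\
    P (sigma @^-1` [set s]) = (ewens theta s)%:E.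

(* Points are numbered from 0, i.e. ['I_N] is {0, ..., N-1}; this shift does
   not affect the condition sigma(i) >= i. *)
Definition B_ex (N : nat) (s : 'S_N) (i : 'I_N) : nat := (i <= s i)%N.

Definition wexc_count (N : nat) (s : 'S_N) (k : nat) : nat :=
  (\sum_(i < N | (i < k)%N) B_ex s i)%N.

(* Linear interpolation between the values [wexc_count s k / N] at [k / N];
   the value is meaningful for [0 < N] and [x] in [0, 1]
   (see [Fwexc_grid] and [Fwexc_affine]). *)
Definition Fwexc (R : realType) (N : nat) (s : 'S_N) (x : R) : R :=
  let k := Num.truncn (N%:R * x) in
  let t := N%:R * x - k%:R in
  ((1 - t) * (wexc_count s k)%:R + t * (wexc_count s k.+1)%:R) / N%:R.

Lemma Fwexc_grid (R : realType) (N : nat) (s : 'S_N) (k : nat) : (0 < N)%N ->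
  Fwexc s (k%:R / N%:R : R) = N%:R^-1 * \sum_(i < N | (i < k)%N) (B_ex s i)%:R.
Proof.
move=> N0; have E : N%:R * (k%:R / N%:R) = k%:R :> R.
  by rewrite mulrC divfK// pnatr_eq0 -lt0n.
by rewrite /Fwexc E natrK subrr subr0 mul1r mul0r addr0 mulrC natr_sum.
Qed.

Lemma Fwexc_affine (R : realType) (N : nat) (s : 'S_N) (k : nat) (t : R) :
  (0 < N)%N -> 0 <= t <= 1 ->
  Fwexc s ((k%:R + t) / N%:R) =
    (1 - t) * Fwexc s (k%:R / N%:R) + t * Fwexc s (k.+1%:R / N%:R).
Proof.
move=> N0 /andP[t0]; rewrite le_eqVlt => /predU1P[->|t1].
  by rewrite subrr mul0r add0r mul1r natr1.
have E : N%:R * ((k%:R + t) / N%:R) = k%:R + t :> R.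
  by rewrite mulrC divfK// pnatr_eq0 -lt0n.
have K : Num.truncn (k%:R + t) = k.
  by apply/truncn_def; rewrite lerDl t0 -natr1 ltrD2l t1.
rewrite !Fwexc_grid// /Fwexc E K [k%:R + t]addrC addrK /wexc_count !natr_sum.
by rewrite mulrDl -!mulrA ![_ / N%:R]mulrC.
Qed.

Definition Zwexc (R : realType) (N : nat) (d : measure_display)
    (T : measurableType d) (P : probability T R) (sigma : T -> 'S_N)
    (x : R) (w : T) : R :=
  Num.sqrt N%:R *
    (Fwexc (sigma w) x - fine 'E_P[fun w' => Fwexc (sigma w') x]%E).

Definition Kwexc (R : realType) (x y : R) : R :=
  \int[lebesgue_measure]_(t in `[0, Num.min x y]) (t * (1 - t)) -
  \int[lebesgue_measure]_(t in `[0, x])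
    \int[lebesgue_measure]_(u in `[0, y]) (Num.min t u * (1 - Num.max t u)).

(* [normal_prob m 0] is not the point mass at [m] (it is uniform on [0, 1]),
   hence the case distinction. *)
Definition gaussian_law (R : realType) (m s : R) (A : set R) : \bar R :=
  if s == 0 then \d_m A else normal_prob m s A.

Definition gaussian_vector (R : realType) (d : measure_display)
    (T : measurableType d) (P : probability T R) (r : nat)
    (G : 'I_r -> {RV P >-> R}) : Prop :=
  forall a : 'I_r -> R, exists m s : R, 0 <= s /\
    forall A : set R, measurable A ->
      P ((fun w => \sum_(i < r) a i * G i w) @^-1` A) = gaussian_law m s A.

Definition cvg_in_distribution (R : realType) (r : nat)
    (d : nat -> measure_display) (T : forall N, measurableType (d N))
    (P : forall N, probability (T N) R) (X : forall N, 'I_r -> T N -> R)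
    (d' : measure_display) (T' : measurableType d') (P' : probability T' R)
    (Y : 'I_r -> T' -> R) : Prop :=
  forall f : 'rV[R]_r -> R, continuous f ->
    (exists M : R, forall v, `|f v| <= M) ->
    ('E_(P N)[fun w => f (\row_i X N i w)] @[N --> \oo] -->
      'E_P'[fun w => f (\row_i Y i w)])%E.

(* Main.v *)
(* Write N * F(x) as a constant minus the sum of w_i over the i with s(i) < i,
   where w_i is the length of [i, i+1] intersected with [0, N x]: every linear
   combination of values of F is such a weighted number of deficits, with
   bounded weights.  Inserting the largest point into an Ewens permutation of
   size n, as a fixed point or right after a uniform point j, adds w_n and
   removes the deficit of j, if any.  Hence, centered and multiplied by
   theta + n - 1, the weighted number of deficits is a martingale whose
   conditional variance is again a polynomial in numbers of deficits.  This gives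
   the mean, the variance (its limit is the quadratic form of K, as a Riemann
   sum), fourth moments of order N^2, and, since the conditional variances
   concentrate, the Gaussian limit of E cos (Z + c) by a Taylor expansion at each
   step.  The fourth moments of F - E F are thus summable in N, which gives the
   almost sure limit for any joint law.  For the convergence in distribution,
   bounded second moments reduce bounded continuous test functions to
   trigonometric polynomials by a Bernstein approximation; the Gaussian vector is
   built by Cholesky decomposition. *)
Require Import Defs.
From mathcomp Require Import all_boot all_order all_algebra fingroup perm.
From mathcomp Require Import all_classical all_reals all_analysis.
From mathcomp Require Import ring lra measurable_realfun.

Set Implicit Arguments.
Unset Strict Implicit.
Unset Printing Implicit Defensive.

Import Order.TTheory GRing.Theory Num.Theory.
Import numFieldTopology.Exports numFieldNormedType.Exports.

Local Open Scope classical_set_scope.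
Local Open Scope ring_scope.

(** * Inserting the largest point into an Ewens permutation *)

(** Before the transfer to probability spaces, every statement about Ewens permutations is an
    identity or an inequality between finite sums over symmetric groups. The insertion chain is not
    built as a process: it appears only as the bijection from ['S_n] times ['I_n.+1] onto ['S_n.+1],
    under which the Ewens weight is multiplied by theta / (theta + n) or by 1 / (theta + n). The
    obstacle is that the weights of the deficits depend on N through the interpolation, so no single
    martingale is indexed by N. For each N the weights are frozen and a martingale is run from size
    0 up to size N. All estimates must therefore be uniform in the weights, which is why the moment
    bounds and the Gaussian approximation are explicit inequalities in terms of a bound [A] on the
    weights. The factor theta + n - 1 has its origin in the mean: numbered from 0, the point i is a
    deficit with probability i / (theta + n - 1) at size n. Cosines with an arbitrary phase play the
    part of the complex characteristic function; in the Cholesky induction the phase also absorbs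
    the variable that has been frozen by Fubini. *)

Section insertion.
Variable n : nat.
Implicit Types (s : 'S_n) (j : 'I_n.+1).
Local Open Scope group_scope.

(** Products of permutations apply the left factor first, so [j] is sent to the new maximum and the
    maximum to [s j]: the maximum enters the cycle of [j] right after [j]. For [j = ord_max] the
    transposition is trivial and the maximum is a fixed point. *)
Definition insert_max s j : 'S_n.+1 :=
  tperm j ord_max * lift_perm ord_max ord_max s.

Lemma lift_maxE s (i : 'I_n) :
  lift_perm ord_max ord_max s (lift ord_max i) = lift ord_max (s i).
Proof. exact: lift_perm_lift. Qed.

Lemma porbit_lift_max s (i : 'I_n) :
  porbit (lift_perm ord_max ord_max s) (lift ord_max i) =
  lift ord_max @: porbit s i.
Proof.
have E k : (lift_perm ord_max ord_max s ^+ k) (lift ord_max i) =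
    lift ord_max ((s ^+ k) i).
  elim: k => [|k IH]; first by rewrite !expg0 !perm1.
  by rewrite !expgSr !permM IH lift_maxE.
apply/setP => y; apply/porbitP/imsetP => [[k ->]|[z /porbitP[k ->] ->]].
  by exists ((s ^+ k) i); [exact: mem_porbit | exact: E].
by exists k.
Qed.

Lemma porbit_lift_max_max s :
  porbit (lift_perm ord_max ord_max s) ord_max = [set ord_max]%SET.
Proof.
have E k : (lift_perm ord_max ord_max s ^+ k) ord_max = ord_max.
  elim: k => [|k IH]; first by rewrite expg0 perm1.
  by rewrite expgSr permM IH lift_perm_id.
apply/setP => y; rewrite inE; apply/porbitP/eqP => [[k ->]|->]; first exact: E.
by exists 0%N; rewrite expg0 perm1.
Qed.

Lemma card_porbits_lift_max s :
  #|porbits (lift_perm ord_max ord_max s)| = #|porbits s|.+1.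
Proof.
pose h (A : {set 'I_n}) := lift (@ord_max n) @: A.
have hinj : injective h by exact/imset_inj/lift_inj.
have -> : porbits (lift_perm ord_max ord_max s) =
    ([set ord_max] |: (h @: porbits s))%SET.
  apply/setP => A; rewrite !inE; apply/imsetP/orP.
    case=> x _ ->; case: (unliftP ord_max x) => [i ->|->].
      right; rewrite porbit_lift_max; apply: imset_f; exact: imset_f.
    by left; rewrite porbit_lift_max_max.
  case=> [/eqP ->|/imsetP[_ /imsetP[i _ ->] ->]].
    by exists ord_max; rewrite ?porbit_lift_max_max.
  by exists (lift ord_max i); rewrite ?porbit_lift_max.
rewrite cardsU1 card_imset// (_ : _ \notin _) ?add1n//.
apply/negP => /imsetP[_ /imsetP[i _ ->]] /setP/(_ ord_max).
rewrite inE eqxx => /esym/imsetP[k _ E].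
by have := neq_lift ord_max k; rewrite -E eqxx.
Qed.

(** The maximum is alone in its cycle of the lifted permutation; multiplying by a transposition that
    moves it merges this cycle with the cycle of [j]. *)
Lemma card_porbits_insert_max s j :
  #|porbits (insert_max s j)| = (#|porbits s| + (j == ord_max))%N.
Proof.
have := porbits_mul_tperm (lift_perm ord_max ord_max s) j ord_max.
rewrite -/(insert_max s j) porbit_lift_max_max inE card_porbits_lift_max.
by case: (j == ord_max) => /=; rewrite ?addn0 ?addn1 ?doubleS ?addn2 //= => -[].
Qed.

(** The insertion point is recovered as the preimage of the maximum; the transposition can then be
    cancelled. *)
Lemma insert_max_inj : injective (fun p => insert_max p.1 p.2).
Proof.
move=> [s j] [s' j'] /= E.
have jE : j = j'.
  have M t i : insert_max t i i = ord_max.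
    by rewrite /insert_max permM tpermL lift_perm_id.
  by apply: (@perm_inj _ (insert_max s j)); rewrite {2}E !M.
move: E; rewrite jE /insert_max => /mulgI E; congr (_, _).
apply/permP => i; apply: (@lift_inj _ ord_max).
by rewrite -!lift_maxE E.
Qed.

(** After the insertion [j] is sent to the maximum and cannot be a deficit, while the other old
    points keep their images. *)
Lemma insert_max_lt s j (i : 'I_n) :
  (insert_max s j (lift ord_max i) < lift ord_max i)%N =
  (s i < i)%N && (lift ord_max i != j).
Proof.
have [ij|ij] := eqVneq (lift ord_max i) j.
  rewrite andbF /insert_max permM ij tpermL lift_perm_id /= -ij ltnNge.
  by rewrite ltnW// lift_max ltn_ord.
rewrite andbT /insert_max permM tpermD//; last by rewrite neq_lift.
  by rewrite lift_maxE !lift_max.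
by rewrite eq_sym.
Qed.

Lemma insert_max_ltn_max s j : (insert_max s j ord_max < n)%N = (j != ord_max).
Proof.
rewrite /insert_max permM tpermR; case: (unliftP ord_max j) => [k ->|->].
  by rewrite lift_maxE lift_max ltn_ord eq_sym neq_lift.
by rewrite lift_perm_id eqxx ltnn.
Qed.

End insertion.

Lemma sum_perm_insert (V : nmodType) (n : nat) (F : 'S_n.+1 -> V) :
  \sum_s F s = \sum_(s : 'S_n) \sum_(j < n.+1) F (insert_max s j).
Proof.
rewrite pair_big /= -(@reindex _ _ _ _ _ (fun p => insert_max p.1 p.2) predT)//.
apply: onW_bij; apply: inj_card_bij; first exact: insert_max_inj.
by rewrite card_prod card_ord !card_Sn factS mulnC.
Qed.

Lemma widen_ord_max n (k : 'I_n) :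
  widen_ord (leqnSn n) k = lift ord_max k.
Proof. by apply/val_inj; rewrite /= /bump leqNgt ltn_ord. Qed.

Section ewens_moments.
Variables (R : realType) (theta : R).

Definition Eewens n (g : 'S_n -> R) : R := \sum_s ewens theta s * g s.

Definition deficits (a : nat -> R) n (s : 'S_n) : R :=
  \sum_(i < n) a i * (s i < i)%N%:R.

Lemma deficits_insert a n (s : 'S_n) (j : 'I_n) :
  deficits a (insert_max s (lift ord_max j)) =
  deficits a s + (a n - a j * (s j < j)%N%:R).
Proof.
rewrite /deficits big_ord_recr/= insert_max_ltn_max eq_sym neq_lift mulr1.
rewrite [RHS]addrCA addrC; congr (_ + _).
rewrite [in RHS](bigD1 j)//= [_ + _ - _]addrC addKr (bigD1 j)//=.
have W k : (insert_max s (lift ord_max j) (widen_ord (leqnSn n) k) < k)%N =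
    (s k < k)%N && (k != j).
  have := insert_max_lt s (lift ord_max j) k; rewrite lift_max -(widen_ord_max k) => ->.
  by rewrite widen_ord_max (inj_eq lift_inj).
rewrite W eqxx andbF mulr0 add0r; apply: eq_bigr => k kj.
by rewrite W kj andbT.
Qed.

Lemma deficits_insert_max a n (s : 'S_n) :
  deficits a (insert_max s ord_max) = deficits a s.
Proof.
rewrite /deficits big_ord_recr/= insert_max_ltn_max eqxx mulr0 addr0.
apply: eq_bigr => k _.
have := insert_max_lt s ord_max k; rewrite lift_max -(widen_ord_max k) => ->.
by rewrite widen_ord_max eq_sym neq_lift andbT.
Qed.

Hypothesis theta_gt0 : 0 < theta.

Lemma thetaD_gt0 n : 0 < theta + n%:R.
Proof. by rewrite ltr_wpDr// ler0n. Qed.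

Lemma ewens_insert n (s : 'S_n) (j : 'I_n) :
  ewens theta (insert_max s (lift ord_max j)) = ewens theta s / (theta + n%:R).
Proof.
rewrite /ewens card_porbits_insert_max eq_sym (negbTE (neq_lift _ _)) addn0.
by rewrite big_ord_recr/= invfM mulrA.
Qed.

Lemma ewens_insert_max n (s : 'S_n) :
  ewens theta (insert_max s ord_max) = theta * ewens theta s / (theta + n%:R).
Proof.
rewrite /ewens card_porbits_insert_max eqxx addn1 exprS.
by rewrite big_ord_recr/= invfM !mulrA.
Qed.

(* The first term inserts the new maximum as a fixed point; the other ones
   insert it in a cycle, right after [j]. *)
Lemma Eewens_recr a n (g : R -> R) :
  Eewens (fun s : 'S_n.+1 => g (deficits a s)) =
  Eewens (fun s : 'S_n => (theta * g (deficits a s) +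
    \sum_(j < n) g (deficits a s + (a n - a j * (s j < j)%N%:R))) /
    (theta + n%:R)).
Proof.
rewrite /Eewens sum_perm_insert; apply: eq_bigr => s _.
have W (F : 'I_n.+1 -> R) :
    \sum_(j < n.+1) F j = F ord_max + \sum_(j < n) F (lift ord_max j).
  rewrite big_ord_recr/= addrC; congr (_ + _); apply: eq_bigr => j _.
  by rewrite widen_ord_max.
rewrite W ewens_insert_max deficits_insert_max mulrDl mulrDr; congr (_ + _).
  by ring.
rewrite mulr_suml mulr_sumr; apply: eq_bigr => j _.
by rewrite ewens_insert deficits_insert; ring.
Qed.

Lemma Eewens0 (g : 'S_0 -> R) : Eewens g = g 1%g.
Proof.
rewrite /Eewens (bigD1 1%g)//= big1 ?addr0 => [|s]; last first.
  by move=> /eqP[]; apply/permP => -[].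
rewrite /ewens big_ord0 divr1 [#|_|](_ : _ = 0%N) ?expr0 ?mul1r//.
by apply/eqP; rewrite cards_eq0; apply/eqP/setP => A; rewrite inE; apply/negP => /imsetP[[]].
Qed.

Lemma ewens_ge0 n (s : 'S_n) : 0 <= ewens theta s.
Proof.
rewrite /ewens divr_ge0// ?exprn_ge0 ?ltW// prodr_gt0// => i _.
exact: thetaD_gt0.
Qed.

Lemma EewensD n (f g : 'S_n -> R) :
  Eewens (fun s => f s + g s) = Eewens f + Eewens g.
Proof.
by rewrite /Eewens -big_split; apply: eq_bigr => s _; rewrite mulrDr.
Qed.

Lemma EewensZ n c (f : 'S_n -> R) : Eewens (fun s => c * f s) = c * Eewens f.
Proof.
by rewrite /Eewens mulr_sumr; apply: eq_bigr => s _; rewrite mulrCA.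
Qed.

Lemma EewensN n (f : 'S_n -> R) : Eewens (fun s => - f s) = - Eewens f.
Proof.
by rewrite -mulN1r -EewensZ; apply: eq_bigr => s _; rewrite mulN1r.
Qed.

Lemma EewensB n (f g : 'S_n -> R) :
  Eewens (fun s => f s - g s) = Eewens f - Eewens g.
Proof. by rewrite EewensD EewensN. Qed.

Lemma eq_Eewens n (f g : 'S_n -> R) : f =1 g -> Eewens f = Eewens g.
Proof. by move=> fg; apply: eq_bigr => s _; rewrite fg. Qed.

Lemma le_Eewens n (f g : 'S_n -> R) :
  (forall s, f s <= g s) -> Eewens f <= Eewens g.
Proof. by move=> fg; apply: ler_sum => s _; rewrite ler_wpM2l ?ewens_ge0. Qed.

Lemma ler_norm_Eewens n (f : 'S_n -> R) :
  `|Eewens f| <= Eewens (fun s => `|f s|).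
Proof.
apply: (le_trans (ler_norm_sum _ _ _)); apply: ler_sum => s _.
by rewrite normrM ger0_norm ?ewens_ge0.
Qed.

(** The insertion recursion applied to the constant 1 multiplies the total mass by (theta + n) /
    (theta + n); this replaces an enumeration of permutations by their number of cycles. *)
Lemma Eewens1 n : Eewens (fun _ : 'S_n => 1) = 1.
Proof.
elim: n => [|n IH]; first by rewrite Eewens0.
rewrite (Eewens_recr (cst 0) n (fun=> 1)) -[RHS]IH; apply: eq_Eewens => s.
by rewrite sumr_const card_ord mulr1 divff ?gt_eqF ?thetaD_gt0.
Qed.

Lemma Eewens_cst n c : Eewens (fun _ : 'S_n => c) = c.
Proof. by rewrite -[RHS]mulr1 -(Eewens1 n) -EewensZ; apply: eq_Eewens => s; rewrite mulr1. Qed.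

End ewens_moments.

(** * Taylor bounds *)

Section taylor.
Variable R : realType.
Implicit Types x h : R.

Lemma ge0_of_derive (f df : R -> R) x : 0 <= x ->
  (forall y : R, is_derive y 1 f (df y)) -> (forall y, 0 <= y -> 0 <= df y) ->
  f 0 <= f x.
Proof.
move=> x0 fd df0; have [->//|xN0] := eqVneq x 0.
have {}x0 : 0 < x by rewrite lt_neqAle eq_sym xN0.
have cf : {within `[0, x], continuous f}.
  by apply: derivable_within_continuous => y _; exact: ex_derive.
have [c] := MVT x0 (fun y _ => fd y) cf.
rewrite in_itv/= => /andP[c0 _] E.
by rewrite -subr_ge0 E subr0 mulr_ge0 ?df0 ?ltW.
Qed.

Lemma sin_le_id x : 0 <= x -> sin x <= x.
Proof.
move=> x0.
have := @ge0_of_derive (fun y => y - sin y) (fun y => 1 - cos y) x x0.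
rewrite sin0 subr0 subr_ge0; by apply=> y; rewrite subr_ge0 cos_le1.
Qed.

Lemma normr_sin_le x : `|sin x| <= `|x|.
Proof.
wlog x0 : x / 0 <= x.
  move=> W; have [|/ltW x0] := leP 0 x; first exact: W.
  by rewrite -normrN -sinN -[in leRHS]normrN W// oppr_ge0.
have [x1|x1] := leP x 1; last first.
  by rewrite (le_trans (sin_max x))// ger0_norm// ltW.
rewrite !ger0_norm ?sin_le_id// sin_ge0_pi// x0 (le_trans x1)//.
by rewrite (le_trans _ (pi_ge2 R))// ler1n.
Qed.

Lemma cosB1E x : cos x - 1 = - 2 * sin (x / 2) ^+ 2.
Proof.
have -> : cos x = cos ((x / 2) *+ 2) by congr cos; rewrite mulr2n; lra.
by rewrite cos_mulr2n cos2sin2; ring.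
Qed.

Lemma cos_ge_taylor2 x : 0 <= cos x - 1 + x ^+ 2 / 2.
Proof.
rewrite cosB1E; have : sin (x / 2) ^+ 2 <= (x / 2) ^+ 2.
  rewrite -[leLHS]real_normK ?num_real// -[leRHS]real_normK ?num_real//.
  by rewrite lerXn2r ?nnegrE// normr_sin_le.
by rewrite exprMn; lra.
Qed.

Lemma sin_taylor1 x : `|sin x - x| <= `|x| ^+ 3.
Proof.
wlog x0 : x / 0 <= x.
  move=> W; have [|/ltW x0] := leP 0 x; first exact: W.
  by rewrite -normrN opprD -sinN -[in leRHS]normrN W// oppr_ge0.
rewrite ler0_norm ?subr_le0 ?sin_le_id// opprB ger0_norm// -subr_ge0.
have := @ge0_of_derive (fun y => y ^+ 3 - (y - sin y))
  (fun y => 3 * y ^+ 2 - (1 - cos y)) x x0.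
rewrite expr0n sin0 !subr0; apply=> y.
  apply: is_deriveB; apply: is_derive_eq.
  by rewrite /GRing.scale/= !mulr1; ring.
by move=> _; have := cos_ge_taylor2 y; nra.
Qed.

(** With s = sin (x / 2), the left side is the difference of squares 2 (x/2 - s) (x/2 + s), whose
    factors are of order 3 and 1. The constant is not sharp; only the order of the remainder matters
    later. *)
Lemma cos_le_taylor2 x : cos x - 1 + x ^+ 2 / 2 <= x ^+ 4.
Proof.
rewrite cosB1E; have := sin_taylor1 (x / 2); have := normr_sin_le (x / 2).
wlog x0 : x / 0 <= x.
  move=> W; have [|/ltW x0] := leP 0 x; first exact: W.
  move: (W (- x)); rewrite (mulNr x) sinN !normrN oppr_ge0 -opprD normrN.
  by rewrite -[4%N]/(2 * 2)%N !exprM !sqrrN; apply.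
have y0 : 0 <= x / 2 by rewrite divr_ge0.
rewrite (ger0_norm y0) !ler_norml => /andP[h1 h2] /andP[h3 h4].
set s := sin _ in h1 h2 h3 h4 *.
have -> : - 2 * s ^+ 2 + x ^+ 2 / 2 = 2 * (x / 2 - s) * (x / 2 + s) by field.
have A : 0 <= x / 2 + s by lra.
have B : x / 2 + s <= x by lra.
have C : x / 2 - s <= (x / 2) ^+ 3 by lra.
apply: (@le_trans _ _ (2 * (x / 2) ^+ 3 * x)); last first.
  have : 0 <= x ^+ 4 by rewrite exprn_ge0.
  by rewrite !exprS expr0; lra.
apply: ler_pM => //; first by rewrite mulr_ge0//; lra.
by rewrite ler_pM2l.
Qed.

Lemma cosD_taylor1 x h : `|cos (x + h) - cos x + h * sin x| <= 3 * h ^+ 2.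
Proof.
have T := sin_taylor1 h; have N := normr_sin_le h.
have E2 : `|sin h - h| <= 2 * h ^+ 2.
  have h2 : h ^+ 2 = `|h| ^+ 2 by rewrite real_normK ?num_real.
  have [h1|h1] := leP `|h| 1.
    apply: (le_trans T); rewrite h2; have := normr_ge0 h; nra.
  apply: (le_trans (ler_normB _ _)); rewrite h2; nra.
have C1 := cos_ge_taylor2 h; have C2 := cos_le1 h.
have -> : cos (x + h) - cos x + h * sin x =
    cos x * (cos h - 1) - sin x * (sin h - h) by rewrite cosD; ring.
apply: (le_trans (ler_normB _ _)); rewrite !normrM.
have A : `|cos x| * `|cos h - 1| <= h ^+ 2 / 2.
  have D : `|cos h - 1| <= h ^+ 2 / 2 by rewrite ler0_norm ?subr_le0//; lra.
  by rewrite -[leRHS]mul1r; apply: ler_pM => //; exact: cos_max.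
have B : `|sin x| * `|sin h - h| <= 2 * h ^+ 2.
  by rewrite -[leRHS]mul1r; apply: ler_pM => //; exact: sin_max.
by apply: (le_trans (lerD A B)); have := sqr_ge0 h; lra.
Qed.

Lemma cosD_taylor2 x h :
  `|cos (x + h) - cos x + h * sin x + h ^+ 2 / 2 * cos x| <= h ^+ 4 + `|h| ^+ 3.
Proof.
have -> : cos (x + h) - cos x + h * sin x + h ^+ 2 / 2 * cos x =
    cos x * (cos h - 1 + h ^+ 2 / 2) - sin x * (sin h - h).
  by rewrite cosD; ring.
apply: (le_trans (ler_normB _ _)); rewrite !normrM; apply: lerD.
  rewrite -[leRHS]mul1r; apply: ler_pM => //; first exact: cos_max.
  by rewrite ger0_norm ?cos_ge_taylor2// cos_le_taylor2.
by rewrite -[leRHS]mul1r; apply: ler_pM => //; [exact: sin_max|exact: sin_taylor1].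
Qed.

(** Both 1 + x <= e^x and 1 - x <= e^(-x) are used: the second one, multiplied by e^x, bounds the
    remainder by x (e^x - 1). *)
Lemma expR_taylor1 x : `|expR x - 1 - x| <= x ^+ 2 * expR `|x|.
Proof.
have L := expR_ge1Dx x; have := expR_ge1Dx (- x).
have P := expR_gt0 x => M.
have U : expR x - 1 - x <= x * (expR x - 1).
  have : expR x * (1 - x) <= expR x * expR (- x) by rewrite ler_pM2l.
  by rewrite expRxMexpNx_1; lra.
rewrite ger0_norm; last by lra.
apply: (le_trans U); have [x0|x0] := leP 0 x.
  rewrite (ger0_norm x0) expr2 -mulrA ler_wpM2l//.
  have : expR x * (1 - x) <= expR x * expR (- x) by rewrite ler_pM2l.
  by rewrite expRxMexpNx_1; lra.
rewrite (ltr0_norm x0) expr2 -mulrA; apply: ler_wnM2l; first exact: ltW.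
have E1 : 1 <= expR (- x) by apply: le_trans M; lra.
apply: (@le_trans _ _ x); last lra.
by rewrite ger_nMr.
Qed.

Lemma expRN_taylor1 x : 0 <= x -> `|1 - x - expR (- x)| <= x ^+ 2.
Proof.
move=> x0; have L := expR_ge1Dx (- x); have L2 := expR_ge1Dx x.
have P := expR_gt0 (- x).
have : expR (- x) * (1 + x) <= expR (- x) * expR x by rewrite ler_pM2l.
rewrite [_ * expR x]mulrC expRxMexpNx_1 => U.
have := ler_wpM2l x0 L; rewrite distrC ger0_norm; last by lra.
by move: U; rewrite !mulrDr !mulr1 (mulrC (expR _)) expr2; lra.
Qed.

(** This is how an integral depending on a parameter is differentiated in [is_derive_normal_cos]: a
    Taylor bound on the integrand, once integrated, yields the quadratic error. *)
Lemma is_derive_quadratic (f : R -> R) x l C :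
  (forall h, `|h| <= 1 -> `|f (x + h) - f x - h * l| <= C * h ^+ 2) ->
  is_derive x (1 : R) f l.
Proof.
move=> H.
have C0 : 0 <= C.
  have := H 1; rewrite normr1 => /(_ (lexx _)); rewrite expr1n mulr1.
  exact: le_trans.
have L : h^-1 *: ((f \o shift x) (h *: 1) - f x) @[h --> 0^'] --> l.
  apply/cvgrPdist_le => e e0; near=> h.
  have hN0 : h != 0 by near: h; exact: nbhs_dnbhs_neq.
  have h1 : `|h| <= 1.
    near: h; apply: dnbhs0_le; exact: ltr01.
  have h2 : `|h| <= e / (C + 1).
    by near: h; apply: dnbhs0_le; rewrite divr_gt0// ltr_wpDl.
  have -> : l - h^-1 *: ((f \o shift x) (h *: 1) - f x) =
      - (h^-1 * (f (x + h) - f x - h * l)).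
    rewrite /= /GRing.scale/= mulr1 [h + x]addrC; field => //.
  rewrite normrN normrM normfV ler_pdivrMl ?normr_gt0//.
  apply: (le_trans (H h h1)).
  rewrite -(real_normK (num_real h)) expr2 mulrCA ler_wpM2l//.
  move: h2; rewrite ler_pdivlMr ?ltr_wpDl// => h2.
  by apply: le_trans h2; rewrite mulrC ler_wpM2l// lerDl.
apply: DeriveDef; first by apply/cvg_ex; exists l.
exact/cvg_lim.
Unshelve. all: by end_near. Qed.

End taylor.

(** * The deficit martingale *)

Section increments.
Variables (R : realType) (theta : R).
Hypothesis theta_gt0 : 0 < theta.
Notation E := (Eewens theta).
Implicit Types (a : nat -> R) (f g : R -> R).

(* Multiplying by [theta + n - 1] turns the centered deficits of the insertion
   chain into a martingale, with increments [incr_fix] and [incr]. *)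
Definition mart a n (s : 'S_n) : R :=
  (theta + n%:R - 1) * deficits a s - \sum_(i < n) a i * i%:R.

Definition incr_fix a n (s : 'S_n) : R := deficits a s - n%:R * a n.

Definition incr a n (s : 'S_n) (j : 'I_n) : R :=
  incr_fix a s + (theta + n%:R) * (a n - a j * (s j < j)%N%:R).

(** Conditional expectation of [f] at the increment of [mart], given the permutation [s] of size
    [n]. *)
Definition cmean a n (s : 'S_n) f : R :=
  (theta * f (incr_fix a s) + \sum_j f (incr a s j)) / (theta + n%:R).

(* The conditional variance of the increment of [mart], see [cmean_quadratic]. *)
Definition cvar a n (s : 'S_n) : R :=
  (theta + n%:R) * (n%:R * a n ^+ 2 - 2 * a n * deficits a s +
    deficits (fun i => a i ^+ 2) s) - (n%:R * a n - deficits a s) ^+ 2.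

Lemma Eewens_mart_recr a n g :
  E (fun s : 'S_n.+1 => g (mart a s)) =
  E (fun s : 'S_n => cmean a s (fun x => g (mart a s + x))).
Proof.
rewrite /mart (Eewens_recr theta a n (fun u =>
  g ((theta + n.+1%:R - 1) * u - \sum_(i < n.+1) a i * i%:R))).
apply: eq_Eewens => s; rewrite /cmean !big_ord_recr/=; congr ((_ * g _ + _) / _).
  by rewrite /incr_fix -natr1; ring.
by apply: eq_bigr => j _; congr g; rewrite /incr /incr_fix -natr1; ring.
Qed.

(** The absence of [q] on the right is the martingale property. Most later estimates compare a test
    function with a quadratic by [le_cmean] and then evaluate the quadratic here. *)
Lemma cmean_quadratic a n (s : 'S_n) p q r :
  cmean a s (fun x => p + q * x + r * x ^+ 2) = p + r * cvar a s.
Proof.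
have tn : theta + n%:R != 0 by rewrite gt_eqF// thetaD_gt0.
rewrite /cmean.
have -> : \sum_(j < n) (p + q * incr a s j + r * incr a s j ^+ 2) =
   n%:R * (p + q * (incr_fix a s + (theta + n%:R) * a n) +
     r * (incr_fix a s + (theta + n%:R) * a n) ^+ 2)
   - (q * (theta + n%:R) + r * 2 * (incr_fix a s + (theta + n%:R) * a n) * (theta + n%:R))
     * deficits a s
   + r * (theta + n%:R) ^+ 2 * deficits (fun i => a i ^+ 2) s.
  rewrite /deficits !mulr_sumr -sumrN.
  rewrite -[n in n%:R * (p + _ + _)]card_ord mulr_natl -sumr_const -!big_split/=.
  apply: eq_bigr => j _; rewrite /incr.
  by case: (s j < j)%N => /=; ring.
by rewrite /cvar /incr_fix; field.
Qed.

(** The increments are bounded: [incr_fix] contributes at most 2 A n and the inserted term at most 2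
    A (theta + n), hence the radius with constant 4. *)
Lemma le_cmean a n (s : 'S_n) A f g :
  (forall i, `|a i| <= A) ->
  (forall x, `|x| <= 4 * A * (theta + n%:R) -> f x <= g x) ->
  cmean a s f <= cmean a s g.
Proof.
move=> aA fg; have tn := thetaD_gt0 theta_gt0 n.
have A0 : 0 <= A := le_trans (normr_ge0 _) (aA 0%N).
have n0 : 0 <= n%:R :> R := ler0n _ n.
have Az i (b : bool) : `|a i * b%:R| <= A.
  by case: b; rewrite ?mulr1 ?mulr0 ?normr0.
have S : `|deficits a s| <= n%:R * A.
  rewrite (le_trans (ler_norm_sum _ _ _))//.
  rewrite -[n in n%:R]card_ord mulr_natl -sumr_const.
  by apply: ler_sum => i _; exact: Az.
have F : `|incr_fix a s| <= 2 * A * n%:R.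
  have N : `|n%:R * a n| <= n%:R * A by rewrite normrM ger0_norm// ler_wpM2l.
  by rewrite (le_trans (ler_normB _ _))// (le_trans (lerD S N))//; lra.
have nt : A * n%:R <= A * (theta + n%:R) by rewrite ler_wpM2l// lerDr ltW.
rewrite /cmean ler_pM2r ?invr_gt0//; apply: lerD.
  by rewrite ler_pM2l// fg// (le_trans F)//; nra.
apply: ler_sum => j _; apply: fg; rewrite /incr.
have G : `|(theta + n%:R) * (a n - a j * (s j < j)%N%:R)| <= (theta + n%:R) * (2 * A).
  rewrite normrM gtr0_norm// ler_pM2l// (le_trans (ler_normB _ _))//.
  by have := lerD (aA n) (Az j (s j < j)%N); lra.
by rewrite (le_trans (ler_normD _ _))// (le_trans (lerD F G))//; nra.
Qed.

Lemma cvar_ge0 a n (s : 'S_n) : 0 <= cvar a s.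
Proof.
have := cmean_quadratic a s 0 0 1; rewrite add0r mul1r => <-.
have q (x : R) : 0 <= 0 + 0 * x + 1 * x ^+ 2 by have := sqr_ge0 x; lra.
rewrite /cmean divr_ge0//; last exact/ltW/thetaD_gt0.
by rewrite addr_ge0 ?mulr_ge0 ?q ?sumr_ge0// ltW.
Qed.

Lemma cvar_le a n (s : 'S_n) A : (forall i, `|a i| <= A) ->
  cvar a s <= (4 * A * (theta + n%:R)) ^+ 2.
Proof.
move=> aA.
have := cmean_quadratic a s 0 0 1; rewrite add0r mul1r => <-.
have := cmean_quadratic a s ((4 * A * (theta + n%:R)) ^+ 2) 0 0.
rewrite mul0r addr0 => <-; apply: le_cmean => // x xb.
rewrite !(mul0r, addr0, add0r, mul1r).
rewrite -(real_normK (num_real x)) lerXn2r ?nnegrE//.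
exact: le_trans xb.
Qed.

Lemma Eewens_mart_sqrS a n :
  E (fun s : 'S_n.+1 => mart a s ^+ 2) =
  E (fun s : 'S_n => mart a s ^+ 2) + E (fun s : 'S_n => cvar a s).
Proof.
rewrite (Eewens_mart_recr a n (fun x => x ^+ 2)) -EewensD; apply: eq_Eewens => s.
have := cmean_quadratic a s (mart a s ^+ 2) (2 * mart a s) 1.
rewrite mul1r => <-; rewrite /cmean; congr ((_ * _ + _) / _); first by rewrite /=; ring.
by apply: eq_bigr => j _ /=; ring.
Qed.

Lemma Eewens_mart a n : E (fun s : 'S_n => mart a s) = 0.
Proof.
elim: n => [|n IH].
  by rewrite Eewens0 /mart /deficits !big_ord0 mulr0 subr0.
rewrite (Eewens_mart_recr a n id) -[RHS]IH; apply: eq_Eewens => s.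
have := cmean_quadratic a s (mart a s) 1 0; rewrite mul0r addr0 => H.
rewrite -[RHS]H /cmean; congr ((_ * _ + _) / _); first by rewrite /=; ring.
by apply: eq_bigr => j _ /=; ring.
Qed.

Lemma mart0 a (s : 'S_0) : mart a s = 0.
Proof. by rewrite /mart /deficits !big_ord0 mulr0 subr0. Qed.

Section moments.
Variables (a : nat -> R) (A : R).
Hypothesis aA : forall i, `|a i| <= A.

Let A_ge0 : 0 <= A. Proof. exact: le_trans (normr_ge0 _) (aA 0%N). Qed.

(** The bound [D] stays fixed along the induction, so that every increment up to size n is at most 4
    A D. It will be theta + n - 1, the factor that turns the martingale back into centered
    deficits. *)
Lemma Eewens_mart_sqr_le n (D : R) : (forall k, (k < n)%N -> theta + k%:R <= D) ->
  E (fun s : 'S_n => mart a s ^+ 2) <= n%:R * (4 * A * D) ^+ 2.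
Proof.
elim: n => [|n IH] nD; first by rewrite Eewens0 mart0 expr0n mul0r.
rewrite Eewens_mart_sqrS -natr1 mulrDl mul1r lerD//.
  by apply: IH => k kn; apply: nD; exact: ltnW.
rewrite -[leRHS](Eewens_cst theta_gt0 n); apply: le_Eewens => // s.
apply: (le_trans (cvar_le _ aA)).
have tn := thetaD_gt0 theta_gt0 n.
have D0 : 0 <= D by apply: le_trans (nD n _); rewrite ?ltW.
by rewrite lerXn2r ?nnegrE ?mulr_ge0// ?ler_wpM2l ?mulr_ge0 ?nD// ltW.
Qed.

(** With b = 4 A D, one step adds at most 8 b^2 E(mart^2) + 3 b^4, and E(mart^2) <= n b^2; since 8 n
    + 3 is at most 11 (2 n + 1), the constant 11 passes through the induction. *)
Lemma Eewens_mart_pow4_le n (D : R) : (forall k, (k < n)%N -> theta + k%:R <= D) ->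
  E (fun s : 'S_n => mart a s ^+ 4) <= 11 * n%:R ^+ 2 * (4 * A * D) ^+ 4.
Proof.
elim: n => [|n IH] nD.
  by rewrite Eewens0 mart0 !expr0n/= mulr0 mul0r.
have tn := thetaD_gt0 theta_gt0 n.
have D0 : 0 <= D by apply: le_trans (nD n _); rewrite ?ltW.
have nD' k : (k < n)%N -> theta + k%:R <= D.
  by move=> kn; apply: nD; exact: ltnW.
pose b := 4 * A * D.
have b0 : 0 <= b by rewrite !mulr_ge0.
rewrite (Eewens_mart_recr a n (fun x => x ^+ 4)).
apply: (@le_trans _ _ (E (fun s : 'S_n => mart a s ^+ 4 +
   (8 * b ^+ 2 * mart a s ^+ 2 + 3 * b ^+ 4)))).
  apply: le_Eewens => // s; set m := mart a s.
  have := cmean_quadratic a s (m ^+ 4 + (8 * b ^+ 2 * m ^+ 2 + 3 * b ^+ 4)) (4 * m ^+ 3) 0.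
  rewrite mul0r addr0 => <-; apply: (le_cmean _ aA) => x xb.
  have {}xb : `|x| <= b.
    by apply: (le_trans xb); rewrite ler_wpM2l ?mulr_ge0// nD.
  have x2 : x ^+ 2 <= b ^+ 2.
    by rewrite -(real_normK (num_real x)) lerXn2r ?nnegrE.
  have x4 : x ^+ 4 <= b ^+ 4.
    by rewrite !(exprM _ 2 2) lerXn2r ?nnegrE ?sqr_ge0.
  rewrite mul0r addr0.
  (* The term 4 m x^3 has no sign and is absorbed by completing a square; the term 4 m^3 x has
     conditional mean zero. *)
  have -> : (m + x) ^+ 4 = m ^+ 4 + 4 * m ^+ 3 * x + 8 * m ^+ 2 * x ^+ 2 +
     3 * x ^+ 4 - 2 * (m * x - x ^+ 2) ^+ 2 by ring.
  have := sqr_ge0 (m * x - x ^+ 2).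
  have : m ^+ 2 * x ^+ 2 <= m ^+ 2 * b ^+ 2 by rewrite ler_wpM2l ?sqr_ge0.
  lra.
rewrite !EewensD EewensZ Eewens_cst//.
have := IH nD'; have := Eewens_mart_sqr_le nD'; rewrite -/b.
set e2 := E _; set e4 := E _ => h2 h4.
have n0 : 0 <= n%:R :> R := ler0n _ n.
have b4 : 0 <= b ^+ 4 by rewrite exprn_ge0.
have : 8 * b ^+ 2 * e2 <= 8 * b ^+ 2 * (n%:R * b ^+ 2).
  by apply: ler_wpM2l h2; rewrite mulr_ge0 ?sqr_ge0.
rewrite -[n.+1%:R]natr1.
have -> : 8 * b ^+ 2 * (n%:R * b ^+ 2) = 8 * n%:R * b ^+ 4 by ring.
have : 0 <= n%:R * b ^+ 4 by rewrite mulr_ge0.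
have -> : 11 * (n%:R + 1) ^+ 2 * b ^+ 4 =
  11 * n%:R ^+ 2 * b ^+ 4 + 22 * (n%:R * b ^+ 4) + 11 * b ^+ 4 by ring.
lra.
Qed.

End moments.

Lemma mart_centered a n (s : 'S_n.+1) :
  mart a s = (theta + n%:R) * (deficits a s - E (fun s : 'S_n.+1 => deficits a s)).
Proof.
have tn := thetaD_gt0 theta_gt0 n.
have := Eewens_mart a n.+1; rewrite /mart EewensB EewensZ Eewens_cst//.
by rewrite -natr1 addrA addrK mulrBr => /eqP; rewrite subr_eq0 => /eqP ->.
Qed.

(** The mean is read off from [Eewens_mart]: the point i is a deficit with probability i / (theta +
    n) at size n + 1. *)
Lemma Eewens_deficits a n :
  E (fun s : 'S_n.+1 => deficits a s) =
  (\sum_(i < n.+1) a i * i%:R) / (theta + n%:R).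
Proof.
have tn := thetaD_gt0 theta_gt0 n.
have := Eewens_mart a n.+1; rewrite /mart EewensB EewensZ Eewens_cst//.
rewrite -natr1 addrA addrK => /eqP; rewrite subr_eq0 => /eqP <-.
by rewrite mulrC mulKf// gt_eqF.
Qed.

End increments.

(** * Central limit theorem for deficits *)

Section clt.
Variables (R : realType) (theta : R).
Hypothesis theta_gt0 : 0 < theta.
Notation E := (Eewens theta).
Variables (a : nat -> R) (A : R).
Hypothesis A_gt0 : 0 < A.
Hypothesis aA : forall i, `|a i| <= A.

Definition var_deficits (b : nat -> R) n : R :=
  E (fun s : 'S_n => (deficits b s - E (fun s : 'S_n => deficits b s)) ^+ 2).

(** Instead of the Cauchy-Schwarz inequality: |X| <= X^2 / (2 y) + y / 2 pointwise. *)
Lemma Eewens_norm_le n (X : 'S_n -> R) (y : R) : 0 < y ->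
  E (fun s => X s ^+ 2) <= y ^+ 2 -> E (fun s => `|X s|) <= y.
Proof.
move=> y0 XY.
apply: (@le_trans _ _ (E (fun s => (2 * y)^-1 * X s ^+ 2 + y / 2))).
  apply: le_Eewens => // s; rewrite -subr_ge0.
  rewrite -(real_normK (num_real (X s))).
  rewrite (_ : _ - _ = (2 * y)^-1 * (`|X s| - y) ^+ 2); last first.
    by field; rewrite gt_eqF.
  by rewrite mulr_ge0 ?sqr_ge0// invr_ge0 mulr_ge0// ltW.
rewrite EewensD Eewens_cst// EewensZ.
apply: (@le_trans _ _ ((2 * y)^-1 * y ^+ 2 + y / 2)).
  by rewrite lerD2r; apply: ler_wpM2l => //; rewrite invr_ge0 mulr_ge0// ltW.
by rewrite le_eqVlt; apply/orP; left; apply/eqP; field; rewrite gt_eqF.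
Qed.

(** This allows a deviation to be estimated around a convenient center instead of the mean, at the
    price of a factor 2. *)
Lemma Eewens_abs_dev_le n (X : 'S_n -> R) c :
  E (fun s => `|X s - E X|) <= 2 * E (fun s => `|X s - c|).
Proof.
have H : `|c - E X| <= E (fun s => `|X s - c|).
  rewrite distrC -[c in leLHS](Eewens_cst theta_gt0 n) -EewensB.
  exact: ler_norm_Eewens.
apply: (@le_trans _ _ (E (fun s => `|X s - c| + `|c - E X|))).
  apply: le_Eewens => // s.
  by rewrite (le_trans _ (ler_normD _ _))// addrA subrK.
by rewrite EewensD Eewens_cst// mulr2n mulrDl mul1r lerD2l.
Qed.

Lemma var_deficits_mart b n :
  E (fun s : 'S_n.+1 => mart theta b s ^+ 2) =
  (theta + n%:R) ^+ 2 * var_deficits b n.+1.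
Proof.
rewrite /var_deficits -EewensZ; apply: eq_Eewens => s.
by rewrite (mart_centered theta_gt0) exprMn.
Qed.

Lemma var_deficits_le (b : nat -> R) (B : R) n : (forall i, `|b i| <= B) ->
  var_deficits b n <= n%:R * (4 * B) ^+ 2.
Proof.
case: n => [|n] bB.
  by rewrite /var_deficits !Eewens0 subrr expr0n mul0r.
have tn := thetaD_gt0 theta_gt0 n.
have H : forall k, (k < n.+1)%N -> theta + k%:R <= theta + n%:R.
  by move=> k kn; rewrite lerD2l ler_nat.
have := Eewens_mart_sqr_le theta_gt0 bB H; rewrite var_deficits_mart.
by rewrite (exprMn _ (4 * B)) mulrA [leRHS]mulrC ler_pM2l// exprn_gt0.
Qed.

Lemma pow4_deficits_le (b : nat -> R) (B : R) n : (forall i, `|b i| <= B) ->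
  E (fun s : 'S_n => (deficits b s - E (fun s : 'S_n => deficits b s)) ^+ 4) <=
  11 * n%:R ^+ 2 * (4 * B) ^+ 4.
Proof.
case: n => [|n] bB.
  by rewrite !Eewens0 subrr !expr0n mulr0 mul0r.
have tn := thetaD_gt0 theta_gt0 n.
have H : forall k, (k < n.+1)%N -> theta + k%:R <= theta + n%:R.
  by move=> k kn; rewrite lerD2l ler_nat.
have := Eewens_mart_pow4_le theta_gt0 bB H.
under [X in X <= _]eq_Eewens do rewrite (mart_centered theta_gt0) exprMn.
rewrite EewensZ.
by rewrite (exprMn _ (4 * B)) mulrA [leRHS]mulrC ler_pM2l// exprn_gt0.
Qed.

(** The conditional variance is a quadratic polynomial in two numbers of deficits, whose L1
    deviations are at most 4 A q and 4 A^2 q. Their coefficients are at most 6 A (theta + N) and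
    theta + N, whence 56 = 2 (6 * 4 + 4). The result is smaller by an order of sqrt N than the bound
    of order N^2 on [cvar]. *)
Lemma cvar_dev_le n (q : R) : 0 < q -> n.+1%:R <= q ^+ 2 ->
  E (fun s : 'S_n.+1 => `|cvar theta a s - E (fun s : 'S_n.+1 => cvar theta a s)|)
  <= 56 * A ^+ 2 * (theta + n.+1%:R) * q.
Proof.
move=> q0 nq; have tn := thetaD_gt0 theta_gt0 n.+1.
have A0 := ltW A_gt0.
pose a2 i := a i ^+ 2.
have a2A i : `|a2 i| <= A ^+ 2 by rewrite normrX lerXn2r ?nnegrE.
pose u (s : 'S_n.+1) := deficits a s - E (fun s : 'S_n.+1 => deficits a s).
pose u2 (s : 'S_n.+1) := deficits a2 s - E (fun s : 'S_n.+1 => deficits a2 s).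
have dev (b : nat -> R) B : 0 < B -> (forall i, `|b i| <= B) ->
    E (fun s : 'S_n.+1 => `|deficits b s - E (fun s : 'S_n.+1 => deficits b s)|)
    <= 4 * B * q.
  move=> B0 bB; apply: Eewens_norm_le; first by rewrite !mulr_gt0.
  apply: (le_trans (var_deficits_le _ bB)).
  by rewrite (exprMn _ (4 * B)) mulrC ler_wpM2l ?sqr_ge0.
have n0 : 0 <= n.+1%:R :> R := ler0n _ _.
have Sle (s : 'S_n.+1) : `|deficits a s| <= n.+1%:R * A.
  rewrite (le_trans (ler_norm_sum _ _ _))//.
  have -> : n.+1%:R * A = \sum_(i < n.+1) A by rewrite sumr_const card_ord mulr_natl.
  by apply: ler_sum => i _; case: (_ < _)%N; rewrite ?mulr1 ?mulr0 ?normr0 ?aA.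
have ESle : `|E (fun s : 'S_n.+1 => deficits a s)| <= n.+1%:R * A.
  apply: (le_trans (ler_norm_Eewens theta_gt0 _)).
  by rewrite -[leRHS](Eewens_cst theta_gt0 n.+1); exact: le_Eewens.
(* The center is [cvar] with the numbers of deficits replaced by their means; then [cvar - c] is
   linear in [u] and [u2], after factoring a difference of squares. *)
pose c := (theta + n.+1%:R) * (n.+1%:R * a n.+1 ^+ 2 - 2 * a n.+1 *
   E (fun s : 'S_n.+1 => deficits a s) + E (fun s : 'S_n.+1 => deficits a2 s)) -
  (n.+1%:R * a n.+1 - E (fun s : 'S_n.+1 => deficits a s)) ^+ 2.
apply: (le_trans (Eewens_abs_dev_le _ c)).
apply: (@le_trans _ _ (2 * E (fun s => (theta + n.+1%:R) * (6 * A) * `|u s| +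
    (theta + n.+1%:R) * `|u2 s|))).
  rewrite ler_pM2l//; apply: le_Eewens => // s.
  have -> : cvar theta a s - c = ((2 * (n.+1%:R * a n.+1) - deficits a s -
      E (fun s : 'S_n.+1 => deficits a s)) - (theta + n.+1%:R) * (2 * a n.+1)) * u s +
      (theta + n.+1%:R) * u2 s.
    by rewrite /cvar /c /u /u2 /a2; ring.
  rewrite (le_trans (ler_normD _ _))// !normrM (gtr0_norm tn).
  rewrite lerD2r ler_wpM2r//.
  have N1 : `|n.+1%:R * a n.+1| <= n.+1%:R * A.
    by rewrite normrM ger0_norm// ler_wpM2l.
  have N2 : `|(theta + n.+1%:R) * (2 * a n.+1)| <= (theta + n.+1%:R) * (2 * A).
    by rewrite !normrM (gtr0_norm tn) ler_pM2l// ger0_norm// ler_pM2l.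
  have N3 : n.+1%:R * A <= (theta + n.+1%:R) * A.
    by rewrite ler_wpM2r// lerDr ltW.
  move: N1 N2 (Sle s) ESle; rewrite !ler_norml.
  move=> /andP[? ?] /andP[? ?] /andP[? ?] /andP[? ?]; apply/andP; split; lra.
rewrite EewensD !EewensZ.
have D1 := dev a A A_gt0 aA.
have D2 := dev a2 (A ^+ 2) (exprn_gt0 _ A_gt0) a2A.
have : (theta + n.+1%:R) * (6 * A) * E (fun s => `|u s|) <=
   (theta + n.+1%:R) * (6 * A) * (4 * A * q).
  by apply: ler_wpM2l => //; rewrite !mulr_ge0// ltW.
have : (theta + n.+1%:R) * E (fun s => `|u2 s|) <=
   (theta + n.+1%:R) * (4 * A ^+ 2 * q).
  by apply: ler_wpM2l => //; rewrite ltW.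
rewrite expr2; lra.
Qed.

Lemma cvar_dev_bound n (q : R) : 0 < q -> n%:R <= q ^+ 2 ->
  E (fun s : 'S_n => `|cvar theta a s - E (fun s : 'S_n => cvar theta a s)|)
  <= 56 * A ^+ 2 * (theta + n%:R) * q.
Proof.
case: n => [|n] q0 nq; last exact: cvar_dev_le.
rewrite !Eewens0 subrr normr0 addr0.
by rewrite !mulr_ge0 ?sqr_ge0// ltW.
Qed.

(** Taylor expansion of the cosine at the current value: the linear term has conditional mean zero
    and the quadratic one gives [cvar]. The cubic and quartic remainders are each at most [eta ^+ 3]
    because [eta <= 1]. The second error is the cost of replacing [cvar] by its mean, which makes
    the factor deterministic. *)
Lemma Eewens_cos_step n (eps eta c : R) : 0 <= eps ->
  eps * (4 * A * (theta + n%:R)) <= eta -> eta <= 1 ->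
  `|E (fun s : 'S_n.+1 => cos (eps * mart theta a s + c)) -
    E (fun s : 'S_n => cos (eps * mart theta a s + c)) *
      (1 - eps ^+ 2 / 2 * E (fun s : 'S_n => cvar theta a s))| <=
  2 * eta ^+ 3 + eps ^+ 2 / 2 *
    E (fun s : 'S_n => `|cvar theta a s - E (fun s : 'S_n => cvar theta a s)|).
Proof.
move=> eps0 epsb eta1; set W := E (fun s : 'S_n => cvar theta a s).
have tn := thetaD_gt0 theta_gt0 n.
pose C (s : 'S_n) := cos (eps * mart theta a s + c).
have step (s : 'S_n) :
    `|cmean theta a s (fun x => cos (eps * (mart theta a s + x) + c)) -
      C s * (1 - eps ^+ 2 / 2 * cvar theta a s)| <= 2 * eta ^+ 3.
  set y := eps * mart theta a s + c.
  have T x : `|x| <= 4 * A * (theta + n%:R) ->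
      `|cos (eps * (mart theta a s + x) + c) -
        (cos y - eps * x * sin y - eps ^+ 2 / 2 * x ^+ 2 * cos y)| <= 2 * eta ^+ 3.
    move=> xb; have := cosD_taylor2 y (eps * x).
    have -> : y + eps * x = eps * (mart theta a s + x) + c by rewrite /y; ring.
    have -> : cos (eps * (mart theta a s + x) + c) - cos y + eps * x * sin y +
        (eps * x) ^+ 2 / 2 * cos y = cos (eps * (mart theta a s + x) + c) -
        (cos y - eps * x * sin y - eps ^+ 2 / 2 * x ^+ 2 * cos y) by field.
    move=> /le_trans; apply.
    have ex : `|eps * x| <= eta.
      by rewrite normrM ger0_norm// (le_trans _ epsb)// ler_wpM2l.
    have e3 : `|eps * x| ^+ 3 <= eta ^+ 3.
      by rewrite lerXn2r ?nnegrE// (le_trans (normr_ge0 _) ex).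
    have e4 : (eps * x) ^+ 4 <= `|eps * x| ^+ 3.
      rewrite -[(eps * x) ^+ 4]ger0_norm ?exprn_even_ge0// normrX exprSr.
      by rewrite ler_piMr ?exprn_ge0// (le_trans ex).
    lra.
  rewrite ler_norml; apply/andP; split.
    have := cmean_quadratic theta_gt0 a s (cos y - 2 * eta ^+ 3)
      (- (eps * sin y)) (- (eps ^+ 2 / 2 * cos y)).
    rewrite lerBrDr /C -/y.
    have -> : - (2 * eta ^+ 3) + cos y * (1 - eps ^+ 2 / 2 * cvar theta a s) =
      cos y - 2 * eta ^+ 3 + - (eps ^+ 2 / 2 * cos y) * cvar theta a s by ring.
    move=> <-; apply: (le_cmean theta_gt0 _ aA) => // x /T.
    by rewrite ler_norml => /andP[+ _]; lra.
  have := cmean_quadratic theta_gt0 a s (cos y + 2 * eta ^+ 3)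
    (- (eps * sin y)) (- (eps ^+ 2 / 2 * cos y)).
  rewrite lerBlDr /C -/y.
  have -> : 2 * eta ^+ 3 + cos y * (1 - eps ^+ 2 / 2 * cvar theta a s) =
    cos y + 2 * eta ^+ 3 + - (eps ^+ 2 / 2 * cos y) * cvar theta a s by ring.
  move=> <-; apply: (le_cmean theta_gt0 _ aA) => // x /T.
  by rewrite ler_norml => /andP[_ +]; lra.
rewrite (Eewens_mart_recr theta a n (fun x => cos (eps * x + c))).
have -> : E (fun s : 'S_n => C s) * (1 - eps ^+ 2 / 2 * W) =
    E (fun s : 'S_n => C s * (1 - eps ^+ 2 / 2 * W)).
  by rewrite mulrC -EewensZ; apply: eq_Eewens => s; rewrite mulrC.
rewrite -EewensB; apply: (le_trans (ler_norm_Eewens theta_gt0 _)).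
rewrite -[2 * eta ^+ 3](Eewens_cst theta_gt0 n) -EewensZ -EewensD.
apply: le_Eewens => // s.
rewrite -(subrK (C s * (1 - eps ^+ 2 / 2 * cvar theta a s)) (cmean _ _ _ _)) -addrA.
apply: (le_trans (ler_normD _ _)); apply: lerD; first exact: step.
rewrite -mulrBr normrM.
have -> : 1 - eps ^+ 2 / 2 * cvar theta a s - (1 - eps ^+ 2 / 2 * W) =
  - (eps ^+ 2 / 2 * (cvar theta a s - W)) by ring.
rewrite normrN normrM (ger0_norm (_ : 0 <= eps ^+ 2 / 2)) ?divr_ge0 ?sqr_ge0//.
rewrite ler_piMl ?cos_max// mulr_ge0// divr_ge0 ?sqr_ge0//.
Qed.

(** With eta = 4 A / q, the three terms bound, up to the common factor 1 / q^3, the errors of one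
    step: the Taylor remainder 2 eta^3, the deviation of [cvar], and the replacement of 1 - x by
    exp(-x) with x <= eta^2 / 2. There are N = q^2 steps, hence the final rate 1 / q. *)
Definition clt_const (A : R) : R := 128 * A ^+ 3 + 56 * A ^+ 2 + 64 * A ^+ 4.

Lemma Eewens_cos_clt n (q c : R) : (0 < n)%N -> 0 < q -> q ^+ 2 = n.+1%:R ->
  4 * A <= q ->
  `|E (fun s : 'S_n.+1 => cos ((deficits a s -
        E (fun s : 'S_n.+1 => deficits a s)) / q + c)) -
    expR (- (var_deficits a n.+1 / n.+1%:R / 2)) * cos c| <= clt_const A / q.
Proof.
move=> n0 q0 q2 qA; set D := theta + n%:R.
have tn : 0 < D := thetaD_gt0 theta_gt0 n.
have A0 := ltW A_gt0.
(* The scale is that of the last size and is kept for all smaller sizes [k]: at the end,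
   [eps * mart] is the centered number of deficits divided by sqrt N. *)
pose eps := (D * q)^-1.
have eps0 : 0 < eps by rewrite invr_gt0 mulr_gt0.
pose Q k := E (fun s : 'S_k => mart theta a s ^+ 2).
have Q0 k : 0 <= Q k.
  rewrite -(Eewens_cst theta_gt0 k 0); apply: le_Eewens => // s; exact: sqr_ge0.
(* This is where [0 < n] matters: it turns the remaining factor 1 / D in the deviation of [cvar]
   into 2 / q^2. *)
have DN : q ^+ 2 / 2 <= D.
  rewrite q2 -[n.+1%:R]natr1 /D; have : 1 <= n%:R :> R by rewrite ler1n.
  by have := theta_gt0; lra.
have main k : (k <= n.+1)%N ->
    `|E (fun s : 'S_k => cos (eps * mart theta a s + c)) -
      expR (- (eps ^+ 2 / 2 * Q k)) * cos c| <= k%:R * (clt_const A / q ^+ 3).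
  elim: k => [_|k IH kn].
    rewrite /Q !Eewens0 !mart0 expr0n !mulr0 add0r oppr0 expR0 !mul1r subrr.
    by rewrite normr0 mul0r.
  have kD : theta + k%:R <= D by rewrite lerD2l ler_nat.
  have tk := thetaD_gt0 theta_gt0 k.
  pose eta := 4 * A / q.
  have e1 : eps * (4 * A * (theta + k%:R)) <= eta.
    have -> : eps * (4 * A * (theta + k%:R)) = eta * ((theta + k%:R) / D).
      by rewrite /eps /eta; field; rewrite !gt_eqF.
    apply: ler_piMr; last by rewrite ler_pdivrMr// mul1r.
    exact: divr_ge0 (mulr_ge0 _ _) (ltW _).
  have e2 : eta <= 1 by rewrite /eta ler_pdivrMr// mul1r.
  have eta0 : 0 <= eta by rewrite divr_ge0 ?mulr_ge0// ltW.
  have S := Eewens_cos_step c (ltW eps0) e1 e2.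
  set W := E (fun s : 'S_k => cvar theta a s) in S.
  have W0 : 0 <= W.
    rewrite -(Eewens_cst theta_gt0 k 0); apply: le_Eewens => // s; exact: cvar_ge0.
  pose x := eps ^+ 2 / 2 * W.
  have x0 : 0 <= x by rewrite mulr_ge0// divr_ge0 ?sqr_ge0.
  have xle : x <= eta ^+ 2 / 2.
    have : W <= (4 * A * (theta + k%:R)) ^+ 2.
      rewrite -[leRHS](Eewens_cst theta_gt0 k); apply: le_Eewens => // s.
      exact: cvar_le.
    move=> /(ler_wpM2l (sqr_ge0 eps)); rewrite -exprMn => h.
    have : (eps * (4 * A * (theta + k%:R))) ^+ 2 <= eta ^+ 2.
      by rewrite lerXn2r ?nnegrE// !mulr_ge0// ltW.
    by rewrite /x; lra.
  have x1 : x <= 1.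
    have : eta ^+ 2 <= 1 by rewrite expr_le1.
    lra.
  have dev : eps ^+ 2 / 2 *
      E (fun s : 'S_k => `|cvar theta a s - W|) <= 56 * A ^+ 2 / q ^+ 3.
    have kq : k%:R <= q ^+ 2 by rewrite q2 ler_nat ltnW.
    have /(ler_wpM2l (_ : 0 <= eps ^+ 2 / 2)) := cvar_dev_bound q0 kq.
    move=> /(_ (divr_ge0 (sqr_ge0 _) (ler0n _ _)))/le_trans; apply.
    apply: (@le_trans _ _ (28 * A ^+ 2 / q * D^-1)).
      have -> : 28 * A ^+ 2 / q * D^-1 = eps ^+ 2 / 2 * (56 * A ^+ 2 * D * q).
        by rewrite /eps; field; rewrite !gt_eqF.
      apply: ler_wpM2l; first by rewrite divr_ge0 ?sqr_ge0.
      by rewrite ler_pM2r// ler_wpM2l// mulr_ge0 ?sqr_ge0.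
    have -> : 56 * A ^+ 2 / q ^+ 3 = 28 * A ^+ 2 / q * (q ^+ 2 / 2)^-1.
      by field; rewrite gt_eqF.
    apply: ler_wpM2l; first by rewrite divr_ge0 ?mulr_ge0 ?sqr_ge0// ltW.
    by rewrite lef_pV2 ?posrE// divr_gt0 ?exprn_gt0.
  have QS : Q k.+1 = Q k + W by rewrite /Q Eewens_mart_sqrS.
  rewrite QS mulrDr -/x opprD expRD.
  have y1 : expR (- (eps ^+ 2 / 2 * Q k)) <= 1.
    by rewrite expR_le1 oppr_le0 mulr_ge0// divr_ge0 ?sqr_ge0.
  have y0 := expR_ge0 (- (eps ^+ 2 / 2 * Q k)).
  have := IH (ltnW kn).
  move: S; rewrite -/x; set y := expR _ in y1 y0 *.
  set f1 := E _; set f0 := E _ => S I.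
  have -> : f1 - y * expR (- x) * cos c = (f1 - f0 * (1 - x)) +
     ((f0 - y * cos c) * (1 - x) + (y * cos c) * (1 - x - expR (- x))) by ring.
  apply: (le_trans (ler_normD _ _)).
  have -> : k.+1%:R * (clt_const A / q ^+ 3) =
     (2 * eta ^+ 3 + 56 * A ^+ 2 / q ^+ 3) +
     (k%:R * (clt_const A / q ^+ 3) + 64 * A ^+ 4 / q ^+ 3).
    by rewrite -[k.+1%:R]natr1 /clt_const /eta; field; rewrite gt_eqF.
  apply: lerD; first by apply: (le_trans S); rewrite lerD2l.
  apply: (le_trans (ler_normD _ _)); rewrite !normrM; apply: lerD.
    rewrite -[leRHS]mulr1; apply: ler_pM => //.
    by rewrite ger0_norm ?subr_ge0// gerBl.
  apply: (@le_trans _ _ (x ^+ 2)).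
    rewrite -[leRHS]mul1r; apply: ler_pM => //; last exact: expRN_taylor1.
    rewrite -[leRHS]mul1r; apply: ler_pM => //; last exact: cos_max.
    by rewrite ger0_norm.
  have : x ^+ 2 <= (eta ^+ 2 / 2) ^+ 2.
    by rewrite lerXn2r ?nnegrE// divr_ge0 ?sqr_ge0.
  move=> /le_trans; apply.
  have q1 : 1 <= q by rewrite -(@expr_ge1 _ 2 q _ (ltW q0))// q2 ler1n.
  have -> : (eta ^+ 2 / 2) ^+ 2 = 64 * A ^+ 4 / q ^+ 3 * q^-1.
    by rewrite /eta; field; rewrite gt_eqF.
  apply: ler_piMr; last by rewrite invf_le1.
  exact: divr_ge0 (mulr_ge0 _ (exprn_ge0 _ A0)) (exprn_ge0 _ (ltW _)).
have := main n.+1 (leqnn _).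
have -> : E (fun s : 'S_n.+1 => cos (eps * mart theta a s + c)) =
    E (fun s : 'S_n.+1 => cos ((deficits a s -
        E (fun s : 'S_n.+1 => deficits a s)) / q + c)).
  apply: eq_Eewens => s; rewrite (mart_centered theta_gt0) /eps; congr (cos (_ + _)).
  by rewrite -/D; field; rewrite !gt_eqF.
have -> : eps ^+ 2 / 2 * Q n.+1 = var_deficits a n.+1 / n.+1%:R / 2.
  by rewrite /Q var_deficits_mart -q2 /eps -/D; field; rewrite !gt_eqF.
have -> // : n.+1%:R * (clt_const A / q ^+ 3) = clt_const A / q.
by rewrite -q2; field; rewrite gt_eqF.
Qed.

End clt.

(** * Trigonometric integrals of the normal law *)

Section normal_density_integral.
Variables (R : realType) (s : R).
Hypothesis s0 : 0 < s.
Notation mu := (@lebesgue_measure R).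
Notation N := (normal_prob 0 s).
Local Open Scope ereal_scope.

(** The Radon-Nikodym derivative of the normal law agrees almost everywhere with its density, as
    both have the same integrals over measurable sets. *)
Lemma ge0_integral_normal_prob m (f : R -> R) : measurable_fun setT f ->
  (forall x, 0 <= f x)%R ->
  \int[normal_prob m s]_x (f x)%:E = \int[mu]_x (f x * normal_pdf m s x)%:E.
Proof.
move=> mf f0.
have dom := normal_prob_dominates m s.
rewrite -(Radon_Nikodym_SigmaFinite.change_of_variables dom)//; last exact/measurable_EFinP.
apply: ae_eq_integral => //.
- apply: emeasurable_funM; first exact/measurable_EFinP.
  exact: measurable_int (Radon_Nikodym_SigmaFinite.f_integrable dom).
- apply/measurable_EFinP/measurable_funM => //; exact: measurable_normal_pdf.
- suff : ae_eq mu setT (Radon_Nikodym_SigmaFinite.f (normal_prob m s) mu)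
      (fun x => (normal_pdf m s x)%:E).
    by apply: filterS => x /= H _; rewrite EFinM H.
  apply: integral_ae_eq => //.
  + exact: (Radon_Nikodym_SigmaFinite.f_integrable dom).
  + apply/measurable_EFinP; exact: measurable_normal_pdf.
  + by move=> E _ mE; rewrite -Radon_Nikodym_SigmaFinite.f_integral.
Qed.

Lemma integral_translation (G : R -> R) h : continuous G ->
  (forall x, 0 <= G x)%R ->
  \int[mu]_x (G x)%:E = \int[mu]_x (G (x + h)%R)%:E.
Proof.
move=> cG G0.
have d1 : (fun x : R => x + h)%R^`()%classic = cst 1%R.
  apply/funext => x; rewrite derive1E deriveD// derive_id derive_cst.
  exact: addr0.
rewrite (@increasing_ge0_integration_by_substitutionT _ (fun x => x + h)%R)//.
- by apply: eq_integral => x _; rewrite d1 !fctE mulr1.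
- by move=> x y xy; rewrite ltrD2r.
- by rewrite d1 => ?; exact: cvg_cst.
- by rewrite d1; exact: is_cvg_cst.
- by rewrite d1; exact: is_cvg_cst.
- exact: cvg_addrr_Ny.
- exact: cvg_addrr.
Qed.

(** Cameron-Martin formula: by completing the square, the exponential factor turns the density
    centered at 0 into the one centered at [h]. *)
Lemma normal_shift (G : R -> R) h : continuous G ->
  (forall x, 0 <= G x)%R ->
  \int[N]_x (G (x + h)%R)%:E =
  \int[N]_x (G x * expR ((h * x - h ^+ 2 / 2) / s ^+ 2))%:E.
Proof.
move=> cG G0.
have sN0 : s != 0%R by rewrite gt_eqF.
have cN m : continuous (normal_pdf m s) by exact: continuous_normal_pdf.
have pdfD x : (expR ((h * x - h ^+ 2 / 2) / s ^+ 2) * normal_pdf 0 s x =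
    normal_pdf h s x)%R.
  rewrite !normal_pdfE// mulrCA; congr (_ * _)%R.
  rewrite /normal_fun -expRD; congr expR; rewrite -[(s ^+ 2 *+ 2)%R]mulr_natr; field.
  exact: sN0.
rewrite ge0_integral_normal_prob//; last first.
  apply: measurableT_comp => //; first exact: continuous_measurable_fun.
  exact: measurable_funD.
rewrite ge0_integral_normal_prob; last 2 first.
- apply: measurable_funM; first exact: continuous_measurable_fun.
  apply: measurableT_comp => //; apply: measurable_funM => //.
  by apply: measurable_funB => //; exact: measurable_funM.
- by move=> x; rewrite mulr_ge0 ?expR_ge0.
under [in RHS]eq_integral do rewrite -mulrA pdfD.
rewrite [RHS](@integral_translation _ h); last 2 first.
- by move=> x; apply: cvgM; [exact: cG|exact: cN].
- by move=> x; rewrite mulr_ge0 ?normal_pdf_ge0.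
apply: eq_integral => x _; congr (_ * _)%:E.
by rewrite !normal_pdfE// /normal_fun addrK subr0.
Qed.

(** The translation formula for the constant 1 and the shift s^2 h says that the tilted law has mass
    1. *)
Lemma normal_mgf h : \int[N]_x (expR (h * x))%:E = (expR (s ^+ 2 * h ^+ 2 / 2))%:E.
Proof.
have sN0 : s != 0%R by rewrite gt_eqF.
have := @normal_shift (cst 1%R) (s ^+ 2 * h) (fun=> cvg_cst _) (fun=> ler01).
rewrite (eq_integral (cst 1))// integral_cst//= probability_setT mul1e => E.
have H x : (expR (h * x) = expR (s ^+ 2 * h ^+ 2 / 2) *
    (1 * expR ((s ^+ 2 * h * x - (s ^+ 2 * h) ^+ 2 / 2) / s ^+ 2)))%R.
  by rewrite mul1r -expRD; congr expR; field.
under eq_integral do rewrite H EFinM.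
rewrite ge0_integralZl//=; first by rewrite -E ?mule1// => y; exact: nbhs_filter.
apply/measurable_EFinP; apply: measurable_funM => //.
apply: measurableT_comp => //; apply: measurable_funM => //.
by apply: measurable_funB => //; exact: measurable_funM.
Qed.

End normal_density_integral.

Section normal_characteristic.
Variables (R : realType) (s : R).
Hypothesis s0 : 0 < s.
Notation N := (normal_prob 0 s).

(** A single integrable weight dominating all integrands below. The exponent 4 is enough for powers
    up to 4 and for y^2 e^y, which occurs in the remainder of the exponential. *)
Let w (x : R) := expR (4 * x) + expR (- 4 * x).
Let K := \int[N]_x w x.

Let w_ge_exp x : expR (4 * `|x|) <= w x.
Proof.
rewrite /w; have [x0|x0] := leP 0 x.
  by rewrite ger0_norm// lerDl expR_ge0.
by rewrite ltr0_norm// mulrN -mulNr lerDr expR_ge0.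
Qed.

Let w_ge1 x : 1 <= w x.
Proof.
by apply: le_trans (w_ge_exp x); rewrite -expR0 ler_expR mulr_ge0.
Qed.

Let w_ge_pow k x : (k <= 4)%N -> `|x| ^+ k <= w x.
Proof.
move=> k4; apply: le_trans (w_ge_exp x).
have h : `|x| <= expR `|x| by apply: le_trans (expR_ge1Dx _); rewrite lerDr.
apply: (@le_trans _ _ (expR `|x| ^+ k)); first by rewrite lerXn2r ?nnegrE// expR_ge0.
by rewrite expRM_natl ler_weXn2l// -expR0 ler_expR.
Qed.

Let mw : measurable_fun setT w.
Proof.
apply: measurable_funD; apply: measurableT_comp => //; exact: measurable_funM.
Qed.

Let iw : N.-integrable setT (EFin \o w).
Proof.
apply/integrableP; split; first exact/measurable_EFinP.
under eq_integral.
  move=> x _; rewrite /= ger0_norm ?addr_ge0 ?expR_ge0//; over.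
rewrite /w; under eq_integral do rewrite EFinD.
rewrite ge0_integralD//=; first by rewrite !(normal_mgf s0) -EFinD ltry.
all: by apply/measurable_EFinP; apply: measurableT_comp => //; exact: measurable_funM.
Qed.

Lemma integrable_normal_le (f : R -> R) (C : R) : measurable_fun setT f ->
  (forall x, `|f x| <= C * w x) -> N.-integrable setT (EFin \o f).
Proof.
move=> mf fC.
apply: (@le_integrable _ _ _ N setT measurableT (EFin \o f) (fun x => (C * w x)%:E)).
- exact/measurable_EFinP.
- by move=> x _; rewrite lee_fin (le_trans (fC x))// ler_norm.
- by under eq_fun do rewrite EFinM; apply: integrableZl.
Qed.

Lemma Rintegral_normal_le (f : R -> R) (C : R) : measurable_fun setT f ->
  (forall x, `|f x| <= C * w x) -> `|\int[N]_x f x| <= C * K.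
Proof.
move=> mf fC; have iF := integrable_normal_le mf fC.
apply: (le_trans (le_normr_Rintegral _ iF)) => //.
rewrite -RintegralZl//; apply: le_Rintegral => //.
- by apply: (@integrable_normal_le _ C) => [|x]; [exact: measurableT_comp|rewrite normr_id].
- by under [EFin \o _]funext do rewrite /= EFinM; apply: integrableZl.
Qed.

Let mcos t c : measurable_fun setT (fun x : R => cos (t * x + c)).
Proof.
have mcos : measurable_fun setT (@cos R).
  by apply: continuous_measurable_fun; exact: continuous_cos.
by apply: (measurableT_comp mcos); apply: measurable_funD.
Qed.

Let msin t c : measurable_fun setT (fun x : R => sin (t * x + c)).
Proof.
have msin : measurable_fun setT (@sin R).
  by apply: continuous_measurable_fun; exact: continuous_sin.
by apply: (measurableT_comp msin); apply: measurable_funD.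
Qed.

Let icos t c : N.-integrable setT (fun x => (cos (t * x + c))%:E).
Proof.
by apply: (@integrable_normal_le _ 1) => // x; rewrite mul1r (le_trans (cos_max _)).
Qed.

Let isin t c : N.-integrable setT (fun x => (sin (t * x + c))%:E).
Proof.
by apply: (@integrable_normal_le _ 1) => // x; rewrite mul1r (le_trans (sin_max _)).
Qed.

Let ixcos t c : N.-integrable setT (fun x => (x * cos (t * x + c))%:E).
Proof.
apply: (@integrable_normal_le _ 1) => [|x]; first exact: measurable_funM.
rewrite mul1r normrM (le_trans _ (@w_ge_pow 1 x _))// expr1.
by rewrite ler_piMr// cos_max.
Qed.

Let zero_of_small (Z C : R) : (forall u, 0 < u -> u <= 1 -> `|Z| <= C * u) -> Z = 0.
Proof.
move=> H; apply/eqP; rewrite -normr_eq0; apply/eqP/le_anti; rewrite normr_ge0 andbT.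
apply/ler_addgt0Pl => e e0; rewrite addr0.
have C0 : 0 <= C by have := H 1 ltr01 (lexx _); rewrite mulr1; exact: le_trans.
have c1 : 0 < C + 1 by rewrite ltr_wpDl.
have m0 : 0 < Num.min 1 (e / (C + 1)) by rewrite lt_min ltr01 divr_gt0.
apply: (le_trans (H _ m0 _)); first by rewrite ge_min lexx.
apply: (@le_trans _ _ ((C + 1) * (e / (C + 1)))); last by rewrite mulrC divfK// gt_eqF.
by apply: ler_pM => //; [exact: ltW|rewrite lerDl|rewrite ge_min lexx orbT].
Qed.

Let sqr_expR (y : R) : 0 <= y -> y ^+ 2 * expR y <= expR (4 * y).
Proof.
move=> y0; have h : y <= expR y by apply: le_trans (expR_ge1Dx _); rewrite lerDr.
have e1 : 1 <= expR y by rewrite -expR0 ler_expR.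
rewrite expRM_natl; apply: (@le_trans _ _ (expR y ^+ 2 * expR y)).
  by rewrite ler_wpM2r// lerXn2r ?nnegrE// (le_trans y0).
by rewrite -exprSr ler_weXn2l.
Qed.

(** First order expansion in [u] of the tilting factor for a translation by s^2 u. *)
Let exp_bound x u : 0 < u -> u <= 1 ->
  `|expR (u * x - s ^+ 2 * u ^+ 2 / 2) - 1 - u * x| <=
  (expR (4 * s ^+ 2) + s ^+ 2) * u ^+ 2 * w x.
Proof.
move=> u0 u1; set v := u * x - _ / 2.
have s20 : 0 <= s ^+ 2 := sqr_ge0 _.
have y0 : 0 <= `|x| + s ^+ 2 by rewrite addr_ge0.
have uu : u ^+ 2 <= u by rewrite expr2 ler_piMr// ltW.
have us : s ^+ 2 * u ^+ 2 / 2 <= s ^+ 2 * u.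
  have := ler_wpM2l s20 uu; have : 0 <= s ^+ 2 * u ^+ 2 by rewrite mulr_ge0 ?sqr_ge0.
  lra.
have vle : `|v| <= u * (`|x| + s ^+ 2).
  rewrite mulrDr; apply: (le_trans (ler_normB _ _)); apply: lerD.
    by rewrite normrM (gtr0_norm u0).
  rewrite ger0_norm; first by rewrite (mulrC u).
  by rewrite divr_ge0// mulr_ge0// sqr_ge0.
have vle1 : `|v| <= `|x| + s ^+ 2 by rewrite (le_trans vle)// ler_piMl.
have -> : expR v - 1 - u * x = (expR v - 1 - v) - s ^+ 2 * u ^+ 2 / 2.
  by rewrite /v; ring.
apply: (le_trans (ler_normB _ _)).
rewrite (_ : _ * w x = expR (4 * s ^+ 2) * u ^+ 2 * w x + s ^+ 2 * u ^+ 2 * w x); last by ring.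
apply: lerD.
  apply: (le_trans (expR_taylor1 v)).
  apply: (@le_trans _ _ ((u * (`|x| + s ^+ 2)) ^+ 2 * expR (`|x| + s ^+ 2))).
    apply: ler_pM; rewrite ?sqr_ge0 ?expR_ge0// ?ler_expR//.
    by rewrite -(real_normK (num_real v)) lerXn2r ?nnegrE// mulr_ge0// ltW.
  set y := `|x| + s ^+ 2.
  have yy : y ^+ 2 * expR y <= expR (4 * s ^+ 2) * w x.
    apply: (le_trans (sqr_expR y0)).
    rewrite (_ : 4 * y = 4 * s ^+ 2 + 4 * `|x|); last by rewrite /y; ring.
    by rewrite expRD ler_wpM2l ?expR_ge0.
  have -> : (u * y) ^+ 2 * expR y = u ^+ 2 * (y ^+ 2 * expR y) by ring.
  have -> : expR (4 * s ^+ 2) * u ^+ 2 * w x = u ^+ 2 * (expR (4 * s ^+ 2) * w x).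
    by ring.
  by apply: ler_wpM2l yy; exact: sqr_ge0.
have su : 0 <= s ^+ 2 * u ^+ 2 by rewrite mulr_ge0 ?sqr_ge0.
rewrite ger0_norm ?divr_ge0//.
apply: (@le_trans _ _ (s ^+ 2 * u ^+ 2 * 1)); first by rewrite mulr1; lra.
exact: ler_wpM2l.
Qed.

(* Translating the normal law tilts it by an exponential; the derivative at
   [h = 0] is the integration by parts formula [Rintegral_normal_xcos]. *)
Let shift_cos t c h :
  \int[N]_x cos (t * x + (c + t * h)) =
  \int[N]_x (cos (t * x + c) * expR ((h * x - h ^+ 2 / 2) / s ^+ 2)).
Proof.
have sN0 : s != 0 by rewrite gt_eqF.
pose e (x : R) := expR ((h * x - h ^+ 2 / 2) / s ^+ 2).
have me : measurable_fun setT e.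
  apply: measurableT_comp => //; apply: measurable_funM => //.
  by apply: measurable_funB => //; exact: measurable_funM.
have ge0e x : 0 <= e x := expR_ge0 _.
have e1 : (\int[N]_x (e x)%:E = 1)%E.
  under eq_integral.
    move=> x _; rewrite /e.
    rewrite (_ : _ / _ = - (h ^+ 2 / s ^+ 2 / 2) + h / s ^+ 2 * x); last by field.
    rewrite expRD EFinM; over.
  rewrite /= ge0_integralZl//=; last first.
    by apply/measurable_EFinP; apply: measurableT_comp.
  rewrite (normal_mgf s0) -EFinM -expRD; congr (_%:E).
  by rewrite (_ : _ + _ = 0) ?expR0//; field.
have ie : N.-integrable setT (EFin \o e).
  apply/integrableP; split; first exact/measurable_EFinP.
  under eq_integral do rewrite /= ger0_norm ?expR_ge0//.
  by rewrite e1 ltry.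
have ice : N.-integrable setT (fun x => (cos (t * x + c) * e x)%:E).
  apply: (@le_integrable _ _ _ N setT measurableT _ (EFin \o e)) => //.
    by apply/measurable_EFinP; apply: measurable_funM (mcos t c) me.
  by move=> x _; rewrite /= lee_fin normrM ler_piMl// cos_max.
(* [normal_shift] is about nonnegative functions, hence the added constant, which cancels at the
   end. *)
pose G x := 1 + cos (t * x + c).
have cG : continuous G.
  move=> x; apply: cvgD; first exact: cvg_cst.
  apply: continuous_comp; last exact: continuous_cos.
  apply: cvgD; last exact: cvg_cst.
  by apply: cvgM; [exact: cvg_cst|exact: cvg_id].
have G0 x : 0 <= G x by rewrite /G; have := cos_geN1 (t * x + c); lra.
have := normal_shift s0 h cG G0.
move=> /(congr1 fine).
have i1 : N.-integrable setT (fun=> 1%:E) by exact: finite_measure_integrable_cst.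
have -> : fine (\int[N]_x (G (x + h))%:E)%E = 1 + \int[N]_x cos (t * x + (c + t * h)).
  transitivity (\int[N]_x (1 + cos (t * x + (c + t * h)))).
    by apply: eq_Rintegral => x _; rewrite /G; congr (1 + cos _); ring.
  rewrite RintegralD//; last exact: icos.
  by rewrite [X in X + _]/Rintegral integral_cst//= probability_setT mul1e.
have -> : fine (\int[N]_x (G x * expR ((h * x - h ^+ 2 / 2) / s ^+ 2))%:E)%E =
    1 + \int[N]_x (cos (t * x + c) * e x).
  transitivity (\int[N]_x (e x + cos (t * x + c) * e x)).
    by apply: eq_Rintegral => x _; rewrite /G mulrDl mul1r.
  rewrite RintegralD//; congr (_ + _).
  by rewrite /Rintegral e1.
by move/addrI.
Qed.

Lemma Rintegral_normal_xcos t c :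
  \int[N]_x (x * cos (t * x + c)) = - (s ^+ 2 * t) * \int[N]_x sin (t * x + c).
Proof.
have sN0 : s != 0 by rewrite gt_eqF.
set Ix := Rintegral _ _ _; set Is := Rintegral _ _ _.
have ixc := ixcos t c.
apply/eqP; rewrite -subr_eq0; apply/eqP.
apply: (@zero_of_small _ ((3 * (t * s ^+ 2) ^+ 2 + (expR (4 * s ^+ 2) + s ^+ 2)) * K)).
move=> u u0 u1.
(* [f1] and [f2] are the first order remainders in [u] of the two sides of [shift_cos] at the shift
   s^2 u. Both have integrals of order u^2, while the difference of these integrals is u times the
   difference of the two sides of the claim. *)
pose f1 (x : R) := cos (t * x + (c + t * (s ^+ 2 * u))) - cos (t * x + c)
  + t * s ^+ 2 * u * sin (t * x + c).
pose ev (x : R) := expR ((s ^+ 2 * u * x - (s ^+ 2 * u) ^+ 2 / 2) / s ^+ 2).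
pose f2 (x : R) := cos (t * x + c) * ev x - cos (t * x + c) - u * (x * cos (t * x + c)).
have evE (x : R) : ev x = expR (u * x - s ^+ 2 * u ^+ 2 / 2).
  by rewrite /ev; congr expR; field.
have mev : measurable_fun setT ev.
  apply: measurableT_comp => //; apply: measurable_funM => //.
  by apply: measurable_funB => //; exact: measurable_funM.
have b1 (x : R) : `|f1 x| <= (3 * (t * s ^+ 2) ^+ 2 * u ^+ 2) * w x.
  apply: (@le_trans _ _ (3 * (t * s ^+ 2) ^+ 2 * u ^+ 2)); last first.
    apply: ler_peMr (w_ge1 x); apply: mulr_ge0 (sqr_ge0 u); exact: mulr_ge0 (sqr_ge0 _).
  have := cosD_taylor1 (t * x + c) (t * s ^+ 2 * u).
  rewrite (_ : 3 * (t * s ^+ 2 * u) ^+ 2 = 3 * (t * s ^+ 2) ^+ 2 * u ^+ 2); last by ring.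
  rewrite (_ : t * x + c + t * s ^+ 2 * u = t * x + (c + t * (s ^+ 2 * u))); last by ring.
  exact.
have b2 (x : R) : `|f2 x| <= ((expR (4 * s ^+ 2) + s ^+ 2) * u ^+ 2) * w x.
  rewrite (_ : f2 x = cos (t * x + c) * (expR (u * x - s ^+ 2 * u ^+ 2 / 2) - 1 - u * x)).
    rewrite normrM -[leRHS]mul1r; apply: ler_pM => //; first exact: cos_max.
    exact: exp_bound.
  by rewrite /f2 evE; ring.
have mf1 : measurable_fun setT f1.
  by apply: measurable_funD; [exact: measurable_funB|exact: measurable_funM].
have mxc : measurable_fun setT (fun x : R => x * cos (t * x + c)) by exact: measurable_funM.
have mce : measurable_fun setT (fun x : R => cos (t * x + c) * ev x) by exact: measurable_funM.
have mf2 : measurable_fun setT f2.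
  by apply: measurable_funB; [exact: measurable_funB|exact: measurable_funM].
have if2 := integrable_normal_le mf2 b2.
have ius : N.-integrable setT (fun x => (t * s ^+ 2 * u * sin (t * x + c))%:E).
  by under eq_fun do rewrite EFinM; apply: integrableZl.
have iux : N.-integrable setT (fun x => (u * (x * cos (t * x + c)))%:E).
  by under eq_fun do rewrite EFinM; apply: integrableZl.
have icd : N.-integrable setT (fun x =>
    (cos (t * x + (c + t * (s ^+ 2 * u))) - cos (t * x + c))%:E).
  by under eq_fun do rewrite EFinB; apply: integrableB.
have E1 : \int[N]_x f1 x = \int[N]_x cos (t * x + (c + t * (s ^+ 2 * u))) -
    \int[N]_x cos (t * x + c) + t * s ^+ 2 * u * Is.
  rewrite RintegralD// RintegralB//; [|exact: icos|exact: icos].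
  by rewrite (RintegralZl _ measurableT (isin t c)).
have E2 : \int[N]_x f2 x = \int[N]_x (cos (t * x + c) * ev x) -
    \int[N]_x cos (t * x + c) - u * Ix.
  have ice : N.-integrable setT (fun x => (cos (t * x + c) * ev x)%:E).
    have -> : (fun x => (cos (t * x + c) * ev x)%:E) = (fun x =>
        (f2 x)%:E + ((cos (t * x + c))%:E + (u * (x * cos (t * x + c)))%:E))%E.
      by apply/funext => x; rewrite -!EFinD; congr (_%:E); rewrite /f2; ring.
    by apply: integrableD => //; exact: integrableD.
  have icd2 : N.-integrable setT (fun x => (cos (t * x + c) * ev x - cos (t * x + c))%:E).
    by under eq_fun do rewrite EFinB; apply: integrableB.
  rewrite RintegralB// RintegralB//; last exact: icos.
  by rewrite (RintegralZl _ measurableT ixc).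
have B1 := Rintegral_normal_le mf1 b1.
have B2 := Rintegral_normal_le mf2 b2.
have SC := shift_cos t c (s ^+ 2 * u).
have : `|u * (Ix - - (s ^+ 2 * t) * Is)| <=
   (3 * (t * s ^+ 2) ^+ 2 * u ^+ 2) * K + ((expR (4 * s ^+ 2) + s ^+ 2) * u ^+ 2) * K.
  rewrite (_ : u * _ = \int[N]_x f1 x - \int[N]_x f2 x).
    by rewrite (le_trans (ler_normB _ _))// lerD.
  by rewrite E1 E2 SC; ring.
rewrite normrM gtr0_norm// => H.
rewrite -(ler_pM2l u0); apply: (le_trans H).
by rewrite le_eqVlt; apply/orP; left; apply/eqP; ring.
Qed.

Lemma Rintegral_normal_xsin t c :
  \int[N]_x (x * sin (t * x + c)) = s ^+ 2 * t * \int[N]_x cos (t * x + c).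
Proof.
have cE (y : R) : cos (y - pi / 2) = sin y.
  by rewrite cosB cos_pihalf sin_pihalf mulr0 add0r mulr1.
have sE (y : R) : sin (y - pi / 2) = -1 * cos y.
  by rewrite sinB cos_pihalf sin_pihalf mulr0 sub0r mulr1 mulN1r.
have := Rintegral_normal_xcos t (c - pi / 2).
have -> : \int[N]_x (x * cos (t * x + (c - pi / 2))) = \int[N]_x (x * sin (t * x + c)).
  by apply: eq_Rintegral => x _; rewrite addrA cE.
have -> : \int[N]_x sin (t * x + (c - pi / 2)) = \int[N]_x (-1 * cos (t * x + c)).
  by apply: eq_Rintegral => x _; rewrite addrA sE.
rewrite (RintegralZl _ measurableT (icos t c)) => ->; ring.
Qed.

Lemma is_derive_normal_cos t c :
  is_derive t (1 : R) (fun t : R => \int[N]_x cos (t * x + c))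
    (- (s ^+ 2 * t * \int[N]_x cos (t * x + c))).
Proof.
apply: (@is_derive_quadratic _ _ _ _ (3 * K)) => h _.
pose f (x : R) := cos ((t + h) * x + c) - cos (t * x + c) + h * (x * sin (t * x + c)).
have mxs : measurable_fun setT (fun x : R => x * sin (t * x + c)).
  exact: measurable_funM.
have mf : measurable_fun setT f.
  by apply: measurable_funD; [exact: measurable_funB|exact: measurable_funM].
have bf (x : R) : `|f x| <= (3 * h ^+ 2) * w x.
  have := cosD_taylor1 (t * x + c) (h * x).
  rewrite (_ : t * x + c + h * x = (t + h) * x + c); last by ring.
  rewrite -mulrA => /le_trans; apply.
  rewrite exprMn mulrA; apply: ler_wpM2l; first exact: mulr_ge0 (sqr_ge0 _).
  by rewrite -(real_normK (num_real x)); exact: w_ge_pow.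
have ixs : N.-integrable setT (fun x => (x * sin (t * x + c))%:E).
  apply: (@integrable_normal_le _ 1) => // x.
  rewrite mul1r normrM (le_trans _ (@w_ge_pow 1 x _))// expr1.
  by rewrite ler_piMr// sin_max.
have ihxs : N.-integrable setT (fun x => (h * (x * sin (t * x + c)))%:E).
  by under eq_fun do rewrite EFinM; apply: integrableZl.
have icd : N.-integrable setT (fun x => (cos ((t + h) * x + c) - cos (t * x + c))%:E).
  by under eq_fun do rewrite EFinB; apply: integrableB.
have := Rintegral_normal_le mf bf.
rewrite RintegralD// RintegralB//; [|exact: icos|exact: icos].
rewrite (RintegralZl _ measurableT ixs) Rintegral_normal_xsin mulrN opprK.
by rewrite [3 * K * _]mulrAC.
Qed.

(** As a function of t the integral satisfies y' = - s^2 t y, solved by an integrating factor; at t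
    = 0 it is cos c. *)
Theorem Rintegral_normal_cos t c :
  \int[N]_x cos (t * x + c) = expR (- (s ^+ 2 * t ^+ 2 / 2)) * cos c.
Proof.
pose Phi (t : R) := \int[N]_x cos (t * x + c).
pose Psi (t : R) := Phi t * expR (s ^+ 2 / 2 * t ^+ 2).
have dPsi (u : R) : is_derive u (1 : R) Psi 0.
  have d1 : is_derive u (1 : R) Phi (- (s ^+ 2 * u * Phi u)).
    exact: is_derive_normal_cos.
  have d2 : is_derive u (1 : R) (fun u : R => s ^+ 2 / 2 * u ^+ 2) (s ^+ 2 * u).
    by apply: is_derive_eq; rewrite /GRing.scale/=; field.
  have d3 : is_derive u (1 : R) (fun u : R => expR (s ^+ 2 / 2 * u ^+ 2))
      (expR (s ^+ 2 / 2 * u ^+ 2) * (s ^+ 2 * u)).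
    exact: is_derive1_comp.
  apply: is_derive_eq; rewrite /GRing.scale/=; ring.
have := is_derive_0_is_cst t 0 dPsi.
rewrite /Psi expr0n/= mulr0 expR0 mulr1.
have -> : Phi 0 = cos c.
  rewrite /Phi; transitivity (\int[N]__ (cos c)).
    by apply: eq_Rintegral => x _; rewrite mul0r add0r.
  by rewrite [LHS]/Rintegral integral_cst//= probability_setT mule1.
move=> <-; rewrite -/(Phi t) mulrCA -expRD.
by rewrite (_ : _ + _ = 0) ?expR0 ?mulr1//; field.
Qed.

Lemma Rintegral_normal_id : \int[N]_x x = 0.
Proof.
have := Rintegral_normal_xcos 0 0; rewrite mulr0 oppr0 mul0r; apply: etrans.
by apply: eq_Rintegral => x _; rewrite mul0r add0r cos0 mulr1.
Qed.

Lemma integrable_normal_pow k : (k <= 4)%N ->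
  N.-integrable setT (fun x => (x ^+ k)%:E).
Proof.
move=> k4; apply: (@integrable_normal_le _ 1) => [|x]; first exact: measurable_funX.
by rewrite mul1r normrX w_ge_pow.
Qed.

(** The coefficients of h^2 are compared in the expansions of the integral of cos (h x) and of its
    value exp (- s^2 h^2 / 2). *)
Lemma Rintegral_normal_sqr : \int[N]_x (x ^+ 2) = s ^+ 2.
Proof.
apply/eqP; rewrite -subr_eq0; apply/eqP.
set M2 := Rintegral _ _ _.
apply: (@zero_of_small _ (4 * K + s ^+ 4)) => h h0 h1.
have i2 := @integrable_normal_pow 2 isT.
pose f (x : R) := cos (h * x + 0) - 1 + h ^+ 2 / 2 * x ^+ 2.
have mf : measurable_fun setT f.
  apply: measurable_funD; first exact: measurable_funB.
  by apply: measurable_funM => //; exact: measurable_funX.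
have hh : h ^+ 4 <= h ^+ 3 by rewrite exprS ler_piMl// exprn_ge0// ltW.
have bf (x : R) : `|f x| <= (2 * h ^+ 3) * w x.
  have := cosD_taylor2 0 (h * x); rewrite add0r cos0 sin0 mulr0 addr0 mulr1.
  rewrite /f addr0 (_ : (h * x) ^+ 2 / 2 = h ^+ 2 / 2 * x ^+ 2); last by field.
  move=> /le_trans; apply.
  rewrite (_ : 2 * h ^+ 3 * w x = h ^+ 3 * w x + h ^+ 3 * w x); last by ring.
  apply: lerD.
    rewrite exprMn; apply: ler_pM => //; [exact/exprn_ge0/ltW|exact: exprn_even_ge0|].
    by rewrite -[x ^+ 4]ger0_norm ?exprn_even_ge0// normrX w_ge_pow.
  rewrite normrM (gtr0_norm h0) exprMn; apply: ler_wpM2l; last exact: w_ge_pow.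
  exact/exprn_ge0/ltW.
have i1 : N.-integrable setT (fun=> 1%:E) by exact: finite_measure_integrable_cst.
have i22 : N.-integrable setT (fun x => (h ^+ 2 / 2 * x ^+ 2)%:E).
  by under eq_fun do rewrite EFinM; apply: integrableZl.
have icd : N.-integrable setT (fun x => (cos (h * x + 0) - 1)%:E).
  by under eq_fun do rewrite EFinB; apply: integrableB.
have := Rintegral_normal_le mf bf.
rewrite RintegralD// RintegralB//; last exact: icos.
rewrite (RintegralZl _ measurableT i2) Rintegral_normal_cos cos0 mulr1 -/M2.
rewrite [X in _ - X + _](_ : _ = 1); last first.
  by rewrite /Rintegral integral_cst//= probability_setT mul1e.
set y := s ^+ 2 * h ^+ 2 / 2.
have y0 : 0 <= y by rewrite divr_ge0// mulr_ge0// sqr_ge0.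
have := expRN_taylor1 y0; rewrite !ler_norml => /andP[a1 a2] /andP[a3 a4].
have y2 : y ^+ 2 = s ^+ 4 * (h ^+ 4 / 4) by rewrite /y; field.
have s4 : 0 <= s ^+ 4 by rewrite exprn_even_ge0.
have h3 : 0 <= s ^+ 4 * h ^+ 3 by exact: mulr_ge0 s4 (exprn_ge0 _ (ltW h0)).
have hs : s ^+ 4 * h ^+ 4 <= s ^+ 4 * h ^+ 3 by rewrite ler_wpM2l.
have H : `|h ^+ 2 / 2 * (M2 - s ^+ 2)| <= h ^+ 2 / 2 * ((4 * K + s ^+ 4) * h).
  have -> : h ^+ 2 / 2 * (M2 - s ^+ 2) = h ^+ 2 / 2 * M2 - y by rewrite /y; field.
  have -> : h ^+ 2 / 2 * ((4 * K + s ^+ 4) * h) = 2 * h ^+ 3 * K + s ^+ 4 * h ^+ 3 / 2.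
    by field.
  by rewrite ler_norml; apply/andP; split; lra.
have p : 0 < h ^+ 2 / 2 by rewrite divr_gt0// exprn_gt0.
by move: H; rewrite normrM (gtr0_norm p) (ler_pM2l p) ler_norml.
Qed.

End normal_characteristic.

(** * Trigonometric approximation *)

Section bernstein.
Variable R : realType.
Implicit Types p : R.

(** Probability of k successes in m independent trials, defined by conditioning on one trial. The
    recursion gives the moments, and the closure under trigonometric polynomials, by induction on
    m. *)
Fixpoint bernstein (p : R) (m k : nat) : R :=
  match m with
  | 0 => (k == 0%N)%:R
  | m'.+1 => (1 - p) * bernstein p m' k +
      p * (if k is k'.+1 then bernstein p m' k' else 0)
  end.

Lemma bernstein_ge0 p m k : 0 <= p <= 1 -> 0 <= bernstein p m k.
Proof.
move=> /andP[p0 p1]; elim: m k => [|m IH] k /=; first by rewrite ler0n.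
by case: k => [|k]; rewrite addr_ge0// mulr_ge0 ?subr_ge0.
Qed.

Lemma bernstein_gt p m k : (m < k)%N -> bernstein p m k = 0.
Proof.
elim: m k => [|m IH] [|k]//= mk.
by rewrite !IH ?mulr0 ?addr0// ltnW.
Qed.

Lemma sum_bernsteinS p m (phi : nat -> R) :
  \sum_(k < m.+2) bernstein p m.+1 k * phi k =
  (1 - p) * (\sum_(k < m.+1) bernstein p m k * phi k) +
  p * (\sum_(k < m.+1) bernstein p m k * phi k.+1).
Proof.
rewrite /= (eq_bigr (fun k : 'I_m.+2 => (1 - p) * (bernstein p m k * phi k) +
  p * ((if (k : nat) is k'.+1 then bernstein p m k' else 0) * phi k))); last first.
  by move=> k _ /=; rewrite mulrDl -!mulrA.
rewrite big_split/= -!mulr_sumr; congr (_ * _ + _ * _).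
  by rewrite big_ord_recr/= bernstein_gt// mul0r addr0.
rewrite big_ord_recl/= mul0r add0r.
by apply: eq_bigr => k _; rewrite /= add0n.
Qed.

Lemma sum_bernstein_quadratic p m (x y z : R) :
  \sum_(k < m.+1) bernstein p m k * (x + y * k%:R + z * k%:R ^+ 2) =
  x + y * (m%:R * p) + z * (m%:R * p * (1 - p) + (m%:R * p) ^+ 2).
Proof.
elim: m x y z => [|m IH] x y z.
  by rewrite big_ord1 /=; ring.
rewrite (sum_bernsteinS _ _ (fun k => x + y * k%:R + z * k%:R ^+ 2)) IH.
under eq_bigr => k _.
  rewrite -[k.+1%:R]natr1.
  rewrite (_ : x + _ + _ = (x + y + z) + (y + 2 * z) * k%:R + z * k%:R ^+ 2); last by ring.
  over.
by rewrite IH -[m.+1%:R]natr1; ring.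
Qed.

Lemma sum_bernstein p m : \sum_(k < m.+1) bernstein p m k = 1.
Proof.
have := sum_bernstein_quadratic p m 1 0 0; rewrite !mul0r !addr0 => <-.
by apply: eq_bigr => k _; rewrite !mul0r !addr0 mulr1.
Qed.

(** Variance of the binomial law. The factor 2 comes from mapping [0, 1] to [-1, 1], where the sine
    takes its values. *)
Lemma sum_bernstein_sqr p m : 0 <= p <= 1 ->
  \sum_(k < m.+2) bernstein p m.+1 k * (2 * (k%:R / m.+1%:R - p)) ^+ 2 <=
  4 / m.+1%:R.
Proof.
move=> /andP[p0 p1]; have mN0 : m.+1%:R != 0 :> R by rewrite pnatr_eq0.
under eq_bigr => k _.
  rewrite (_ : (2 * _) ^+ 2 = 4 * p ^+ 2 + (- (8 * p / m.+1%:R)) * k%:R +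
    4 / m.+1%:R ^+ 2 * k%:R ^+ 2); last by field.
  over.
rewrite sum_bernstein_quadratic.
rewrite (_ : _ + _ = 4 / m.+1%:R * (p * (1 - p))); last by field.
apply: ler_piMr; first by rewrite divr_ge0.
by rewrite mulr_ile1// ?subr_ge0// gerBl.
Qed.

End bernstein.

Section multi_bernstein.
Variables (R : realType) (r m : nat) (p : 'I_r -> R).
Hypothesis p01 : forall i, 0 <= p i <= 1.

Definition bern_weight (j : {ffun 'I_r -> 'I_m.+2}) : R :=
  \prod_i bernstein (p i) m.+1 (j i).

Lemma bern_weight_ge0 j : 0 <= bern_weight j.
Proof. by apply: prodr_ge0 => i _; exact: bernstein_ge0. Qed.

Lemma sum_bern_weight : \sum_j bern_weight j = 1.
Proof.
rewrite /bern_weight -(bigA_distr_bigA (fun i (k : 'I_m.+2) => bernstein (p i) m.+1 k)).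
by rewrite big1// => i _; exact: sum_bernstein.
Qed.

Lemma sum_bern_weight_coord i (phi : nat -> R) :
  \sum_j bern_weight j * phi (j i) =
  \sum_(k < m.+2) bernstein (p i) m.+1 k * phi k.
Proof.
pose F (l : 'I_r) (k : 'I_m.+2) :=
  bernstein (p l) m.+1 k * (if l == i then phi k else 1).
transitivity (\sum_(j : {ffun 'I_r -> 'I_m.+2}) \prod_l F l (j l)).
  apply: eq_bigr => j _; rewrite /F /bern_weight big_split/=; congr (_ * _).
  by rewrite (bigD1 i)//= eqxx big1 ?mulr1// => l /negbTE ->.
have F1 l : l != i -> \sum_(k < m.+2) F l k = 1.
  move=> /negbTE li; rewrite /F; under eq_bigr do rewrite li mulr1.
  exact: sum_bernstein.
rewrite -(bigA_distr_bigA F) (bigD1 i)//= [X in _ * X]big1 ?mulr1//.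
by apply: eq_bigr => k _; rewrite /F eqxx.
Qed.

End multi_bernstein.

Section trigonometric_polynomials.
Variables (R : realType) (r : nat).

(* The phases [c] account for the sine terms. *)
Inductive trigpoly : ('rV[R]_r -> R) -> Prop :=
| trigpoly_cos t c : trigpoly (fun v => cos (\sum_i t i * v 0 i + c))
| trigpolyD f g : trigpoly f -> trigpoly g -> trigpoly (fun v => f v + g v)
| trigpolyZ k f : trigpoly f -> trigpoly (fun v => k * f v).

Lemma eq_trigpoly f g : f =1 g -> trigpoly f -> trigpoly g.
Proof. by move=> /funext ->. Qed.

Lemma trigpolyM f g : trigpoly f -> trigpoly g -> trigpoly (fun v => f v * g v).
Proof.
move=> tf tg; elim: tf => {f}[t c|f1 f2 _ h1 _ h2|k f _ IH].
- elim: tg => {g}[t' c'|f1 f2 _ h1 _ h2|k f _ IH].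
  + apply: (@eq_trigpoly (fun v =>
      2^-1 * cos (\sum_i (t i + t' i) * v 0 i + (c + c')) +
      2^-1 * cos (\sum_i (t i - t' i) * v 0 i + (c - c')))) => [v|].
      rewrite (_ : \sum_i (t i + t' i) * v 0 i + (c + c') =
        (\sum_i t i * v 0 i + c) + (\sum_i t' i * v 0 i + c')); last first.
        by under eq_bigr do rewrite mulrDl; rewrite big_split/=; ring.
      rewrite (_ : \sum_i (t i - t' i) * v 0 i + (c - c') =
        (\sum_i t i * v 0 i + c) - (\sum_i t' i * v 0 i + c')); last first.
        by under eq_bigr do rewrite mulrBl; rewrite sumrB/=; ring.
      by rewrite cosD cosB; field.
    by apply: trigpolyD; apply: trigpolyZ; exact: trigpoly_cos.
  + apply: (eq_trigpoly _ (trigpolyD h1 h2)) => v; by rewrite mulrDr.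
  + apply: (eq_trigpoly _ (trigpolyZ k IH)) => v; by rewrite mulrCA.
- apply: (eq_trigpoly _ (trigpolyD h1 h2)) => v; by rewrite mulrDl.
- apply: (eq_trigpoly _ (trigpolyZ k IH)) => v; by rewrite mulrA.
Qed.

Lemma trigpoly_cst c : trigpoly (fun=> c).
Proof.
apply: (eq_trigpoly _ (trigpolyZ c (trigpoly_cos (fun=> 0) 0))) => v.
rewrite big1 => [|i _]; last by rewrite mul0r.
by rewrite addr0 cos0 mulr1.
Qed.

Lemma trigpoly_sum (I : Type) (s : seq I) (F : I -> 'rV[R]_r -> R) :
  (forall i, trigpoly (F i)) -> trigpoly (fun v => \sum_(i <- s) F i v).
Proof.
move=> tF; elim: s => [|i s IH].
  by under eq_fun do rewrite big_nil; exact: trigpoly_cst.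
by under eq_fun do rewrite big_cons; exact: trigpolyD.
Qed.

Lemma trigpoly_prod (I : Type) (s : seq I) (F : I -> 'rV[R]_r -> R) :
  (forall i, trigpoly (F i)) -> trigpoly (fun v => \prod_(i <- s) F i v).
Proof.
move=> tF; elim: s => [|i s IH].
  by under eq_fun do rewrite big_nil; exact: trigpoly_cst.
by under eq_fun do rewrite big_cons; exact: trigpolyM.
Qed.

Lemma trigpoly_bernstein (q : 'rV[R]_r -> R) m k : trigpoly q ->
  trigpoly (fun v => bernstein (q v) m k).
Proof.
move=> tq; elim: m k => [|m IH] k /=; first exact: trigpoly_cst.
apply: trigpolyD.
  apply: trigpolyM => //.
  apply: (eq_trigpoly _ (trigpolyD (trigpoly_cst 1) (trigpolyZ (-1) tq))) => v.
  by rewrite mulN1r.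
apply: trigpolyM => //; case: k => [|k]; [exact: trigpoly_cst|exact: IH].
Qed.

Lemma trigpoly_sin_coord i (a : R) : trigpoly (fun v => sin (a * v 0 i)).
Proof.
apply: (eq_trigpoly _
  (trigpoly_cos (fun j => if j == i then a else 0) (- (pi / 2)))) => v.
rewrite cosB cos_pihalf sin_pihalf mulr0 add0r mulr1.
congr sin; rewrite (bigD1 i)//= eqxx big1 ?addr0// => j /negbTE ->.
by rewrite mul0r.
Qed.

End trigonometric_polynomials.

Section compact_modulus.
Variables (R : realType) (r : nat) (f : 'rV[R]_r -> R) (M L : R).
Hypothesis cf : continuous f.
Hypothesis fM : forall v, `|f v| <= M.

Let box := [set v : 'rV[R]_r | forall i, v ord0 i \in `[- L, L]].

(** Close points are handled by uniform continuity, distant ones by 2 M and the square of their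
    distance. A quadratic error is what the variance of the Bernstein weights controls. Only [v] has
    to lie in the box. *)
Lemma unif_modulus (eps : R) : 0 < eps -> exists2 C : R, 0 <= C &
  forall v u : 'rV[R]_r, (forall i, `|v 0 i| <= L) ->
    `|f v - f u| <= eps + C * \sum_i (v 0 i - u 0 i) ^+ 2.
Proof.
move=> eps0.
have cbox : compact box.
  have := @rV_compact R r (fun=> [set` `[- L, L]]) (fun=> @segment_compact _ _ _).
  exact.
have [d d0 dP] : exists2 d : R, 0 < d & forall v u, box v -> ball v d u -> `|f v - f u| <= eps.
  have near_cov := proj1 (compact_near_coveringP _) cbox.
  pose P (d : R) (v : 'rV[R]_r) := forall u : 'rV[R]_r, ball v d u -> `|f v - f u| <= eps.
  have H v : box v -> \forall v' \near v & d \near 0^'+, P d v'.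
    move=> _.
    have : \forall u \near v, `|f v - f u| <= eps / 2.
      by move/cvgrPdist_le : (@cf v); apply; rewrite divr_gt0.
    move=> /nbhs_ballP[e /= e0 eP].
    (* Half of the radius is for the moving center [v'] and half for [d], so that [u] stays within
       [e] of [v]. *)
    exists (ball v (e / 2), [set d | d < e / 2]).
      split => /=; first by apply: nbhsx_ballx; rewrite divr_gt0.
      by apply: nbhs_right_lt; rewrite divr_gt0.
    have e2 : e / 2 <= e by rewrite ler_pdivrMr// ler_peMr ?ler1n// ltW.
    move=> [v' d] /= [vv' de] u v'u.
    have h1 : `|f v - f v'| <= eps / 2 by apply: eP; exact: le_ball vv'.
    have h2 : `|f v - f u| <= eps / 2.
      apply: eP; rewrite (splitr e); apply: (ball_triangle vv').
      by apply: le_ball v'u; exact: ltW.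
    move: h1 h2; rewrite !ler_norml => /andP[? ?] /andP[? ?].
    by apply/andP; split; lra.
  have := near_cov R 0^'+ P _ H => K.
  have [d [d0 dP]] : exists d : R, 0 < d /\ (box `<=` P d).
    apply: (@filter_ex _ (0^'+ : set_system R)).
    by apply: filterI; [exact: nbhs_right_gt|exact: K].
  by exists d => // v u bv; exact: dP.
have M0 : 0 <= M := le_trans (normr_ge0 _) (fM 0).
have C0 : 0 <= 2 * M / d ^+ 2 by exact: divr_ge0 (mulr_ge0 _ M0) (sqr_ge0 _).
exists (2 * M / d ^+ 2) => // v u vL.
have bv : box v by move=> i; rewrite in_itv/= -ler_norml vL.
have S0 : 0 <= \sum_i (v 0 i - u 0 i) ^+ 2 by apply: sumr_ge0 => i _; exact: sqr_ge0.
have [/forallP vu|/forallPn[i vu]] := boolP [forall i, `|v 0 i - u 0 i| < d].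
  apply: (@le_trans _ _ eps); last by rewrite lerDl mulr_ge0.
  apply: dP => //; split=> // i j; rewrite ord1; exact: vu.
apply: (@le_trans _ _ (2 * M)).
  by rewrite (le_trans (ler_normB _ _))// mulr2n mulrDl mul1r lerD.
apply: (@le_trans _ _ (2 * M / d ^+ 2 * \sum_i (v 0 i - u 0 i) ^+ 2)); last first.
  by rewrite lerDr ltW.
rewrite -mulrA ler_peMr ?mulr_ge0// ler_pdivlMl ?exprn_gt0// mulr1.
rewrite (bigD1 i)//= (@le_trans _ _ ((v 0 i - u 0 i) ^+ 2))//; last first.
  by rewrite lerDl sumr_ge0// => j _; exact: sqr_ge0.
rewrite -(real_normK (num_real (v 0 i - u 0 i))); apply: lerXn2r; rewrite ?nnegrE //.
  exact: ltW.
by rewrite leNgt.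
Qed.

End compact_modulus.

Section trigonometric_approximation.
Variable R : realType.

(** On [-1, 1] the derivative of the sine is at least cos 1; thus the arcsine is Lipschitz on
    [- sin 1, sin 1], with constant 1 / cos 1. *)
Lemma sin_expand (x y : R) : `|x| <= 1 -> `|y| <= 1 ->
  cos 1 * `|x - y| <= `|sin x - sin y|.
Proof.
wlog xy : x y / x < y.
  move=> W x1 y1; have [xy|xy|->] := ltgtP x y; first exact: W.
    by rewrite distrC (distrC (sin x)) W.
  by rewrite !subrr normr0 mulr0.
rewrite !ler_norml => /andP[x1 x2] /andP[y1 y2].
have cs : {within `[x, y], continuous (@sin R)}.
  by apply: derivable_within_continuous => z _; exact: ex_derive.
have [c] := MVT xy (fun z _ => is_derive_sin z) cs.
rewrite in_itv/= => /andP[xc cy] E.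
rewrite distrC (distrC (sin x)) E normrM ler_wpM2r//.
have c1 : `|c| <= 1 by rewrite ler_norml; apply/andP; split; lra.
rewrite (le_trans _ (ler_norm _))// -(cos_norm c).
have pi1 : 1 <= pi :> R by rewrite (le_trans _ (pi_ge2 R))// ler1n.
by rewrite leNgt ltr_cos -?leNgt// in_itv/= ?normr_ge0 ?ler01// (le_trans c1).
Qed.

(* Bernstein's approximation in the variables [(1 + sin (v_i / L)) / 2], with
   nodes pulled back by [phi], a Lipschitz extension of [L * asin]. *)
Lemma trigonometric_approximation r (f : 'rV[R]_r -> R) (M L eps : R) :
  continuous f -> (forall v, `|f v| <= M) -> 0 < L -> 0 < eps ->
  exists g : 'rV[R]_r -> R, [/\ trigpoly g, forall v, `|g v| <= M &
    forall v : 'rV[R]_r, (forall i, `|v 0 i| <= L) -> `|f v - g v| <= eps].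
Proof.
move=> cf fM L0 eps0.
have pi1 : 1 <= pi / 2 :> R := pihalf_ge1 R.
pose S : R := sin 1.
have S0 : 0 <= S by rewrite sin_ge0_pi// ler01 (le_trans _ (pi_ge2 R))// ler1n.
have c1 : 0 < cos 1 :> R := cos1_gt0 R.
(* The nodes fill [-1, 1], but the arcsine is not Lipschitz near the ends; clamping to
   [- sin 1, sin 1] loses nothing, because sin (x / L) lies there when |x| <= L. *)
pose clamp (a : R) := Num.max (- S) (Num.min S a).
have clampS a : - S <= clamp a <= S.
  rewrite /clamp le_max lexx/= ge_max ge_min lexx andbT.
  by rewrite (le_trans _ S0)// oppr_le0.
have S1 : S <= 1 := sin_le1 1.
pose phi a := L * asin (clamp a).
have phiE a : exists2 y : R, `|y| <= 1 & phi a = L * y /\ sin y = clamp a.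
  have /andP[a1 a2] := clampS a.
  exists (asin (clamp a)); last first.
    by split=> //; rewrite asinK// in_itv/=; apply/andP; split; lra.
  have a12 : -1 <= clamp a <= 1 by apply/andP; split; lra.
  have yN := asin_geNpi2 a12; have yp := asin_lepi2 a12.
  have ys : sin (asin (clamp a)) = clamp a by rewrite asinK// in_itv.
  have pN : - (pi / 2) <= 1 :> R by lra.
  rewrite ler_norml; apply/andP; split; rewrite leNgt.
    apply/negP; rewrite -ltr_sin ?in_itv/= ?yN ?yp ?sinN ?ys//; last first.
      by apply/andP; split; lra.
    by rewrite -/S; lra.
  apply/negP; rewrite -ltr_sin ?in_itv/= ?yN ?yp ?ys ?pN ?pi1//.
  by rewrite -/S; lra.
have phi_lip a x : `|x| <= L -> (phi a - x) ^+ 2 <= (L / cos 1) ^+ 2 * (a - sin (x / L)) ^+ 2.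
  move=> xL; have [y y1 [-> ys]] := phiE a.
  pose z := x / L.
  have xz : x = L * z by rewrite /z mulrC divfK// gt_eqF.
  have z1 : `|z| <= 1 by rewrite /z normrM normfV (gtr0_norm L0) ler_pdivrMr// mul1r.
  have := sin_expand y1 z1; rewrite ys -/z => H.
  have sz : `|sin z| <= S.
    move: z1; rewrite !ler_norml /S -sinN => /andP[? ?].
    by rewrite !leNgt !ltr_sin ?in_itv/= -?leNgt; apply/andP; split; lra.
  (* Projecting onto an interval does not increase the distance to one of its points. *)
  have H2 : `|clamp a - sin z| <= `|a - sin z|.
    move: sz; rewrite /clamp ler_norml => /andP[? ?].
    have [?|?] := leP S a; have [?|?] := leP (- S) _;
      by rewrite -[leLHS]/(`|_|) !ler_normr !ler_norml; lra.
  rewrite xz -mulrBr exprMn.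
  rewrite (_ : (L / cos 1) ^+ 2 = L ^+ 2 * (cos 1 ^+ 2)^-1); last first.
    by field; rewrite gt_eqF.
  rewrite -mulrA ler_wpM2l ?sqr_ge0// ler_pdivlMl ?exprn_gt0// -exprMn.
  rewrite -(real_normK (num_real (_ * _))) -(real_normK (num_real (a - _))).
  rewrite lerXn2r ?nnegrE// normrM (gtr0_norm c1).
  exact: le_trans H H2.
have [C C0 HC] := unif_modulus L cf fM (divr_gt0 eps0 (ltr0n _ 2)).
(* Modulus, squared Lipschitz constant of [phi], and a variance of at most 4 / (m + 1) for each of
   the r coordinates. *)
pose K := C * (L / cos 1) ^+ 2 * (r%:R * 4).
have K0 : 0 <= K by exact: mulr_ge0 (mulr_ge0 C0 (sqr_ge0 _)) (mulr_ge0 _ _).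
have [m Hm] : exists m : nat, K / m.+1%:R <= eps / 2.
  exists (Num.truncn (K / (eps / 2))).
  rewrite ler_pdivrMr// mulrC -ler_pdivrMr ?divr_gt0//.
  exact/ltW/truncnS_gt.
pose p (v : 'rV[R]_r) i := (1 + sin (L^-1 * v 0 i)) / 2.
have p01 v i : 0 <= p v i <= 1.
  have := sin_geN1 (L^-1 * v 0 i); have := sin_le1 (L^-1 * v 0 i).
  by rewrite /p => ? ?; apply/andP; split; lra.
pose node (k : nat) := phi (2 * (k%:R / m.+1%:R) - 1).
pose W v (j : {ffun 'I_r -> 'I_m.+2}) := bern_weight (p v) j.
exists (fun v => \sum_j W v j * f (\row_i node (j i))); split.
- apply: trigpoly_sum => j; under eq_fun do rewrite mulrC; apply: trigpolyZ.
  apply: trigpoly_prod => i; apply: trigpoly_bernstein.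
  apply: (eq_trigpoly _ (trigpolyZ 2^-1 (trigpolyD (trigpoly_cst r 1)
    (trigpoly_sin_coord i L^-1)))).
  by move=> v; rewrite /p mulrC.
- move=> v; apply: (le_trans (ler_norm_sum _ _ _)).
  rewrite -[leRHS]mul1r -(sum_bern_weight m (p v)) mulr_suml.
  apply: ler_sum => j _; rewrite normrM ger0_norm ?bern_weight_ge0//.
  by rewrite ler_wpM2l ?bern_weight_ge0.
move=> v vL.
rewrite -[f v]mul1r -(sum_bern_weight m (p v)) mulr_suml -sumrB.
apply: (le_trans (ler_norm_sum _ _ _)).
pose Q i (k : nat) := (L / cos 1) ^+ 2 * (2 * (k%:R / m.+1%:R - p v i)) ^+ 2.
apply: (@le_trans _ _ (\sum_j W v j * (eps / 2 + C * \sum_i Q i (j i)))).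
  apply: ler_sum => j _; rewrite -mulrBr normrM ger0_norm ?bern_weight_ge0//.
  rewrite ler_wpM2l ?bern_weight_ge0//.
  apply: (le_trans (HC _ _ vL)); rewrite lerD2l ler_wpM2l//.
  apply: ler_sum => i _; rewrite mxE -sqrrN opprB.
  apply: (le_trans (phi_lip _ _ (vL i))).
  by rewrite /Q /p (mulrC L^-1) le_eqVlt; apply/orP; left; apply/eqP; congr (_ * _ ^+ 2); field.
under eq_bigr do rewrite mulrDr.
rewrite big_split/= -mulr_suml sum_bern_weight mul1r.
rewrite [leRHS](splitr eps) lerD2l.
apply: le_trans Hm.
under eq_bigr do rewrite mulrCA.
rewrite -mulr_sumr.
under eq_bigr do rewrite mulr_sumr.
rewrite exchange_big/=.
have B : \sum_i \sum_j W v j * Q i (j i) <= (L / cos 1) ^+ 2 * (r%:R * (4 / m.+1%:R)).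
  rewrite -[r in r%:R]card_ord [_%:R * _]mulr_natl -sumr_const mulr_sumr.
  apply: ler_sum => i _; rewrite (sum_bern_weight_coord m (p v) i (Q i)) /Q.
  under eq_bigr do rewrite mulrCA.
  by rewrite -mulr_sumr; apply: ler_wpM2l (sum_bernstein_sqr _ (p01 v i)); exact: sqr_ge0.
apply: (le_trans (ler_wpM2l C0 B)); rewrite /K le_eqVlt; apply/orP; left; apply/eqP.
have m1 : 0 < 1 + m%:R :> R by rewrite ltr_wpDr.
by field; rewrite !gt_eqF.
Qed.

End trigonometric_approximation.

(** * Laws and cosine integrals *)

Section bounded_integrals.
Context {R : realType} d (T : measurableType d) (P : probability T R).

Lemma integrable_bounded_prob (f : T -> R) (M : R) : measurable_fun setT f ->
  (forall w, `|f w| <= M) -> P.-integrable setT (EFin \o f).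
Proof.
move=> mf fM; apply: measurable_bounded_integrable => //.
  by apply: (@le_lt_trans _ _ 1%E); rewrite ?probability_le1 ?ltry.
exists M; split; first exact: num_real.
by move=> x Mx w _; exact: le_trans (fM w) (ltW Mx).
Qed.

Lemma Rintegral_prob_cst (c : R) : \int[P]_(_ in setT) c = c.
Proof.
rewrite Rintegral_cst// [X in fine X](_ : _ = 1%E) ?mulr1//.
exact: probability_setT.
Qed.

Lemma cvg_Rintegral_bounded (f_ : nat -> T -> R) (f : T -> R) (M : R) :
  (forall n, measurable_fun setT (f_ n)) -> (forall n w, `|f_ n w| <= M) ->
  (forall w, f_ n w @[n --> \oo] --> f w) ->
  \int[P]_w f_ n w @[n --> \oo] --> \int[P]_w f w.
Proof.
move=> mf fM ff.
have mlim : measurable_fun setT f.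
  by apply: (@measurable_fun_cvg _ _ _ _ f_) => // w _; exact: ff.
have fM' w : `|f w| <= M.
  apply/ler_addgt0Pl => e e0.
  have /cvgrPdist_le/(_ e e0)[n _ /(_ n (leqnn n)) h] := ff w.
  rewrite -(subrK (f_ n w) (f w)); apply: (le_trans (ler_normD _ _)).
  exact: lerD.
have iM : P.-integrable setT (EFin \o (fun=> M)).
  by apply: (@integrable_bounded_prob _ `|M|) => // w.
have := @dominated_cvg _ _ _ P setT measurableT (fun n w => (f_ n w)%:E)
  (fun w => (f w)%:E) (EFin \o (fun=> M)).
move=> /(_ _ _ _ iM _) H.
apply: fine_cvg; rewrite fineK; last first.
  by apply: integrable_fin_num => //; exact: integrable_bounded_prob fM'.
apply: H => //.
- by move=> n; exact/measurable_EFinP.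
- by move=> w _; apply: cvg_EFin; [exact: nearW|exact: ff].
- by move=> n w _; rewrite lee_fin fM.
Qed.

End bounded_integrals.

Section trigpoly_integrals.
Context {R : realType} (r : nat).
Implicit Types (g : 'rV[R]_r -> R).

(** The boxes grow while the errors shrink, so convergence is pointwise everywhere; the common bound
    [M] makes dominated convergence available. *)
Lemma trigpoly_approx_seq g (M : R) : continuous g -> (forall v, `|g v| <= M) ->
  exists g_ : nat -> 'rV[R]_r -> R, [/\ forall n, trigpoly (g_ n),
    forall n v, `|g_ n v| <= M & forall v, g_ n v @[n --> \oo] --> g v].
Proof.
move=> cg gM.
have H n : exists h : 'rV[R]_r -> R, [/\ trigpoly h, forall v, `|h v| <= M &
    forall v : 'rV[R]_r, (forall i, `|v 0 i| <= n.+1%:R) -> `|g v - h v| <= n.+1%:R^-1].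
  by apply: trigonometric_approximation; rewrite // invr_gt0.
pose g_ n := projT1 (cid (H n)).
have gP n : [/\ trigpoly (g_ n), forall v, `|g_ n v| <= M &
    forall v : 'rV[R]_r, (forall i, `|v 0 i| <= n.+1%:R) -> `|g v - g_ n v| <= n.+1%:R^-1].
  exact: projT2 (cid (H n)).
exists g_; split; [by move=> n; case: (gP n)|by move=> n; case: (gP n)|].
move=> v; apply/cvgrPdist_le => e e0; near=> n.
have [_ _ /(_ v)] := gP n.
have b : forall i, `|v 0 i| <= n.+1%:R.
  move=> i; apply: (@le_trans _ _ (\sum_j `|v 0 j|)).
    by rewrite (bigD1 i)//= lerDl sumr_ge0.
  near: n; exists (Num.truncn (\sum_j `|v 0 j|)) => // n /= h.
  by apply: ltW; rewrite (lt_le_trans (truncnS_gt _))// ler_nat.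
move=> /(_ b)/le_trans; apply.
rewrite -[leRHS]invrK lef_pV2 ?posrE ?invr_gt0//.
near: n; exists (Num.truncn e^-1) => // n /= h.
by apply: ltW; rewrite (lt_le_trans (truncnS_gt _))// ler_nat.
Unshelve. all: by end_near. Qed.

Section one_vector.
Context d (T : measurableType d) (P : probability T R) (X : 'I_r -> T -> R).
Hypothesis mX : forall i, measurable_fun setT (X i).

Lemma measurable_cos_lin (t : 'I_r -> R) c :
  measurable_fun setT (fun w => cos (\sum_i t i * X i w + c)).
Proof.
have mcos : measurable_fun setT (@cos R).
  by apply: continuous_measurable_fun; exact: continuous_cos.
apply: (measurableT_comp mcos); apply: measurable_funD => //.
by apply: measurable_sum => i; exact: measurable_funM.
Qed.

Lemma measurable_trigpoly g : trigpoly g ->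
  measurable_fun setT (fun w => g (\row_i X i w)).
Proof.
elim=> [t c|g1 g2 _ m1 _ m2|k g1 _ m1].
- under eq_fun => w do under eq_bigr do rewrite mxE.
  exact: measurable_cos_lin.
- exact: measurable_funD.
- exact: measurable_funM.
Qed.

Lemma trigpoly_bounded g : trigpoly g -> exists M, forall v, `|g v| <= M.
Proof.
elim=> [t c|g1 g2 _ [M1 h1] _ [M2 h2]|k g1 _ [M1 h1]].
- by exists 1 => v; exact: cos_max.
- by exists (M1 + M2) => v; rewrite (le_trans (ler_normD _ _))// lerD.
- by exists (`|k| * M1) => v; rewrite normrM ler_wpM2l.
Qed.

Lemma integrable_trigpoly g : trigpoly g ->
  P.-integrable setT (EFin \o (fun w => g (\row_i X i w))).
Proof.
move=> tg; have [M gM] := trigpoly_bounded tg.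
by apply: (@integrable_bounded_prob _ _ _ _ _ M) => //; exact: measurable_trigpoly.
Qed.

(** Measurability passes to the limit from trigonometric polynomials, for which it is checked
    coordinate by coordinate. *)
Lemma measurable_continuous_row g (M : R) : continuous g -> (forall v, `|g v| <= M) ->
  measurable_fun setT (fun w => g (\row_i X i w)).
Proof.
move=> cg gM; have [g_ [tg _ cvg]] := trigpoly_approx_seq cg gM.
apply: (@measurable_fun_cvg _ _ _ _ (fun n w => g_ n (\row_i X i w))).
  by move=> n; exact: measurable_trigpoly.
by move=> w _; exact: cvg.
Qed.

End one_vector.

Section two_vectors.
Context d (T : measurableType d) (P : probability T R) (X : 'I_r -> T -> R).
Context d' (T' : measurableType d') (P' : probability T' R) (Y : 'I_r -> T' -> R).
Hypothesis mX : forall i, measurable_fun setT (X i).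
Hypothesis mY : forall i, measurable_fun setT (Y i).
Hypothesis XY : forall t c, \int[P]_w cos (\sum_i t i * X i w + c) =
  \int[P']_w cos (\sum_i t i * Y i w + c).

Lemma eq_Rintegral_trigpoly g : trigpoly g ->
  \int[P]_w g (\row_i X i w) = \int[P']_w g (\row_i Y i w).
Proof.
elim=> [t c|g1 g2 t1 h1 t2 h2|k g1 t1 h1].
- transitivity (\int[P]_w cos (\sum_i t i * X i w + c)).
    by apply: eq_Rintegral => w _; congr (cos (_ + _)); apply: eq_bigr => i _; rewrite mxE.
  rewrite XY; apply: eq_Rintegral => w _; congr (cos (_ + _)).
  by apply: eq_bigr => i _; rewrite mxE.
- have i1 := integrable_trigpoly P mX t1; have i2 := integrable_trigpoly P mX t2.
  have j1 := integrable_trigpoly P' mY t1; have j2 := integrable_trigpoly P' mY t2.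
  by rewrite RintegralD// RintegralD// h1 h2.
- have i1 := integrable_trigpoly P mX t1; have j1 := integrable_trigpoly P' mY t1.
  by rewrite (RintegralZl _ measurableT i1) (RintegralZl _ measurableT j1) h1.
Qed.

Lemma eq_Rintegral_continuous g (M : R) : continuous g -> (forall v, `|g v| <= M) ->
  \int[P]_w g (\row_i X i w) = \int[P']_w g (\row_i Y i w).
Proof.
move=> cg gM; have [g_ [tg g_M cvg]] := trigpoly_approx_seq cg gM.
have c1 : \int[P]_w g_ n (\row_i X i w) @[n --> \oo] --> \int[P]_w g (\row_i X i w).
  apply: (@cvg_Rintegral_bounded _ _ _ _ _ _ M) => //.
  by move=> n; exact: measurable_trigpoly.
have c2 : \int[P']_w g_ n (\row_i Y i w) @[n --> \oo] --> \int[P']_w g (\row_i Y i w).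
  apply: (@cvg_Rintegral_bounded _ _ _ _ _ _ M) => //.
  by move=> n; exact: measurable_trigpoly.
suff E : (fun n => \int[P]_w g_ n (\row_i X i w)) =
    (fun n => \int[P']_w g_ n (\row_i Y i w)).
  by rewrite -(cvg_lim _ c1)// -(cvg_lim _ c2)// E.
by apply/funext => n; exact: eq_Rintegral_trigpoly.
Qed.

End two_vectors.

End trigpoly_integrals.

(** * A law on the line is determined by its cosine integrals *)

Section law_uniqueness.
Context {R : realType}.
Variables (mu nu : probability (measurableTypeR R) R).
Hypothesis munu : forall t c,
  \int[mu]_x cos (t * x + c) = \int[nu]_x cos (t * x + c).

Lemma eq_Rintegral_continuous1 (h : R -> R) (M : R) : continuous h ->
  (forall x, `|h x| <= M) -> \int[mu]_x h x = \int[nu]_x h x.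
Proof.
move=> ch hM.
pose g (v : 'rV[R]_1) := h (v 0 0).
have cg : continuous g.
  by move=> v; apply: continuous_comp; [exact: coord_continuous|exact: ch].
have mid : forall i : 'I_1, measurable_fun setT (fun x : measurableTypeR R => x).
  by move=> _; exact: measurable_id.
have XY (t : 'I_1 -> R) c : \int[mu]_x cos (\sum_i t i * x + c) =
    \int[nu]_x cos (\sum_i t i * x + c).
  have E (m : probability (measurableTypeR R) R) :
      \int[m]_x cos (\sum_i t i * x + c) = \int[m]_x cos (t 0 * x + c).
    by apply: eq_Rintegral => x _; rewrite big_ord1.
  by rewrite !E.
have := @eq_Rintegral_continuous _ 1 _ _ mu (fun _ x => x) _ _ nu (fun _ x => x)
  mid mid XY g M cg (fun v => hM _).
have E (m : probability (measurableTypeR R) R) :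
    \int[m]_x g (\row_(i < 1) x) = \int[m]_x h x.
  by apply: eq_Rintegral => x _; rewrite /g mxE.
by rewrite !E.
Qed.

(** Continuous functions increasing to the indicator of the open ray above [a]. *)
Let ramp (a : R) (n : nat) (x : R) : R := Num.max 0 (Num.min 1 (n%:R * (x - a))).

Let ramp_bounded a n x : `|ramp a n x| <= 1.
Proof.
rewrite ger0_norm; last by rewrite /ramp le_max lexx.
by rewrite /ramp ge_max ler01 ge_min lexx.
Qed.

Let ramp_continuous a n : continuous (ramp a n).
Proof.
move=> x; have cn : {for x, continuous (fun x : R => n%:R * (x - a) : R^o)}.
  apply: cvgM; first exact: cvg_cst.
  by apply: cvgB; [exact: cvg_id|exact: cvg_cst].
have c1 : {for x, continuous (fun=> 1 : R^o)} by exact: cvg_cst.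
have c0 : {for x, continuous (fun=> 0 : R^o)} by exact: cvg_cst.
exact: continuous_max c0 (continuous_min c1 cn).
Qed.

Let ramp_cvg a x : ramp a n x @[n --> \oo] --> (\1_(`]a, +oo[%classic) x : R).
Proof.
rewrite indicE; have [xa|ax] := leP x a.
  rewrite memNset/=; last by rewrite in_itv/= andbT; apply/negP; rewrite -leNgt.
  rewrite (_ : (fun n => ramp a n x) = fun=> 0); first exact: cvg_cst.
  apply/funext => n; rewrite /ramp; apply/max_idPl.
  by rewrite ge_min mulr_ge0_le0 ?orbT// subr_le0.
rewrite mem_set/=; last by rewrite in_itv/= ax.
apply: cvg_near_cst; exists (Num.truncn (x - a)^-1).+1 => // n /= hn.
rewrite /ramp min_l ?max_r//.
rewrite -ler_pdivrMr ?subr_gt0// mul1r; apply: ltW.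
by apply: (lt_le_trans (truncnS_gt _)); rewrite ler_nat.
Qed.

Lemma probability_ray_eq a : mu `]a, +oo[%classic = nu `]a, +oo[%classic.
Proof.
have c (m : probability (measurableTypeR R) R) :
    \int[m]_x ramp a n x @[n --> \oo] --> fine (m `]a, +oo[%classic).
  have -> : fine (m `]a, +oo[%classic) = \int[m]_x (\1_(`]a, +oo[%classic) x : R).
    by rewrite /Rintegral integral_indic ?setIT.
  apply: (@cvg_Rintegral_bounded _ _ _ _ _ _ 1) => // n.
  by apply: continuous_measurable_fun; exact: ramp_continuous.
have E : (fun n => \int[mu]_x ramp a n x) = (fun n => \int[nu]_x ramp a n x).
  apply/funext => n; apply: (@eq_Rintegral_continuous1 _ 1).
    exact: ramp_continuous.
  by move=> x; exact: ramp_bounded.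
rewrite -[LHS]fineK ?fin_num_measure// -[RHS]fineK ?fin_num_measure//.
by congr EFin; rewrite -(cvg_lim _ (c mu))// -(cvg_lim _ (c nu))// E.
Qed.

(** Open rays are stable under intersection and generate the Borel sets, and countably many of them
    cover the line. *)
Theorem law_unique A : measurable A -> mu A = nu A.
Proof.
move=> mA; apply: (@measure_unique _ R (measurableTypeR R) (@RGenOInfty.G R)
  (fun n : nat => `](- n%:R), +oo[%classic) _ _ _ _ mu nu _ _ A mA).
- exact: RGenOInfty.measurableE.
- move=> _ _ [x ->] [y ->]; exists (Num.max x y).
  rewrite eqEsubset; split => z /=; rewrite !in_itv/= !andbT gt_max.
    by move=> [-> ->].
  by move=> /andP[].
- by move=> n; exists (- n%:R).
- rewrite eqEsubset; split => // x _; exists (Num.truncn (- x)).+1 => //=.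
  rewrite in_itv/= andbT ltrNl.
  exact: truncnS_gt.
- by move=> _ [x ->]; exact: probability_ray_eq.
- move=> n; rewrite -ge0_fin_numE ?fin_num_measure//.
Qed.

End law_uniqueness.

(** * Gaussian vectors with a given covariance *)

Section quadratic_forms.
Context {R : realType}.

Definition qform r (K : 'I_r -> 'I_r -> R) (t : 'I_r -> R) : R :=
  \sum_i \sum_j t i * t j * K i j.

Lemma qform_recl r (K : 'I_r.+1 -> 'I_r.+1 -> R) t : (forall i j, K i j = K j i) ->
  qform K t = t ord0 ^+ 2 * K ord0 ord0 +
    2 * t ord0 * (\sum_j t (lift ord0 j) * K ord0 (lift ord0 j)) +
    qform (fun i j => K (lift ord0 i) (lift ord0 j)) (fun j => t (lift ord0 j)).
Proof.
move=> sK; rewrite /qform big_ord_recl/= big_ord_recl/= -!addrA; congr (_ + _).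
under [X in _ + X = _]eq_bigr do rewrite big_ord_recl/=.
rewrite big_split/= addrA; congr (_ + _).
rewrite -mulrA mulr2n mulrDl mul1r mulr_sumr -big_split -big_split/=.
by apply: eq_bigr => j _; rewrite (sK (lift ord0 j)); ring.
Qed.

Lemma qform_subr_tensor r (K : 'I_r -> 'I_r -> R) (u : 'I_r -> R) (a : R) t :
  qform (fun i j => K i j - u i * u j * a) t =
  qform K t - (\sum_j t j * u j) ^+ 2 * a.
Proof.
rewrite /qform expr2 mulr_suml mulr_suml -sumrB; apply: eq_bigr => i _.
rewrite mulr_sumr mulr_suml -sumrB; apply: eq_bigr => j _; ring.
Qed.

Lemma psd_row0 r (K : 'I_r.+1 -> 'I_r.+1 -> R) : (forall i j, K i j = K j i) ->
  (forall t, 0 <= qform K t) -> K ord0 ord0 = 0 -> forall j, K ord0 (lift ord0 j) = 0.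
Proof.
move=> sK pK K0 j; apply/eqP/negP => /negP Kj.
pose t x (i : 'I_r.+1) : R := if i == ord0 then x else (i == lift ord0 j)%:R.
have t0 x : t x ord0 = x by rewrite /t eqxx.
have tl x i : t x (lift ord0 i) = (i == j)%:R.
  by rewrite /t eq_sym (negbTE (neq_lift _ _)) (inj_eq lift_inj).
have tE x : qform K (t x) = 2 * x * K ord0 (lift ord0 j) +
    K (lift ord0 j) (lift ord0 j).
  rewrite qform_recl// K0 mulr0 add0r t0; congr (_ * _ + _).
    rewrite (bigD1 j)//= tl eqxx mul1r big1 ?addr0// => i ij.
    by rewrite tl (negbTE ij) mul0r.
  rewrite /qform (bigD1 j)//= [X in _ + X]big1 ?addr0; last first.
    by move=> i ij; apply: big1 => k _; rewrite !tl (negbTE ij) !mul0r.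
  rewrite (bigD1 j)//= !tl eqxx !mul1r big1 ?addr0// => i ij.
  by rewrite !tl (negbTE ij) mulr0 mul0r.
(* Along [t x] the form is affine in x with a nonzero slope; this x gives it the value -1. *)
have := pK (t (- (K (lift ord0 j) (lift ord0 j) + 1) / (2 * K ord0 (lift ord0 j)))).
rewrite tE; set x := K (lift _ _) _; rewrite (_ : 2 * _ * _ = - (x + 1)).
  by lra.
by field.
Qed.

End quadratic_forms.

Section gaussian_existence.
Context {R : realType}.

(* The phases [c = 0] and [c = - pi / 2] give the real and imaginary parts of
   the characteristic function. *)
Definition gaussian_cos r (K : 'I_r -> 'I_r -> R) d (T : measurableType d)
    (P : probability T R) (G : 'I_r -> T -> R) : Prop :=
  (forall i, measurable_fun setT (G i)) /\
  forall t c, \int[P]_w cos (\sum_i t i * G i w + c) =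
    expR (- (qform K t / 2)) * cos c.

(* One step of the Cholesky decomposition: the covariance of the remaining
   coordinates is the Schur complement of [K ord0 ord0]. If [K ord0 ord0 = 0],
   then the row [K ord0] vanishes and the junk value [x / 0 = 0] is harmless. *)
Lemma gaussian_cos_step r (K : 'I_r.+1 -> 'I_r.+1 -> R) d (T : measurableType d)
    (P : probability T R) (G : 'I_r -> T -> R) :
  (forall i j, K i j = K j i) -> (forall t, 0 <= qform K t) ->
  gaussian_cos (fun i j => K (lift ord0 i) (lift ord0 j) -
    K ord0 (lift ord0 i) * K ord0 (lift ord0 j) * (K ord0 ord0)^-1) P G ->
  gaussian_cos K (P \x normal_prob 0 1)%E
    (fun i (z : T * measurableTypeR R) => if unlift ord0 i is Some j
      then K ord0 i / Num.sqrt (K ord0 ord0) * z.2 + G j z.1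
      else Num.sqrt (K ord0 ord0) * z.2).
Proof.
move=> sK pK [mG EG]; set H := fun i => _; split.
  move=> i; rewrite /H; case: (unlift ord0 i) => [j|].
    apply: measurable_funD; first by apply: measurable_funM => //; exact: measurable_snd.
    by apply: measurableT_comp => //; exact: measurable_fst.
  by apply: measurable_funM => //; exact: measurable_snd.
move=> t c; set k := K ord0 ord0; set q := Num.sqrt k.
have k0 : 0 <= k.
  pose e (i : 'I_r.+1) : R := (i == ord0)%:R.
  have el j : e (lift ord0 j) = 0 by rewrite /e eq_sym (negbTE (neq_lift _ _)).
  have := pK e; rewrite qform_recl// {1}/e eqxx expr1n mul1r.
  have -> : \sum_j e (lift ord0 j) * K ord0 (lift ord0 j) = 0.
    by apply: big1 => j _; rewrite el mul0r.
  have -> : qform (fun i j => K (lift ord0 i) (lift ord0 j)) (fun j => e (lift ord0 j)) = 0.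
    by apply: big1 => i _; apply: big1 => j _; rewrite !el !mul0r.
  by rewrite mulr0 !addr0.
pose S := \sum_j t (lift ord0 j) * K ord0 (lift ord0 j).
(* Total coefficient of the new normal variable [z.2] in the linear combination; its square is what
   K adds to the form of the Schur complement. *)
pose al := t ord0 * q + S / q.
pose Q := qform (fun i j => K (lift ord0 i) (lift ord0 j) -
    K ord0 (lift ord0 i) * K ord0 (lift ord0 j) * k^-1) (fun j => t (lift ord0 j)).
have alQ : qform K t = al ^+ 2 + Q.
  rewrite qform_recl// /Q qform_subr_tensor -/S -/k /al.
  have [k00|kN0] := eqVneq k 0.
    have S0 : S = 0.
      by rewrite /S big1// => j _; rewrite (psd_row0 sK pK k00) mulr0.
    have q0 : q = 0 by rewrite /q k00 sqrtr0.
    by rewrite k00 q0 S0 !mul0r; ring.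
  have q2 : q ^+ 2 = k by rewrite sqr_sqrtr.
  have qN0 : q != 0 by rewrite -sqrf_eq0 q2.
  by rewrite -q2; field.
have sumE z : \sum_i t i * H i z = al * z.2 + \sum_j t (lift ord0 j) * G j z.1.
  rewrite big_ord_recl/= /H unlift_none.
  under eq_bigr do rewrite liftK mulrDr mulrA.
  rewrite big_split/= -mulr_suml addrA mulrA -mulrDl; congr (_ * _ + _).
  rewrite /al /S; congr (_ + _); rewrite mulr_suml.
  by apply: eq_bigr => j _; rewrite mulrA.
pose f (z : T * measurableTypeR R) := cos (\sum_j t (lift ord0 j) * G j z.1 + (al * z.2 + c)).
have mcos : measurable_fun setT (@cos R).
  by apply: continuous_measurable_fun; exact: continuous_cos.
have mf : measurable_fun setT f.
  apply: (measurableT_comp mcos); apply: measurable_funD.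
    apply: measurable_sum => j; apply: measurable_funM => //.
    by apply: measurableT_comp => //; exact: measurable_fst.
  apply: measurable_funD => //; apply: measurable_funM => //; exact: measurable_snd.
have iF : (P \x normal_prob 0 1)%E.-integrable setT (EFin \o f).
  by apply: (@integrable_bounded_prob _ _ _ _ _ 1) => // z; exact: cos_max.
transitivity (\int[(P \x normal_prob 0 1)%E]_z f z).
  by apply: eq_Rintegral => z _; rewrite sumE /f; congr cos; ring.
(* The old coordinates are integrated first, the new variable y being frozen in the phase al y + c;
   this is the use of arbitrary phases. *)
rewrite /Rintegral -integral21_prod_meas1//.
transitivity (\int[normal_prob 0 1]_y (expR (- (Q / 2)) * cos (al * y + c))).
  congr fine; apply: eq_integral => y _; rewrite /fubini_G -EG /Rintegral fineK//.
  apply: integrable_fin_num => //.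
  apply: (@integrable_bounded_prob _ _ _ _ _ 1) => [|z]; last exact: cos_max.
  exact: measurable_cos_lin.
rewrite RintegralZl//; last first.
  apply: (@integrable_bounded_prob _ _ _ _ _ 1) => [|z]; last exact: cos_max.
  apply: (measurableT_comp mcos); apply: measurable_funD => //.
rewrite Rintegral_normal_cos ?ltr01// expr1n mul1r mulrA -expRD alQ.
by congr (expR _ * _); field.
Qed.

Theorem gaussian_exists r (K : 'I_r -> 'I_r -> R) :
  (forall i j, K i j = K j i) -> (forall t, 0 <= qform K t) ->
  exists (d : measure_display) (T : measurableType d) (P : probability T R)
    (G : 'I_r -> T -> R), gaussian_cos K P G.
Proof.
elim: r K => [|r IH] K sK pK.
  exists _, (measurableTypeR R), (normal_prob 0 1), (fun _ x => x).
  split=> [i|t c]; first exact: measurable_id.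
  rewrite /qform big_ord0 mul0r oppr0 expR0 mul1r.
  under eq_Rintegral do rewrite big_ord0 add0r.
  exact: Rintegral_prob_cst.
have [||d [T [P [G HG]]]] := IH (fun i j => K (lift ord0 i) (lift ord0 j) -
    K ord0 (lift ord0 i) * K ord0 (lift ord0 j) * (K ord0 ord0)^-1).
- by move=> i j; rewrite sK; ring.
- move=> t; rewrite qform_subr_tensor; set S := \sum_j _.
  (* This first coordinate minimizes the form of K when [K ord0 ord0] is nonzero, and the minimum is
     the form of the Schur complement. *)
  pose u (i : 'I_r.+1) := if unlift ord0 i is Some j then t j else - S / K ord0 ord0.
  have := pK u; rewrite qform_recl// {1 2}/u unlift_none.
  have -> : \sum_j u (lift ord0 j) * K ord0 (lift ord0 j) = S.
    by apply: eq_bigr => j _; rewrite /u liftK.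
  have -> : qform (fun i j => K (lift ord0 i) (lift ord0 j)) (fun j => u (lift ord0 j))
     = qform (fun i j => K (lift ord0 i) (lift ord0 j)) t.
    by apply: eq_bigr => i _; apply: eq_bigr => j _; rewrite /u !liftK.
  have [K0|KN0] := eqVneq (K ord0 ord0) 0.
    have S0 : S = 0.
      by rewrite /S big1// => j _; rewrite (psd_row0 sK pK K0) mulr0.
    by rewrite K0 invr0 S0 oppr0 !mulr0 !add0r subr0.
  rewrite (_ : _ + _ + _ = qform (fun i j => K (lift ord0 i) (lift ord0 j)) t -
     S ^+ 2 / K ord0 ord0)//.
  by field.
do 4 eexists; exact: gaussian_cos_step HG.
Qed.

End gaussian_existence.

Section gaussian_law.
Context {R : realType} (r : nat) (K : 'I_r -> 'I_r -> R).
Hypothesis pK : forall t, 0 <= qform K t.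
Context d (T : measurableType d) (P : probability T R) (G : 'I_r -> T -> R).
Hypothesis GK : gaussian_cos K P G.

Let mG i : measurable_fun setT (G i). Proof. by case: GK => mG _; exact: mG. Qed.

Let lin (a : 'I_r -> R) (w : T) : R := \sum_i a i * G i w.

Let mlin a : measurable_fun setT (lin a).
Proof. by apply: measurable_sum => i; exact: measurable_funM. Qed.

Let mlinR a : measurable_fun setT (lin a : T -> measurableTypeR R).
Proof. exact: mlin. Qed.

Let Y a : {mfun T >-> measurableTypeR R} :=
  @mfun_Sub _ _ T (measurableTypeR R) (lin a) (mem_set (mlinR a)).

Let law_cos a t c : \int[distribution P (Y a)]_x cos (t * x + c) =
  expR (- (qform K a * t ^+ 2 / 2)) * cos c.
Proof.
have mcos : measurable_fun setT (@cos R).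
  by apply: continuous_measurable_fun; exact: continuous_cos.
have mc : measurable_fun setT (fun x : measurableTypeR R => (cos (t * x + c))%:E).
  apply/measurable_EFinP; apply: (measurableT_comp mcos).
  by apply: measurable_funD.
rewrite {1}/Rintegral integral_distribution//; last first.
  apply: (@integrable_bounded_prob _ _ _ _ _ 1) => [|w]; last exact: cos_max.
  apply: (measurableT_comp mcos); apply: measurable_funD => //.
  by apply: measurable_funM => //; exact: mlin.
transitivity (\int[P]_w cos (\sum_i (t * a i) * G i w + c)).
  congr fine; apply: eq_integral => w _ /=; congr (cos (_ + _))%:E.
  by rewrite /lin mulr_sumr; apply: eq_bigr => i _; rewrite mulrA.
case: GK => _ ->; congr (expR (- (_ / 2)) * _).
rewrite /qform mulr_suml; apply: eq_bigr => i _; rewrite mulr_suml.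
by apply: eq_bigr => j _; ring.
Qed.

(** The law of the linear combination is identified by its cosine integrals, as a point mass or a
    normal law. Packing the moments with [nu] spares later proofs this distinction. *)
Lemma gaussian_cos_law a : exists nu : probability (measurableTypeR R) R,
  [/\ forall A, measurable A -> P (lin a @^-1` A) = nu A,
      forall A, nu A = gaussian_law 0 (Num.sqrt (qform K a)) A,
      nu.-integrable setT (EFin \o (fun x => x ^+ 2)),
      \int[nu]_x x = 0 & \int[nu]_x (x ^+ 2) = qform K a].
Proof.
set s := Num.sqrt (qform K a).
have s2 : s ^+ 2 = qform K a by rewrite sqr_sqrtr.
have [s0|sN0] := eqVneq s 0.
  exists (dirac (0 : measurableTypeR R)); split.
  - move=> A mA; apply: (law_unique (mu := distribution P (Y a))) => // t c.
    rewrite law_cos -s2 s0 expr0n/= !mul0r oppr0 expR0 mul1r.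
    rewrite /Rintegral integral_dirac//.
      by rewrite diracT mul1e mulr0 add0r.
    apply/measurable_EFinP; apply: measurableT_comp.
      by apply: continuous_measurable_fun; exact: continuous_cos.
    by apply: measurable_funD.
  - by move=> A; rewrite /gaussian_law s0 eqxx.
  - apply/integrableP; split.
      by apply/measurable_EFinP; exact: measurable_funX.
    rewrite integral_dirac//; first by rewrite diracT mul1e /= expr0n/= normr0 ltry.
    apply: measurableT_comp => //; apply/measurable_EFinP; exact: measurable_funX.
  - by rewrite /Rintegral integral_dirac// diracT mul1e.
  - rewrite /Rintegral integral_dirac//; first by rewrite diracT mul1e -s2 s0.
    by apply/measurable_EFinP; exact: measurable_funX.
have s_gt0 : 0 < s by rewrite lt_neqAle eq_sym sN0 sqrtr_ge0.
exists (normal_prob 0 s); split.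
- move=> A mA; apply: (law_unique (mu := distribution P (Y a))) => // t c.
  by rewrite law_cos Rintegral_normal_cos// s2.
- by move=> A; rewrite /gaussian_law (negbTE sN0).
- exact: (@integrable_normal_pow _ _ s_gt0 2).
- exact: Rintegral_normal_id.
- by rewrite Rintegral_normal_sqr.
Qed.

Lemma gaussian_cos_moments a : [/\
  P.-integrable setT (EFin \o (fun w => lin a w ^+ 2)),
  \int[P]_w lin a w = 0 & \int[P]_w (lin a w ^+ 2) = qform K a].
Proof.
have [nu [Pnu _ i2 m1 m2]] := gaussian_cos_law a.
have E (f : measurableTypeR R -> \bar R) :
    (\int[distribution P (Y a)]_x f x = \int[nu]_x f x)%E.
  by apply: eq_measure_integral => A mA _; exact: Pnu.
have mX2 : measurable_fun setT (fun x : measurableTypeR R => x ^+ 2).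
  exact: measurable_funX.
have mX : measurable_fun setT (fun x : measurableTypeR R => x).
  exact: measurable_id.
have iY2 : P.-integrable setT (EFin \o (fun w => lin a w ^+ 2)).
  apply/integrableP; split.
    by apply/measurable_EFinP; exact: measurable_funX.
  under eq_integral do rewrite /= ger0_norm ?sqr_ge0//.
  have mf : measurable_fun setT (fun x : measurableTypeR R => (x ^+ 2)%:E).
    exact/measurable_EFinP.
  have f0 (x : measurableTypeR R) : (0 <= (x ^+ 2)%:E)%E by rewrite lee_fin sqr_ge0.
  have /= <- := @ge0_integral_distribution _ _ _ _ _ P (Y a) _ mf f0; rewrite E.
  have /integrableP[_] := i2.
  by under eq_integral do rewrite /= ger0_norm ?sqr_ge0//.
split=> //.
- rewrite -m1 /Rintegral -E integral_distribution//.
  apply: (@le_integrable _ _ _ P setT measurableT _ (EFin \o (fun w => 1 + lin a w ^+ 2))).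
  + by apply/measurable_EFinP; exact: mlin.
  + move=> w _ /=; rewrite lee_fin [leRHS]ger0_norm ?addr_ge0 ?sqr_ge0//.
    rewrite -[lin a w ^+ 2](real_normK (num_real (lin a w))).
    have := sqr_ge0 (`|lin a w| - 1); have := normr_ge0 (lin a w).
    by rewrite sqrrB1; lra.
  + under [EFin \o _]funext do rewrite /= EFinD.
    by apply: integrableD => //; exact: finite_measure_integrable_cst.
- rewrite -m2 /Rintegral -E integral_distribution//; exact/measurable_EFinP.
Qed.

End gaussian_law.

Section delta_forms.
Context {R : realType} (r : nat).

(** Coefficients of G_i + e G_j: e = 0 yields means and variances, e = 1 and e = -1 yield
    covariances by polarization. *)
Definition delta_pair (i j : 'I_r) (e : R) (k : 'I_r) : R :=
  (k == i)%:R + e * (k == j)%:R.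

Lemma sum_delta_pair i j e (F : 'I_r -> R) :
  \sum_k delta_pair i j e k * F k = F i + e * F j.
Proof.
under eq_bigr do rewrite mulrDl -mulrA.
rewrite big_split/= -mulr_sumr; congr (_ + _ * _).
  rewrite (bigD1 i)//= eqxx mul1r big1 ?addr0// => k /negbTE ->.
  by rewrite mul0r.
rewrite (bigD1 j)//= eqxx mul1r big1 ?addr0// => k /negbTE ->.
by rewrite mul0r.
Qed.

Lemma qform_delta_pair (K : 'I_r -> 'I_r -> R) i j e :
  (forall i j, K i j = K j i) ->
  qform K (delta_pair i j e) = K i i + 2 * e * K i j + e ^+ 2 * K j j.
Proof.
move=> sK; rewrite /qform.
under eq_bigr => k _.
  under eq_bigr do rewrite -mulrA.
  rewrite -mulr_sumr sum_delta_pair; over.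
by rewrite sum_delta_pair (sK j i); ring.
Qed.

End delta_forms.

Section gaussian_covariance.
Context {R : realType} (r : nat) (K : 'I_r -> 'I_r -> R).
Hypothesis sK : forall i j, K i j = K j i.
Hypothesis pK : forall t, 0 <= qform K t.
Context d (T : measurableType d) (P : probability T R) (G : 'I_r -> T -> R).
Hypothesis GK : gaussian_cos K P G.

Let linE i j e w :
  \sum_k delta_pair i j e k * G k w = G i w + e * G j w.
Proof. exact: (sum_delta_pair i j e (fun k => G k w)). Qed.

Lemma gaussian_cos_mean i : \int[P]_w G i w = 0.
Proof.
have [_ h _] := gaussian_cos_moments pK GK (delta_pair i i 0).
by rewrite -[RHS]h; apply: eq_Rintegral => w _; rewrite linE mul0r addr0.
Qed.

Lemma integrable_gaussian_cos_sqr i : P.-integrable setT (EFin \o (fun w => G i w ^+ 2)).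
Proof.
have [h _ _] := gaussian_cos_moments pK GK (delta_pair i i 0).
by move: h; under [EFin \o _]funext do rewrite /= linE mul0r addr0.
Qed.

Lemma gaussian_cos_sqr i : \int[P]_w (G i w ^+ 2) = K i i.
Proof.
have [_ _ h] := gaussian_cos_moments pK GK (delta_pair i i 0).
rewrite qform_delta_pair// expr0n/= !mulr0 !mul0r !addr0 in h.
by rewrite -[RHS]h; apply: eq_Rintegral => w _; rewrite linE mul0r addr0.
Qed.

Lemma gaussian_cos_prod i j : (\int[P]_w (G i w * G j w)%:E)%E = (K i j)%:E.
Proof.
have [i1 _ h1] := gaussian_cos_moments pK GK (delta_pair i j 1).
have [i2 _ h2] := gaussian_cos_moments pK GK (delta_pair i j (-1)).
rewrite qform_delta_pair// in h1; rewrite qform_delta_pair// in h2.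
set f1 := fun w => _ in i1 h1; set f2 := fun w => _ in i2 h2.
have E w : G i w * G j w = 4^-1 * (f1 w - f2 w).
  by rewrite /f1 /f2 !linE; field.
have i12 : P.-integrable setT (fun w => (f1 w - f2 w)%:E).
  by under eq_fun do rewrite EFinB; apply: integrableB.
have iE : P.-integrable setT (fun w => (4^-1 * (f1 w - f2 w))%:E).
  by under eq_fun do rewrite EFinM; apply: integrableZl.
under eq_integral do rewrite E.
rewrite -[LHS]fineK; last exact: integrable_fin_num.
congr EFin; rewrite -[LHS]/(Rintegral P setT (fun w => 4^-1 * (f1 w - f2 w))).
by rewrite (RintegralZl _ measurableT i12) (RintegralB measurableT i1 i2) h1 h2; field.
Qed.

Variable X : 'I_r -> {RV P >-> R}.
Hypothesis XG : forall i, X i = G i :> (T -> R).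

Lemma gaussian_cos_expectation i : 'E_P[X i]%E = 0%E.
Proof.
rewrite unlock XG -[LHS]fineK; last first.
  apply: integrable_fin_num => //.
  apply: (@le_integrable _ _ _ P setT measurableT _ (EFin \o (fun w => 1 + G i w ^+ 2))).
  - by apply/measurable_EFinP; case: GK.
  - move=> w _ /=; rewrite lee_fin [leRHS]ger0_norm ?addr_ge0 ?sqr_ge0//.
    rewrite -[G i w ^+ 2](real_normK (num_real (G i w))).
    have := sqr_ge0 (`|G i w| - 1); have := normr_ge0 (G i w).
    by rewrite sqrrB1; lra.
  - under [EFin \o _]funext do rewrite /= EFinD.
    apply: integrableD => //; first exact: finite_measure_integrable_cst.
    exact: integrable_gaussian_cos_sqr.
by congr EFin; exact: gaussian_cos_mean.
Qed.

Lemma gaussian_cos_covariance i j : covariance P (X i) (X j) = (K i j)%:E.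
Proof.
rewrite unlock !gaussian_cos_expectation/= unlock -gaussian_cos_prod.
apply: eq_integral => w _; rewrite ?fctE -!XG.
by congr (_ * _)%:E; exact: subr0.
Qed.

Lemma gaussian_cos_vector : gaussian_vector X.
Proof.
move=> a; exists 0, (Num.sqrt (qform K a)); split; first exact: sqrtr_ge0.
move=> A mA; have [nu [Pnu nuE _ _ _]] := gaussian_cos_law pK GK a.
have -> : (fun w => \sum_i a i * X i w) = (fun w => \sum_i a i * G i w).
  by apply/funext => w; apply: eq_bigr => i _; rewrite XG.
by rewrite -nuE -Pnu.
Qed.

End gaussian_covariance.

(** * Convergence in distribution from cosine integrals and bounded second moments *)

Section convergence_criterion.
Context {R : realType} (r : nat).
Context (d : nat -> measure_display) (T : forall N, measurableType (d N))
  (P : forall N, probability (T N) R) (X : forall N, 'I_r -> T N -> R).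
Context d' (T' : measurableType d') (P' : probability T' R) (Y : 'I_r -> T' -> R).
Variable B : R.
Hypothesis mX : forall N i, measurable_fun setT (@X N i).
Hypothesis mY : forall i, measurable_fun setT (Y i).
Hypothesis iX : forall N i, (P N).-integrable setT (EFin \o (fun w => X i w ^+ 2)).
Hypothesis iY : forall i, P'.-integrable setT (EFin \o (fun w => Y i w ^+ 2)).
Hypothesis XB : forall N i, \int[P N]_w (X i w ^+ 2) <= B.
Hypothesis YB : forall i, \int[P']_w (Y i w ^+ 2) <= B.
Hypothesis XY : forall t c,
  \int[P N]_w cos (\sum_i t i * X i w + c) @[N --> \oo] -->
  \int[P']_w cos (\sum_i t i * Y i w + c).

Lemma cvg_Rintegral_trigpoly g : trigpoly g ->
  \int[P N]_w g (\row_i X i w) @[N --> \oo] --> \int[P']_w g (\row_i Y i w).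
Proof.
elim=> [t c|g1 g2 t1 h1 t2 h2|k g1 t1 h1].
- have E dU (U : measurableType dU) (Q : probability U R) (V : 'I_r -> U -> R) :
      \int[Q]_w cos (\sum_i t i * (\row_i V i w) 0 i + c) =
      \int[Q]_w cos (\sum_i t i * V i w + c).
    by apply: eq_Rintegral => w _; congr (cos (_ + _)); apply: eq_bigr => i _; rewrite mxE.
  rewrite E; under eq_fun do rewrite E.
  exact: XY.
- have E dU (U : measurableType dU) (Q : probability U R) (V : 'I_r -> U -> R) :
      (forall i, measurable_fun setT (V i)) ->
      \int[Q]_w (g1 (\row_i V i w) + g2 (\row_i V i w)) =
      \int[Q]_w g1 (\row_i V i w) + \int[Q]_w g2 (\row_i V i w).
    move=> mV.
    exact: (RintegralD measurableT (integrable_trigpoly Q mV t1) (integrable_trigpoly Q mV t2)).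
  by rewrite E//; under eq_fun do rewrite E//; exact: cvgD.
- have E dU (U : measurableType dU) (Q : probability U R) (V : 'I_r -> U -> R) :
      (forall i, measurable_fun setT (V i)) ->
      \int[Q]_w (k * g1 (\row_i V i w)) = k * \int[Q]_w g1 (\row_i V i w).
    by move=> mV; exact: (RintegralZl _ measurableT (integrable_trigpoly Q mV t1)).
  by rewrite E//; under eq_fun do rewrite E//; apply: cvgMr.
Qed.

Lemma cvg_Rintegral_continuous (f : 'rV[R]_r -> R) (M : R) : continuous f ->
  (forall v, `|f v| <= M) ->
  \int[P N]_w f (\row_i X i w) @[N --> \oo] --> \int[P']_w f (\row_i Y i w).
Proof.
move=> cf fM; apply/cvgrPdist_le => e e0.
have M0 : 0 <= M := le_trans (normr_ge0 _) (fM 0).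
(* Chosen so that, with L^2 = c / e5, the second moments make the contribution from outside the box
   at most e5; the added 1 keeps c positive. *)
pose c := 2 * M * (r%:R * `|B|) + 1.
have c0 : 0 < c by rewrite ltr_wpDl// !mulr_ge0.
(* Replacing f by g costs 2 e5 for each of X and Y, and the convergence for g costs e5. *)
pose e5 := e / 5.
have e50 : 0 < e5 by rewrite divr_gt0.
pose L := Num.sqrt (c / e5).
have L0 : 0 < L by rewrite sqrtr_gt0 divr_gt0.
have L2 : L ^+ 2 = c / e5 by rewrite sqr_sqrtr// ltW// divr_gt0.
have [g [tg gM fg]] := trigonometric_approximation cf fM L0 e50.
pose D := 2 * M / L ^+ 2.
have D0 : 0 <= D by exact: divr_ge0 (mulr_ge0 _ M0) (sqr_ge0 _).
(* Outside the box some coordinate exceeds L, so that 2 M is at most D times the sum of squares, as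
   in Chebyshev's inequality. *)
have bound (v : 'rV[R]_r) : `|f v - g v| <= e5 + D * \sum_i v 0 i ^+ 2.
  have S0 : 0 <= \sum_i v 0 i ^+ 2 by apply: sumr_ge0 => i _; exact: sqr_ge0.
  have [/forallP vL|/forallPn[i vi]] := boolP [forall i, `|v 0 i| <= L].
    by rewrite (le_trans (fg _ vL))// lerDl mulr_ge0.
  apply: (@le_trans _ _ (2 * M)).
    by rewrite (le_trans (ler_normB _ _))// mulr2n mulrDl mul1r lerD.
  apply: (@le_trans _ _ (D * \sum_i v 0 i ^+ 2)); last by rewrite lerDr ltW.
  apply: (@le_trans _ _ (D * L ^+ 2)).
    by rewrite /D divfK// gt_eqF// exprn_gt0.
  apply: ler_wpM2l => //; rewrite (bigD1 i)//=.
  apply: (@le_trans _ _ (v 0 i ^+ 2)); last first.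
    by rewrite lerDl sumr_ge0// => j _; exact: sqr_ge0.
  rewrite -[v 0 i ^+ 2](real_normK (num_real (v 0 i))); apply: lerXn2r; rewrite ?nnegrE//.
    exact: ltW.
  by rewrite -ltNge in vi; exact: ltW.
have E dU (U : measurableType dU) (Q : probability U R) (V : 'I_r -> U -> R) :
    (forall i, measurable_fun setT (V i)) ->
    (forall i, Q.-integrable setT (EFin \o (fun w => V i w ^+ 2))) ->
    (forall i, \int[Q]_w (V i w ^+ 2) <= B) ->
    `|\int[Q]_w f (\row_i V i w) - \int[Q]_w g (\row_i V i w)| <= 2 * e5.
  move=> mV iV VB.
  have mfV := measurable_continuous_row mV cf fM.
  have ifV : Q.-integrable setT (EFin \o (fun w => f (\row_i V i w))).
    exact: integrable_bounded_prob mfV (fun w => fM _).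
  have igV := integrable_trigpoly Q mV tg.
  rewrite -(RintegralB measurableT ifV igV).
  have ifg : Q.-integrable setT (EFin \o (fun w => f (\row_i V i w) - g (\row_i V i w))).
    by under [EFin \o _]funext do rewrite /= EFinB; apply: integrableB.
  apply: (le_trans (le_normr_Rintegral measurableT ifg)).
  have iS (s : seq 'I_r) : Q.-integrable setT (EFin \o (fun w => \sum_(i <- s) V i w ^+ 2)) /\
      \int[Q]_w (\sum_(i <- s) V i w ^+ 2) <= (size s)%:R * `|B|.
    elim: s => [|i s [IH1 IH2]].
      under [EFin \o _]funext do rewrite /= big_nil.
      under eq_Rintegral do rewrite big_nil.
      rewrite (Rintegral_prob_cst Q) mul0r lexx; split => //.
      exact: finite_measure_integrable_cst.
    under [EFin \o _]funext do rewrite /= big_cons EFinD.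
    under eq_Rintegral do rewrite big_cons.
    rewrite (RintegralD measurableT (iV i) IH1) -[size _]/(size s).+1 -[_.+1%:R]natr1.
    rewrite mulrDl mul1r addrC.
    split; first exact: (integrableD measurableT (iV i) IH1).
    by apply: lerD => //; rewrite (le_trans (VB i))// ler_norm.
  have [iS1 iS2] := iS (index_enum 'I_r).
  have iDS : Q.-integrable setT (EFin \o (fun w => D * \sum_i V i w ^+ 2)).
    by under [EFin \o _]funext do rewrite /= EFinM; apply: integrableZl.
  have ie : Q.-integrable setT (EFin \o (fun=> e5)).
    exact: finite_measure_integrable_cst.
  apply: (@le_trans _ _ (\int[Q]_w (e5 + D * \sum_i V i w ^+ 2))).
    apply: le_Rintegral => //.
    - by move/integrable_abse : ifg.
    - by under [EFin \o _]funext do rewrite /= EFinD; apply: integrableD.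
    - move=> w _; apply: (le_trans (bound _)); rewrite lerD2l ler_wpM2l//.
      by apply: ler_sum => i _; rewrite mxE.
  rewrite (RintegralD measurableT ie iDS) (Rintegral_prob_cst Q).
  rewrite (RintegralZl _ measurableT iS1) mulr2n mulrDl mul1r lerD2l.
  apply: (le_trans (ler_wpM2l D0 iS2)).
  have -> : (size (index_enum 'I_r))%:R = r%:R :> R.
    by rewrite -[in RHS](card_ord r) cardT enumT.
  rewrite /D L2 mulrAC ler_pdivrMr ?divr_gt0// (mulrC e5) divfK ?gt_eqF//.
  by rewrite /c lerDl.
have := cvg_Rintegral_trigpoly tg => /cvgrPdist_le/(_ e5 e50).
apply: filterS => N gN.
have EX := E _ _ (P N) (@X N) (@mX N) (@iX N) (@XB N).
have EY := E _ _ P' Y mY iY YB.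
have e5E : e = 5 * e5 by rewrite /e5; field.
move: gN EX EY; rewrite e5E !ler_norml.
move=> /andP[? ?] /andP[? ?] /andP[? ?]; apply/andP; split; lra.
Qed.

End convergence_criterion.

(** * Limits of the mean and the variance *)

Section exact_variance.
Variables (R : realType) (theta : R).
Hypothesis theta_gt0 : 0 < theta.
Notation E := (Eewens theta).
Variable a : nat -> R.

Let sA n : R := \sum_(i < n) a i * i%:R.
Let sB n : R := \sum_(i < n) a i ^+ 2 * i%:R.
Let sC n : R := \sum_(i < n) (a i * i%:R) ^+ 2.
Let sP n : R := \sum_(j < n) a j * sA j.
Let sP' n : R := \sum_(j < n) a j * j%:R * sA j.

Let sAS n : sA n.+1 = sA n + a n * n%:R.
Proof. by rewrite /sA big_ord_recr. Qed.

Let sA_sqr n : sA n ^+ 2 = sC n + 2 * sP' n.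
Proof.
elim: n => [|n IH]; first by rewrite /sA /sC /sP' !big_ord0; ring.
by rewrite sAS sqrrD IH /sC /sP' !big_ord_recr/=; ring.
Qed.

Let dbl (D : R) n : R := \sum_(i < n) \sum_(j < n)
  a i * a j * (Num.min i%:R j%:R * (D - Num.max i%:R j%:R)).

Let dblE D n : dbl D n = 2 * (D * sP n - sP' n) + (D * sB n - sC n).
Proof.
elim: n => [|n IH].
  by rewrite /dbl /sP /sP' /sB /sC !big_ord0; ring.
rewrite /dbl big_ord_recr/=.
under eq_bigr do rewrite big_ord_recr/=.
rewrite big_split/= -/(dbl D n) IH [X in _ + X]big_ord_recr/= minxx maxxx.
have c1 : \sum_(i < n) a i * a n * (Num.min i%:R n%:R * (D - Num.max i%:R n%:R)) =
    a n * (D - n%:R) * sA n.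
  rewrite mulr_sumr; apply: eq_bigr => i _.
  have /ltW h : i%:R < n%:R :> R by rewrite ltr_nat.
  by rewrite (min_idPl h) (max_idPr h); ring.
have c2 : \sum_(i < n) a n * a i * (Num.min n%:R i%:R * (D - Num.max n%:R i%:R)) =
    a n * (D - n%:R) * sA n.
  rewrite mulr_sumr; apply: eq_bigr => i _.
  have /ltW h : i%:R < n%:R :> R by rewrite ltr_nat.
  by rewrite (min_idPr h) (max_idPl h); ring.
by rewrite c1 c2 /sP /sP' /sB /sC !big_ord_recr/=; ring.
Qed.

(** The square in [cvar] brings back the variance of the deficits itself, so the variances obey a
    genuine linear recursion and not a mere summation. *)
Let Ecvar n : E (fun s : 'S_n.+1 => cvar theta a s) =
  (theta + n.+1%:R) * (n.+1%:R * a n.+1 ^+ 2 - 2 * a n.+1 * (sA n.+1 / (theta + n%:R)) +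
     sB n.+1 / (theta + n%:R)) -
  (n.+1%:R * a n.+1 - sA n.+1 / (theta + n%:R)) ^+ 2 - var_deficits theta a n.+1.
Proof.
have mu := Eewens_deficits theta_gt0 a n.
have mu2 := Eewens_deficits theta_gt0 (fun i => a i ^+ 2) n.
set m := E _ in mu; rewrite -/(sA n.+1) in mu.
rewrite -[\sum_(i < n.+1) _]/(sB n.+1) in mu2.
have [c cE] : exists c, c =
    (theta + n.+1%:R) * (n.+1%:R * a n.+1 ^+ 2) - (n.+1%:R * a n.+1) ^+ 2 + m ^+ 2.
  by eexists.
have -> : E (fun s : 'S_n.+1 => cvar theta a s) = E (fun s : 'S_n.+1 =>
    (theta + n.+1%:R) * deficits (fun i => a i ^+ 2) s +
    ((-1) * (deficits a s - m) ^+ 2 +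
     ((2 * (n.+1%:R * a n.+1 - m) - (theta + n.+1%:R) * 2 * a n.+1) * deficits a s + c))).
  by apply: eq_Eewens => s; rewrite /cvar cE; ring.
rewrite !EewensD !EewensZ Eewens_cst// mu2 /var_deficits -/m.
by rewrite cE -mu; ring.
Qed.

(** Discrete counterpart of the kernel [Kwexc]: the single sum becomes the integral of t (1 - t) and
    the double sum the iterated integral. Here D is theta + N - 1 for the size N = n + 2. *)
Lemma var_deficitsE n : let D := theta + n.+1%:R in
  var_deficits theta a n.+2 * (D * (D - 1)) =
  \sum_(i < n.+2) a i ^+ 2 * (i%:R * (D - i%:R)) -
  (\sum_(i < n.+2) \sum_(j < n.+2)
     a i * a j * (Num.min i%:R j%:R * (D - Num.max i%:R j%:R))) / D.
Proof.
have rec k : (theta + k.+1%:R) ^+ 2 * var_deficits theta a k.+2 =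
   (theta + k%:R) ^+ 2 * var_deficits theta a k.+1 + E (fun s : 'S_k.+1 => cvar theta a s).
  by rewrite -!var_deficits_mart// Eewens_mart_sqrS.
(* The induction is run on prefix sums, which grow by one term at each step; [sA_sqr] supplies the
   only relation needed between them. *)
have form k : (theta + k.+1%:R) ^+ 2 * var_deficits theta a k.+2 =
    (theta + k.+1%:R) * sB k.+2 - sC k.+2 -
    2 * ((theta + k.+1%:R) * sP k.+2 - sP' k.+2) / (theta + k%:R).
  elim: k => [|k IH].
    have v1 : var_deficits theta a 1 = 0.
      have : var_deficits theta a 1 * theta ^+ 2 = 0.
        have := var_deficits_mart theta_gt0 a 0; rewrite addr0 mulrC => <-.
        rewrite Eewens_mart_sqrS// !Eewens0 mart0 expr0n/= add0r.
        by rewrite /cvar /deficits !big_ord0; ring.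
      by move=> /eqP; rewrite mulf_eq0 sqrf_eq0 (gt_eqF theta_gt0) orbF => /eqP.
    rewrite rec v1 Ecvar v1 /sA /sB /sC /sP /sP' !big_ord_recr !big_ord0/=.
    rewrite /sA !big_ord_recr !big_ord0/= addr0; field.
    by rewrite gt_eqF.
  have t1 : 0 < theta + k%:R by exact: thetaD_gt0.
  have t2 : 0 < theta + k.+1%:R by exact: thetaD_gt0.
  rewrite rec Ecvar.
  have -> : var_deficits theta a k.+2 = ((theta + k.+1%:R) * sB k.+2 - sC k.+2 -
    2 * ((theta + k.+1%:R) * sP k.+2 - sP' k.+2) / (theta + k%:R)) / (theta + k.+1%:R) ^+ 2.
    by rewrite -IH mulrC mulKf// expf_neq0// gt_eqF.
  have cA : sC k.+2 = sA k.+2 ^+ 2 - 2 * sP' k.+2 by rewrite sA_sqr; ring.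
  have [eB eC eP eP'] : [/\ sB k.+3 = sB k.+2 + a k.+2 ^+ 2 * k.+2%:R,
    sC k.+3 = sC k.+2 + (a k.+2 * k.+2%:R) ^+ 2,
    sP k.+3 = sP k.+2 + a k.+2 * sA k.+2 &
    sP' k.+3 = sP' k.+2 + a k.+2 * k.+2%:R * sA k.+2].
    by split; rewrite /sB /sC /sP /sP' [LHS]big_ord_recr.
  rewrite eB eC eP eP' cA.
  set b := sB _; set p := sP _; set p' := sP' _; set A := sA _.
  have e2 : k.+2%:R = k%:R + 2 :> R by rewrite -addn2 natrD.
  have e1 : k.+1%:R = k%:R + 1 :> R by rewrite natr1.
  rewrite e2 e1 in t2 *; field.
  by rewrite !gt_eqF.
move=> D; have D0 : 0 < D := thetaD_gt0 theta_gt0 n.+1.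
have D1 : 0 < theta + n%:R := thetaD_gt0 theta_gt0 n.
have DE : D - 1 = theta + n%:R by rewrite /D -natr1 addrA addrK.
rewrite -/(dbl D n.+2) dblE DE.
have -> : \sum_(i < n.+2) a i ^+ 2 * (i%:R * (D - i%:R)) = D * sB n.+2 - sC n.+2.
  rewrite /sB /sC mulr_sumr -sumrB; apply: eq_bigr => i _; ring.
have -> : var_deficits theta a n.+2 = (D * sB n.+2 - sC n.+2 -
    2 * (D * sP n.+2 - sP' n.+2) / (theta + n%:R)) / D ^+ 2.
  by rewrite -form mulrC mulKf// expf_neq0// gt_eqF.
have DE' : theta + n%:R = D - 1 by rewrite DE.
rewrite DE' in D1 *; field.
by rewrite !gt_eqF.
Qed.

End exact_variance.

(** * Riemann sums with interpolation weights *)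

Section riemann_sums.
Variable R : realType.
Notation mu := (@lebesgue_measure R).

(* The length of [[i, i + 1]] intersected with [[0, N * x]]: this is the weight
   of the point [i] in the linear interpolation [N * Fwexc s x]. *)
Definition ramp_weight (N : nat) (x : R) (i : nat) : R :=
  Num.max 0 (Num.min 1 (N%:R * x - i%:R)).

Lemma ramp_weight_ge0 N x i : 0 <= ramp_weight N x i.
Proof. by rewrite /ramp_weight le_max lexx. Qed.

Lemma ramp_weight_le1 N x i : ramp_weight N x i <= 1.
Proof. by rewrite /ramp_weight ge_max ler01 ge_min lexx. Qed.

Definition riemann_sum (N : nat) (g : R -> R) (x : R) : R :=
  N%:R^-1 * \sum_(i < N) ramp_weight N x i * g (i%:R / N%:R).

(** [Phi] acts as a primitive of [g]: each of the N cells contributes an error of at most L /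
    N^2. *)
Lemma riemann_sum_telescope (g Phi : R -> R) (L : R) N x : (0 < N)%N -> 0 <= L ->
  0 <= x <= 1 -> Phi 0 = 0 ->
  (forall u v, 0 <= u -> u <= v -> v <= 1 ->
    `|Phi v - Phi u - (v - u) * g u| <= L * (v - u) ^+ 2) ->
  `|riemann_sum N g x - Phi x| <= L / N%:R.
Proof.
move=> N0 L0 /andP[x0 x1] Phi0 H.
have n0 : 0 < N%:R :> R by rewrite ltr0n.
(* Stopping the grid at x makes the steps exactly [ramp_weight / N], including the incomplete last
   cell. *)
pose y (i : nat) : R := Num.min x (i%:R / N%:R).
have y0 : y 0 = 0 by rewrite /y mul0r; exact/min_idPr.
have yN : y N = x by rewrite /y divff ?gt_eqF//; exact/min_idPl.
have tel : Phi x = \sum_(i < N) (Phi (y i.+1) - Phi (y i)).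
  rewrite -(big_mkord predT (fun i => Phi (y i.+1) - Phi (y i))) telescope_sumr//.
  by rewrite yN y0 Phi0 subr0.
rewrite tel /riemann_sum mulr_sumr -sumrB.
apply: (le_trans (ler_norm_sum _ _ _)).
have -> : L / N%:R = \sum_(i < N) L / N%:R ^+ 2.
  by rewrite sumr_const card_ord -mulr_natl; field; rewrite gt_eqF.
apply: ler_sum => i _.
have yi0 : 0 <= y i by rewrite /y le_min x0 divr_ge0.
have iS : i.+1%:R / N%:R = i%:R / N%:R + N%:R^-1 :> R.
  by rewrite -natr1 mulrDl mul1r.
have yi1 : y i.+1 <= 1 by rewrite /y ge_min x1.
have [xi|ix] := leP x (i%:R / N%:R).
  have w0 : ramp_weight N x i = 0.
    apply/max_idPl; rewrite ge_min subr_le0.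
    by rewrite mulrC -ler_pdivlMr// xi orbT.
  have -> : y i = x by exact/min_idPl.
  have -> : y i.+1 = x.
    by apply/min_idPl; rewrite iS (le_trans xi)// lerDl invr_ge0 ltW.
  by rewrite w0 mul0r mulr0 subrr subr0 normr0 divr_ge0// exprn_ge0// ltW.
have yi : y i = i%:R / N%:R by apply/min_idPr; exact: ltW.
have wE : y i.+1 - y i = N%:R^-1 * ramp_weight N x i.
  have h : 0 <= N%:R * x - i%:R by rewrite subr_ge0 mulrC -ler_pdivrMr// ltW.
  rewrite yi /y iS /ramp_weight; have [a|a] := leP x (i%:R / N%:R + N%:R^-1).
    rewrite (_ : Num.min 1 _ = N%:R * x - i%:R); last first.
      apply/min_idPr; rewrite lerBlDr -(ler_pM2l n0) in a *.
      move: a; rewrite mulrDr mulrCA divff ?gt_eqF// mulr1; lra.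
    by rewrite (max_idPr h); field; rewrite gt_eqF.
  rewrite (_ : Num.min 1 _ = 1); last first.
    apply/min_idPl; rewrite lerBrDr; move: a; rewrite -(ltr_pM2l n0).
    by rewrite mulrDr mulrCA divff ?gt_eqF// mulr1; lra.
  by rewrite (max_idPr ler01); ring.
have yle : y i <= y i.+1.
  by rewrite -subr_ge0 wE mulr_ge0 ?invr_ge0 ?ramp_weight_ge0// ltW.
have H' := H _ _ yi0 yle yi1; rewrite wE distrC -mulrA in H'.
rewrite -yi; apply: (le_trans H').
apply: ler_wpM2l => //; rewrite exprMn -exprVn; apply: ler_piMr.
  by rewrite exprn_ge0// invr_ge0 ltW.
by rewrite exprn_ile1// ?ramp_weight_ge0// ramp_weight_le1.
Qed.

Lemma ler_riemann_sum N (g g' : R -> R) x e : (0 < N)%N -> 0 <= e ->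
  (forall t, 0 <= t <= 1 -> `|g t - g' t| <= e) ->
  `|riemann_sum N g x - riemann_sum N g' x| <= e.
Proof.
move=> N0 e0 H; have n0 : 0 < N%:R :> R by rewrite ltr0n.
rewrite /riemann_sum -mulrBr -sumrB normrM ger0_norm; last by rewrite invr_ge0 ltW.
rewrite ler_pdivrMl//; apply: (le_trans (ler_norm_sum _ _ _)).
have -> : N%:R * e = \sum_(i < N) e by rewrite sumr_const card_ord mulr_natl.
apply: ler_sum => i _.
rewrite -mulrBr normrM ger0_norm ?ramp_weight_ge0//.
rewrite -[leRHS]mul1r ler_pM ?ramp_weight_ge0 ?ramp_weight_le1// H//.
by rewrite divr_ge0//= ler_pdivrMr// mul1r ler_nat ltnW.
Qed.

Section lipschitz.
Variables (g : R -> R) (L : R).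
Hypothesis L0 : 0 <= L.
Hypothesis gL : forall u v, 0 <= u <= 1 -> 0 <= v <= 1 -> `|g u - g v| <= L * `|u - v|.

Lemma integrable_lipschitz x : 0 <= x <= 1 ->
  mu.-integrable `[0, x] (EFin \o g).
Proof.
move=> /andP[x0 x1].
apply: continuous_compact_integrable; first exact: segment_compact.
apply/subspace_continuousP => u /=; rewrite in_itv/= => /andP[u0 ux].
apply/cvgrPdist_le => e e0; near=> v.
have : v \in `[0, x] by near: v; exact: withinT.
rewrite in_itv/= => /andP[v0 vx].
apply: (le_trans (gL _ _)); first by rewrite u0 (le_trans ux).
  by rewrite v0 (le_trans vx).
apply: (@le_trans _ _ (L * (e / (L + 1)))).
  rewrite ler_wpM2l//; near: v; apply: cvg_within.
  have [] := @cvgrPdist_le _ _ _ (nbhs u) _ id u.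
  by move=> h _; apply: h; [exact: cvg_id|rewrite divr_gt0// ltr_wpDl].
rewrite mulrCA; apply: ler_piMr; first exact: ltW.
by rewrite ler_pdivrMr ?ltr_wpDl// mul1r lerDl.
Unshelve. all: by end_near. Qed.

Lemma riemann_sum_Rintegral N x : (0 < N)%N -> 0 <= x <= 1 ->
  `|riemann_sum N g x - \int[mu]_(t in `[0, x]) g t| <= L / N%:R.
Proof.
move=> N0 x01; apply: (@riemann_sum_telescope g (fun x => \int[mu]_(t in `[0, x]) g t)) => //.
  by rewrite set_itv1 Rintegral_set1.
move=> u v u0 uv v1.
have v01 : 0 <= v <= 1 by rewrite (le_trans u0 uv).
have iv := integrable_lipschitz v01.
have iuv : mu.-integrable `]u, v] (EFin \o g).
  apply: integrableS iv => //; apply: subset_itvr; by rewrite bnd_simp.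
rewrite (Rintegral_itvB iv) ?bnd_simp//.
have muuv : fine (mu `]u, v]) = v - u.
  rewrite lebesgue_measure_itv/= lte_fin; case: ltP => // vu.
  by apply/eqP; rewrite /= eq_sym subr_eq0; apply/eqP/le_anti; rewrite uv vu.
have ic c : mu.-integrable `]u, v] (EFin \o (fun=> c)).
  apply: (@integrableS _ _ _ mu `[u, v]) => //.
    by apply: subset_itvr; rewrite bnd_simp.
  apply: continuous_compact_integrable; first exact: segment_compact.
  by apply: continuous_subspaceT => ?; exact: cvg_cst.
have -> : (v - u) * g u = \int[mu]_(t in `]u, v]) g u.
  by rewrite Rintegral_cst// muuv mulrC.
rewrite -(RintegralB _ iuv (ic _))//.
have igc : mu.-integrable `]u, v] (EFin \o (fun t => g t - g u)).
  under [EFin \o _]funext do rewrite /= EFinB; apply: integrableB => //; exact: ic.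
apply: (le_trans (le_normr_Rintegral _ igc)) => //.
apply: (@le_trans _ _ (\int[mu]_(t in `]u, v]) (L * (v - u)))).
  apply: le_Rintegral => //; first exact: (integrable_abse igc).
  move=> t /=; rewrite in_itv/= => /andP[ut tv].
  apply: (le_trans (gL _ _)).
  - by rewrite (le_trans u0 (ltW ut)) (le_trans tv).
  - by rewrite u0 (le_trans uv).
  - by rewrite ler_wpM2l// gtr0_norm ?subr_gt0// lerD2r.
by rewrite Rintegral_cst// muuv -mulrA expr2.
Qed.

End lipschitz.

End riemann_sums.

Section kernel_integrals.
Variable R : realType.
Notation mu := (@lebesgue_measure R).

Lemma ler_Rintegral_dist (f g : R -> R) y e : 0 <= y <= 1 -> 0 <= e ->
  mu.-integrable `[0, y] (EFin \o f) -> mu.-integrable `[0, y] (EFin \o g) ->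
  (forall u, 0 <= u <= 1 -> `|f u - g u| <= e) ->
  `|\int[mu]_(u in `[0, y]) f u - \int[mu]_(u in `[0, y]) g u| <= e.
Proof.
move=> /andP[y0 y1] e0 fi gi fg; rewrite -(RintegralB _ fi gi)//.
have ifg : mu.-integrable `[0, y] (EFin \o (fun t => f t - g t)).
  by under [EFin \o _]funext do rewrite /= EFinB; apply: integrableB.
have ie : mu.-integrable `[0, y] (EFin \o (fun=> e)).
  apply: continuous_compact_integrable; first exact: segment_compact.
  by apply: continuous_subspaceT => ?; exact: cvg_cst.
apply: (le_trans (le_normr_Rintegral _ ifg)) => //.
apply: (@le_trans _ _ (\int[mu]_(t in `[0, y]) e)).
  apply: le_Rintegral => //; first exact: (integrable_abse ifg).
  by move=> t /=; rewrite in_itv/= => /andP[t0 ty]; rewrite fg// t0 (le_trans ty).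
have muy : fine (mu `[0, y]) = y.
  rewrite lebesgue_measure_itv/= lte_fin; case: ltP => h /=; first by rewrite subr0.
  by apply/le_anti; rewrite y0 h.
by rewrite Rintegral_cst// muy ler_piMr.
Qed.

(** Covariance function of the Brownian bridge. *)
Definition bridge (t u : R) : R := Num.min t u * (1 - Num.max t u).

Lemma bridgeC t u : bridge t u = bridge u t.
Proof. by rewrite /bridge minC maxC. Qed.

Lemma bridge_lipschitz t u v : 0 <= t <= 1 -> 0 <= u <= 1 -> 0 <= v <= 1 ->
  `|bridge t u - bridge t v| <= 1 * `|u - v|.
Proof.
move=> /andP[t0 t1]; wlog uv : u v / v <= u.
  move=> W u01 v01; have [uv|/ltW uv] := leP v u; first exact: W.
  by rewrite distrC (distrC u) W.
move=> /andP[u0 u1] /andP[v0 v1]; rewrite mul1r (ger0_norm (_ : 0 <= u - v)) ?subr_ge0//.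
rewrite /bridge ler_norml.
have [tu|ut] := leP t u; have [tv|vt] := leP t v; apply/andP; split; nra.
Qed.

Definition bridge_integral (y t : R) : R := \int[mu]_(u in `[0, y]) bridge t u.

Lemma bridge_integral_lipschitz y t t' : 0 <= y <= 1 -> 0 <= t <= 1 -> 0 <= t' <= 1 ->
  `|bridge_integral y t - bridge_integral y t'| <= 1 * `|t - t'|.
Proof.
move=> y01 t01 t'01; apply: ler_Rintegral_dist => //.
- apply: (@integrable_lipschitz _ _ 1) => // u v; exact: bridge_lipschitz.
- apply: (@integrable_lipschitz _ _ 1) => // u v; exact: bridge_lipschitz.
- by move=> u u01; rewrite (bridgeC t) (bridgeC t') bridge_lipschitz.
Qed.

Lemma riemann_sum_bridge N x y : (0 < N)%N -> 0 <= x <= 1 -> 0 <= y <= 1 ->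
  `|riemann_sum N (fun t => riemann_sum N (bridge t) y) x -
    \int[mu]_(t in `[0, x]) \int[mu]_(u in `[0, y]) bridge t u| <= 2 / N%:R.
Proof.
move=> N0 x01 y01.
have h1 : `|riemann_sum N (fun t => riemann_sum N (bridge t) y) x -
    riemann_sum N (bridge_integral y) x| <= 1 / N%:R.
  apply: ler_riemann_sum => // t t01; apply: riemann_sum_Rintegral => // u v.
  exact: bridge_lipschitz.
have h2 : `|riemann_sum N (bridge_integral y) x -
    \int[mu]_(t in `[0, x]) \int[mu]_(u in `[0, y]) bridge t u| <= 1 / N%:R.
  apply: riemann_sum_Rintegral => // u v; exact: bridge_integral_lipschitz.
rewrite -(subrK (riemann_sum N (bridge_integral y) x)
  (riemann_sum N (fun t => riemann_sum N (bridge t) y) x)) -addrA.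
apply: (le_trans (ler_normD _ _)); apply: (le_trans (lerD h1 h2)).
by rewrite -mulrDl.
Qed.

Lemma ramp_weight_mono N (x y : R) i : x <= y -> ramp_weight N x i <= ramp_weight N y i.
Proof.
move=> xy; rewrite /ramp_weight ge_max le_max lexx/= le_max; apply/orP; right.
rewrite le_min ge_min lexx/= ge_min; apply/orP; right.
by rewrite lerD2r ler_wpM2l.
Qed.

(** Only the cell containing N x can have a weight other than 0 and 1. *)
Lemma sum_ramp_weight_onem N (x : R) : 0 <= x ->
  \sum_(i < N) ramp_weight N x i * (1 - ramp_weight N x i) <= 1.
Proof.
move=> x0; pose k := Num.truncn (N%:R * x).
have /andP[k1 k2] : k%:R <= N%:R * x < k.+1%:R by apply: truncn_itv; rewrite mulr_ge0.
apply: (@le_trans _ _ (\sum_(i < N) (nat_of_ord i == k)%:R)).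
  apply: ler_sum => i _; have w0 := ramp_weight_ge0 N x i; have w1 := ramp_weight_le1 N x i.
  have [ik|ik|ik] := ltngtP (i : nat) k.
  - have -> : ramp_weight N x i = 1.
      rewrite /ramp_weight (min_idPl _) ?max_r// lerBrDr (le_trans _ k1)//.
      by rewrite -natr1 addrC in k2 *; rewrite addrC natr1 ler_nat.
    by rewrite subrr mulr0.
  - have -> : ramp_weight N x i = 0.
      rewrite /ramp_weight max_l// ge_min; apply/orP; right.
      by rewrite subr_le0 (le_trans (ltW k2))// ler_nat.
    by rewrite mul0r.
  - by rewrite mulr_ile1// ?subr_ge0// gerBl.
have [kN|kN] := ltnP k N.
  rewrite (bigD1 (Ordinal kN))//= eqxx big1 ?addr0// => i /eqP ik.
  by apply/eqP; rewrite pnatr_eq0 eqb0; apply/eqP => h; apply: ik; exact/val_inj.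
rewrite big1 ?ler01// => i _.
by rewrite ltn_eqF// (leq_trans (ltn_ord i)).
Qed.

(** For x <= y the weights satisfy w_x <= w_y, so each term is w_x (1 - w_y) <= w_x (1 - w_x). *)
Lemma sum_ramp_weightM N (x y : R) : 0 <= x -> 0 <= y ->
  \sum_(i < N) `|ramp_weight N x i * ramp_weight N y i -
    ramp_weight N (Num.min x y) i| <= 1.
Proof.
wlog xy : x y / x <= y.
  move=> W x0 y0; case/orP: (le_total x y) => [xy|yx]; first exact: W.
  rewrite minC; under eq_bigr do rewrite mulrC.
  exact: W.
move=> x0 y0; rewrite (min_idPl xy); apply: le_trans (sum_ramp_weight_onem N x0).
apply: ler_sum => i _; have w0 := ramp_weight_ge0 N x i.
have wxy := ramp_weight_mono N i xy; have w1 := ramp_weight_le1 N y i.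
rewrite -{2}[ramp_weight N x i]mulr1 -mulrBr normrM ger0_norm//.
by rewrite ler_wpM2l// ler0_norm ?subr_le0// opprB lerD2l lerN2.
Qed.

Lemma ramp_weight_prod_le1 N (x y z : R) i j : 0 <= z -> z <= 1 ->
  `|ramp_weight N x i * ramp_weight N y j * z| <= 1.
Proof.
move=> z0 z1; rewrite !normrM !ger0_norm ?ramp_weight_ge0//.
have wx := ramp_weight_ge0 N x i; have wy := ramp_weight_ge0 N y j.
apply: mulr_ile1 => //; first exact: mulr_ge0.
by apply: mulr_ile1 => //; exact: ramp_weight_le1.
Qed.

Lemma sum_bilinear n r (t : 'I_r -> R) (w : 'I_r -> nat -> R) (h : nat -> nat -> R) :
  \sum_(i < n) \sum_(j < n) (\sum_l t l * w l i) * (\sum_l t l * w l j) * h i j =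
  \sum_l \sum_m t l * t m * \sum_(i < n) \sum_(j < n) w l i * w m j * h i j.
Proof.
under eq_bigr => i _.
  under eq_bigr => j _ do rewrite -mulrA mulr_suml.
  rewrite exchange_big/=; over.
rewrite exchange_big/=; apply: eq_bigr => l _.
under [in RHS]eq_bigr => m _ do rewrite mulr_sumr.
rewrite [RHS]exchange_big/=; apply: eq_bigr => i _.
under [in RHS]eq_bigr => m _ do rewrite mulr_sumr.
rewrite [RHS]exchange_big/=; apply: eq_bigr => j _.
rewrite mulr_suml mulr_sumr; apply: eq_bigr => m _; ring.
Qed.

Lemma sum_quadratic n r (t : 'I_r -> R) (w : 'I_r -> nat -> R) (h : nat -> R) :
  \sum_(i < n) (\sum_l t l * w l i) ^+ 2 * h i =
  \sum_l \sum_m t l * t m * \sum_(i < n) w l i * w m i * h i.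
Proof.
under eq_bigr => i _ do rewrite expr2 -mulrA mulr_suml.
rewrite exchange_big/=; apply: eq_bigr => l _.
under [in RHS]eq_bigr => m _ do rewrite mulr_sumr.
rewrite [RHS]exchange_big/=; apply: eq_bigr => i _.
rewrite mulr_suml mulr_sumr; apply: eq_bigr => m _; ring.
Qed.

End kernel_integrals.

Section variance_limit.
Variables (R : realType) (theta : R).
Hypothesis theta_gt0 : 0 < theta.
Notation mu := (@lebesgue_measure R).

Lemma cvg_of_rate (u : nat -> R) (l C : R) :
  (forall n, `|u n - l| <= C / n.+2%:R) -> u n @[n --> \oo] --> l.
Proof.
move=> H; apply/cvgrPdist_le => e e0; near=> n.
rewrite distrC (le_trans (H n))// ler_pdivrMr// mulrC -ler_pdivrMr//.
near: n; exists (Num.truncn (C / e)) => // n /= hn.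
apply/ltW/(lt_le_trans (truncnS_gt _)); rewrite ler_nat.
exact: leq_trans hn _.
Unshelve. all: by end_near. Qed.

(** Chosen so that n + 2 <= c (theta + n) for every n. *)
Let c := 1 + 2 / theta.

Let c_gt0 : 0 < c. Proof. by rewrite addr_gt0// divr_gt0. Qed.

Let theta_rate n : (theta + n%:R)^-1 <= c / n.+2%:R.
Proof.
have tn := thetaD_gt0 theta_gt0 n.
rewrite -[leLHS]mul1r ler_pdivrMr// mulrAC ler_pdivlMr// mul1r /c.
rewrite -[n.+2%:R]/((n.+2)%:R) -addn2 natrD mulrDl mul1r mulrDr.
rewrite divfK ?gt_eqF//.
have : 0 <= 2 / theta * n%:R by rewrite mulr_ge0// divr_ge0// ltW.
by have := theta_gt0; lra.
Qed.

Let D n := theta + n.+1%:R.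

Let D_gt0 n : 0 < D n. Proof. exact: thetaD_gt0. Qed.

Let D_rate n : (D n)^-1 <= c / n.+2%:R.
Proof.
apply: le_trans (theta_rate n); rewrite lef_pV2 ?posrE//; last exact: thetaD_gt0.
by rewrite lerD2l ler_nat.
Qed.

Lemma cvg_ratioD : n.+2%:R / D n @[n --> \oo] --> (1 : R).
Proof.
apply: (@cvg_of_rate _ _ (`|1 - theta| * c)) => n.
have -> : n.+2%:R / D n - 1 = (1 - theta) * (D n)^-1.
  have dn := D_gt0 n; rewrite /D in dn *.
  by rewrite -[n.+2%:R]natr1; move: (n.+1%:R) dn => k dn; field; rewrite gt_eqF.
by rewrite normrM -mulrA ler_wpM2l// ger0_norm ?D_rate// invr_ge0 ltW.
Qed.

Lemma cvg_ratioD1 : n.+2%:R / (D n - 1) @[n --> \oo] --> (1 : R).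
Proof.
apply: (@cvg_of_rate _ _ (`|2 - theta| * c)) => n.
have tn := thetaD_gt0 theta_gt0 n.
have DE : D n - 1 = theta + n%:R by rewrite /D -natr1 addrA addrK.
have -> : n.+2%:R / (D n - 1) - 1 = (2 - theta) * (theta + n%:R)^-1.
  by rewrite DE -addn2 natrD; field; rewrite gt_eqF.
by rewrite normrM -mulrA ler_wpM2l// ger0_norm ?theta_rate// invr_ge0 ltW.
Qed.

Lemma mean_wexc_limit x : 0 <= x <= 1 ->
  n.+2%:R^-1 * (\sum_(i < n.+2) ramp_weight n.+2 x i * (1 - i%:R / D n))
    @[n --> \oo] --> (1 - (1 - x) ^+ 2) / 2.
Proof.
move=> x01; apply: (@cvg_of_rate _ _ (1 + `|1 - theta| * c)) => n.
pose g (t : R) := 1 - t.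
pose Phi (t : R) := (1 - (1 - t) ^+ 2) / 2.
have h1 : `|riemann_sum n.+2 g x - Phi x| <= 1 / n.+2%:R.
  apply: riemann_sum_telescope => //; first by rewrite /Phi subr0 expr1n subrr mul0r.
  move=> u v _ uv _.
  rewrite (_ : Phi v - Phi u - (v - u) * g u = - ((v - u) ^+ 2 / 2)).
    by rewrite normrN ger0_norm ?divr_ge0 ?sqr_ge0//; have := sqr_ge0 (v - u); lra.
  by rewrite /Phi /g; field.
have E : n.+2%:R^-1 * (\sum_(i < n.+2) ramp_weight n.+2 x i * (1 - i%:R / D n)) =
    riemann_sum n.+2 (fun t => 1 - n.+2%:R / D n * t) x.
  congr (_ * _); apply: eq_bigr => i _; congr (_ * (1 - _)).
  by have dn := D_gt0 n; field; rewrite !gt_eqF.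
have h2 : `|riemann_sum n.+2 (fun t => 1 - n.+2%:R / D n * t) x - riemann_sum n.+2 g x| <=
    `|1 - theta| * c / n.+2%:R.
  apply: ler_riemann_sum => //.
    by rewrite divr_ge0// mulr_ge0// ltW.
  move=> t /andP[t0 t1].
  have -> : 1 - n.+2%:R / D n * t - g t = - ((1 - theta) * (D n)^-1) * t.
    have dn := D_gt0 n; rewrite /D /g in dn *.
    by rewrite -[n.+2%:R]natr1; move: (n.+1%:R) dn => k dn; field; rewrite gt_eqF.
  rewrite normrM normrN normrM (ger0_norm t0) -[leRHS]mulr1; apply: ler_pM => //.
  rewrite -mulrA ler_wpM2l// ger0_norm ?D_rate// invr_ge0 ltW//.
rewrite E -(subrK (riemann_sum n.+2 g x) (riemann_sum n.+2 _ x)) -addrA addrC.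
apply: (le_trans (ler_normD _ _)); apply: (le_trans (lerD h1 h2)).
by rewrite -mulrDl.
Qed.

Let s1 n (x y : R) := n.+2%:R ^- 3 * \sum_(i < n.+2)
  ramp_weight n.+2 x i * ramp_weight n.+2 y i * (i%:R * (D n - i%:R)).

Let s2 n (x y : R) := n.+2%:R ^- 4 * \sum_(i < n.+2) \sum_(j < n.+2)
  ramp_weight n.+2 x i * ramp_weight n.+2 y j *
  (Num.min i%:R j%:R * (D n - Num.max i%:R j%:R)).

Let s1_cvg x y : 0 <= x <= 1 -> 0 <= y <= 1 ->
  s1 n x y @[n --> \oo] --> \int[mu]_(t in `[0, Num.min x y]) (t * (1 - t)).
Proof.
move=> x01 y01; apply: (@cvg_of_rate _ _ (2 + `|theta - 1|)) => n.
set N := n.+2; have N0 : 0 < N%:R :> R by rewrite ltr0n.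
pose g (t : R) := t * (1 - t).
have m01 : 0 <= Num.min x y <= 1.
  case/andP: x01 => x0 x1; case/andP: y01 => y0 y1.
  by rewrite le_min x0 y0 ge_min x1.
have g01 t : 0 <= t <= 1 -> 0 <= g t <= 1.
  by move=> /andP[t0 t1]; rewrite /g; apply/andP; split; nra.
have i01 (i : 'I_N) : 0 <= (i%:R / N%:R : R) <= 1.
  by rewrite divr_ge0//= ler_pdivrMr// mul1r ler_nat ltnW.
have h1 : `|riemann_sum N g (Num.min x y) -
    \int[mu]_(t in `[0, Num.min x y]) g t| <= 1 / N%:R.
  apply: riemann_sum_Rintegral => // u v /andP[u0 u1] /andP[v0 v1].
  rewrite mul1r (_ : g u - g v = (u - v) * (1 - u - v)); last by rewrite /g; ring.
  by rewrite normrM ler_piMr// ler_norml; apply/andP; split; lra.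
pose A := N%:R^-1 * \sum_(i < N) (ramp_weight N x i * ramp_weight N y i -
  ramp_weight N (Num.min x y) i) * g (i%:R / N%:R).
pose B := N%:R^-1 * \sum_(i < N) ramp_weight N x i * ramp_weight N y i * (i%:R / N%:R).
(* [A] is the defect of the product of weights from the weight of the minimum, and the last term
   comes from D = N + theta - 1 in place of N; both are of order 1 / N. *)
have E : s1 n x y = riemann_sum N g (Num.min x y) + A + (theta - 1) / N%:R * B.
  rewrite /s1 /A /B /riemann_sum -/N !mulrA -[_ / N%:R / N%:R]mulrA.
  rewrite -mulrDr -big_split/= !mulr_sumr -big_split/=.
  apply: eq_bigr => i _; rewrite /D /g.
  have NE : n.+1%:R = N%:R - 1 :> R by rewrite /N -[n.+2%:R]natr1 addrK.
  by rewrite NE; field; rewrite gt_eqF.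
have hA : `|A| <= 1 / N%:R.
  rewrite /A normrM ger0_norm ?invr_ge0 ?(ltW N0)// mulrC ler_pM2r ?invr_gt0//.
  apply: (le_trans (ler_norm_sum _ _ _)).
  have := @sum_ramp_weightM R N x y; case/andP: x01 => x0 _; case/andP: y01 => y0 _.
  move=> /(_ x0 y0); apply: le_trans; apply: ler_sum => i _.
  by rewrite normrM ler_piMr//; case/andP: (g01 _ (i01 i)) => g0 g1; rewrite ger0_norm.
have hB : `|B| <= 1.
  rewrite /B normrM ger0_norm ?invr_ge0 ?(ltW N0)// ler_pdivrMl// mulr1.
  apply: (le_trans (ler_norm_sum _ _ _)).
  rewrite [leRHS](_ : _ = \sum_(i < N) 1); last by rewrite sumr_const card_ord.
  apply: ler_sum => i _; have /andP[a b] := i01 i.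
  exact: ramp_weight_prod_le1.
rewrite E; set I := \int[mu]_(t in _) _.
have hT : `|(theta - 1) / N%:R * B| <= `|theta - 1| / N%:R.
  rewrite (normrM _ B) (normrM (theta - 1)) normfV (ger0_norm (ltW N0)).
  by apply: ler_piMr => //; exact: divr_ge0 (normr_ge0 _) (ltW N0).
rewrite (_ : _ - I = (riemann_sum N g (Num.min x y) - I) + A +
  (theta - 1) / N%:R * B); last by ring.
apply: (le_trans (ler_normD _ _)).
have := lerD (le_trans (ler_normD _ _) (lerD h1 hA)) hT.
by move=> /le_trans; apply; rewrite -!mulrDl.
Qed.

Let s2_cvg x y : 0 <= x <= 1 -> 0 <= y <= 1 ->
  s2 n x y @[n --> \oo] -->
  \int[mu]_(t in `[0, x]) \int[mu]_(u in `[0, y]) bridge t u.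
Proof.
move=> x01 y01; apply: (@cvg_of_rate _ _ (2 + `|theta - 1|)) => n.
set N := n.+2; have N0 : 0 < N%:R :> R by rewrite ltr0n.
have i01 (i : 'I_N) : 0 <= (i%:R / N%:R : R) <= 1.
  by rewrite divr_ge0//= ler_pdivrMr// mul1r ler_nat ltnW.
have h1 := @riemann_sum_bridge R N x y (ltn0Sn _) x01 y01.
pose B := N%:R ^- 2 * \sum_(i < N) \sum_(j < N) ramp_weight N x i *
  ramp_weight N y j * (Num.min i%:R j%:R / N%:R).
have E : s2 n x y = riemann_sum N (fun t => riemann_sum N (bridge t) y) x +
    (theta - 1) / N%:R * B.
  rewrite /s2 /B /riemann_sum -/N.
  rewrite [X in _ = X + _]mulr_sumr !mulrA !mulr_sumr -big_split/=.
  apply: eq_bigr => i _; rewrite !mulr_sumr -big_split/=; apply: eq_bigr => j _.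
  have NE : n.+1%:R = N%:R - 1 :> R by rewrite /N -[n.+2%:R]natr1 addrK.
  have mE : Num.min (i%:R / N%:R) (j%:R / N%:R) = Num.min i%:R j%:R / N%:R :> R.
    by rewrite minr_pMl// invr_ge0 ltW.
  have ME : Num.max (i%:R / N%:R) (j%:R / N%:R) = Num.max i%:R j%:R / N%:R :> R.
    by rewrite maxr_pMl// invr_ge0 ltW.
  rewrite /bridge mE ME /D NE.
  by field; rewrite gt_eqF.
have hB : `|B| <= 1.
  rewrite /B normrM ger0_norm ?invr_ge0 ?exprn_ge0 ?(ltW N0)//.
  rewrite ler_pdivrMl ?exprn_gt0// mulr1 expr2.
  apply: (le_trans (ler_norm_sum _ _ _)).
  have -> : N%:R * N%:R = \sum_(i < N) N%:R :> R.
    by rewrite sumr_const card_ord mulr_natl.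
  apply: ler_sum => i _; apply: (le_trans (ler_norm_sum _ _ _)).
  rewrite [leRHS](_ : _ = \sum_(i < N) 1); last by rewrite sumr_const card_ord.
  apply: ler_sum => j _; have /andP[a b] := i01 i.
  have m0 : 0 <= Num.min i%:R j%:R :> R by rewrite le_min !ler0n.
  have m1 : Num.min i%:R j%:R / N%:R <= 1 :> R.
    by apply: le_trans b; rewrite ler_pM2r ?invr_gt0// ge_min lexx.
  have m2 : 0 <= Num.min i%:R j%:R / N%:R :> R by rewrite divr_ge0.
  exact: ramp_weight_prod_le1.
have hT : `|(theta - 1) / N%:R * B| <= `|theta - 1| / N%:R.
  rewrite (normrM _ B) (normrM (theta - 1)) normfV (ger0_norm (ltW N0)).
  by apply: ler_piMr => //; exact: divr_ge0 (normr_ge0 _) (ltW N0).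
rewrite E addrAC; apply: (le_trans (ler_normD _ _)).
by apply: (le_trans (lerD h1 hT)); rewrite -mulrDl.
Qed.

Lemma cvg_sum_ord r (u : 'I_r -> nat -> R) (l : 'I_r -> R) :
  (forall i, u i n @[n --> \oo] --> l i) ->
  \sum_i u i n @[n --> \oo] --> \sum_i l i.
Proof.
by move=> ul; apply: cvg_big => [|i _]; [exact: add_continuous|exact: ul].
Qed.

Theorem cvg_var_deficits r (t x : 'I_r -> R) : (forall i, 0 <= x i <= 1) ->
  var_deficits theta (fun i => \sum_l t l * ramp_weight n.+2 (x l) i) n.+2 / n.+2%:R
    @[n --> \oo] --> qform (fun i j => Kwexc (x i) (x j)) t.
Proof.
move=> x01.
pose S1 n := \sum_l \sum_m t l * t m * s1 n (x l) (x m).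
pose S2 n := \sum_l \sum_m t l * t m * s2 n (x l) (x m).
have E n : var_deficits theta (fun i => \sum_l t l * ramp_weight n.+2 (x l) i) n.+2 /
    n.+2%:R = n.+2%:R / D n * (n.+2%:R / (D n - 1)) * (S1 n - n.+2%:R / D n * S2 n).
  have := var_deficitsE theta_gt0 (fun i => \sum_l t l * ramp_weight n.+2 (x l) i) n.
  rewrite /= -/(D n) (@sum_quadratic _ _ _ t (fun l => ramp_weight n.+2 (x l))
    (fun i => i%:R * (D n - i%:R))) (@sum_bilinear _ _ _ t (fun l => ramp_weight n.+2 (x l))
    (fun i j => Num.min i%:R j%:R * (D n - Num.max i%:R j%:R))).
  have -> : \sum_l \sum_m t l * t m * (\sum_(i < n.+2) ramp_weight n.+2 (x l) i *
      ramp_weight n.+2 (x m) i * (i%:R * (D n - i%:R))) = n.+2%:R ^+ 3 * S1 n.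
    rewrite mulr_sumr; apply: eq_bigr => l _; rewrite mulr_sumr; apply: eq_bigr => m _.
    by rewrite /s1 [RHS]mulrCA mulVKf// expf_neq0 ?pnatr_eq0.
  have -> : \sum_l \sum_m t l * t m * (\sum_(i < n.+2) \sum_(j < n.+2)
      ramp_weight n.+2 (x l) i * ramp_weight n.+2 (x m) j *
      (Num.min i%:R j%:R * (D n - Num.max i%:R j%:R))) = n.+2%:R ^+ 4 * S2 n.
    rewrite mulr_sumr; apply: eq_bigr => l _; rewrite mulr_sumr; apply: eq_bigr => m _.
    by rewrite /s2 [RHS]mulrCA mulVKf// expf_neq0 ?pnatr_eq0.
  have D0 := D_gt0 n.
  have D1 : 0 < D n - 1 by rewrite /D -natr1 addrA addrK; exact: thetaD_gt0.
  set V := var_deficits _ _ _; have N0 : n.+2%:R != 0 :> R by rewrite pnatr_eq0.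
  move: (n.+2%:R) N0 => N N0 H.
  rewrite (_ : V = (N ^+ 3 * S1 n - N ^+ 4 * S2 n / D n) / (D n * (D n - 1))).
    by field; rewrite N0 !gt_eqF.
  by rewrite -H mulfK// mulf_neq0// gt_eqF.
under eq_fun do rewrite E.
have -> : qform (fun i j => Kwexc (x i) (x j)) t =
    1 * 1 * (\sum_l \sum_m t l * t m * \int[mu]_(u in `[0, Num.min (x l) (x m)]) (u * (1 - u)) -
     1 * \sum_l \sum_m t l * t m *
       \int[mu]_(u in `[0, x l]) \int[mu]_(v in `[0, x m]) bridge u v).
  rewrite !mul1r -sumrB /qform; apply: eq_bigr => l _; rewrite -sumrB.
  by apply: eq_bigr => m _; rewrite -mulrBr.
apply: cvgM; first by apply: cvgM; [exact: cvg_ratioD|exact: cvg_ratioD1].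
apply: cvgB.
  apply: cvg_sum_ord => l; apply: cvg_sum_ord => m.
  by apply: cvgM; [exact: cvg_cst|exact: s1_cvg].
apply: cvgM; first exact: cvg_ratioD.
apply: cvg_sum_ord => l; apply: cvg_sum_ord => m.
by apply: cvgM; [exact: cvg_cst|exact: s2_cvg].
Qed.

(** Positivity is inherited from the variances whose limit this form is. *)
Lemma qform_Kwexc_ge0 r (t x : 'I_r -> R) : (forall i, 0 <= x i <= 1) ->
  0 <= qform (fun i j => Kwexc (x i) (x j)) t.
Proof.
move=> x01; apply: (cvgr_to_ge (@cvg_var_deficits r t x x01)).
apply: nearW => n; apply: divr_ge0 => //.
rewrite /var_deficits -[leLHS](@Eewens_cst _ theta theta_gt0 n.+2 0).
by apply: le_Eewens => // s; exact: sqr_ge0.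
Qed.

End variance_limit.

(** The iterated integrals can be exchanged because they are limits of finite double sums, which
    can. *)
Lemma KwexcC (R : realType) (x y : R) :
  0 <= x <= 1 -> 0 <= y <= 1 -> Kwexc x y = Kwexc y x.
Proof.
move=> x01 y01; rewrite /Kwexc minC; congr (_ - _).
pose S (u v : R) n := riemann_sum n.+2 (fun t => riemann_sum n.+2 (bridge t) v) u.
have S_cvg u v : 0 <= u <= 1 -> 0 <= v <= 1 -> S u v n @[n --> \oo] -->
    \int[lebesgue_measure]_(t in `[0, u]) \int[lebesgue_measure]_(z in `[0, v]) bridge t z.
  by move=> u01 v01; apply: (@cvg_of_rate _ _ _ 2) => n; exact: riemann_sum_bridge.
have SC : S x y = S y x.
  apply/funext => n; rewrite /S /riemann_sum; congr (_ * _).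
  under eq_bigr do rewrite !mulr_sumr; rewrite exchange_big/=.
  under [RHS]eq_bigr do rewrite !mulr_sumr.
  by apply: eq_bigr => i _; apply: eq_bigr => j _; rewrite bridgeC; ring.
by have := S_cvg x y x01 y01; rewrite SC => /cvg_unique; apply => //; exact: S_cvg.
Qed.

(** * The weak excedance process *)

Section linear_statistic.
Variables (R : realType) (N : nat).

Lemma ramp_weightE (x : R) (i : nat) : 0 <= x -> let k := Num.truncn (N%:R * x) in
  let t := N%:R * x - k%:R in
  ramp_weight N x i = (1 - t) * (i < k)%N%:R + t * (i < k.+1)%N%:R.
Proof.
move=> x0 k t; rewrite /ramp_weight.
have /andP[k1 k2] : k%:R <= N%:R * x < k.+1%:R by apply: truncn_itv; rewrite mulr_ge0.
have t0 : 0 <= t by rewrite subr_ge0.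
have t1 : t <= 1 by rewrite lerBlDl natr1 ltW.
have -> : N%:R * x = k%:R + t by rewrite addrC subrK.
rewrite ltnS; have [ik|ik|ik] := ltngtP i k.
- have ik' : i.+1%:R <= k%:R :> R by rewrite ler_nat.
  rewrite -natr1 in ik'.
  rewrite (min_idPl _) ?max_r//; last by lra.
  by rewrite !mulr1 subrK.
- have ik' : k.+1%:R <= i%:R :> R by rewrite ler_nat.
  rewrite -natr1 in ik'.
  rewrite !mulr0 addr0 /=; apply/max_idPl; rewrite ge_min; apply/orP; right; lra.
- by rewrite ik addrAC subrr add0r mulr0 mulr1 add0r (min_idPr t1) max_r.
Qed.

Lemma Fwexc_ramp (s : 'S_N) (x : R) : 0 <= x ->
  Fwexc s x = N%:R^-1 * (\sum_(i < N) ramp_weight N x i - deficits (ramp_weight N x) s).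
Proof.
move=> x0; rewrite /Fwexc /deficits -sumrB mulrC; congr (_ * _).
rewrite /wexc_count !natr_sum [\sum_(i < N | (i < _.+1)%N) _]big_mkcond.
rewrite [\sum_(i < N | (i < _)%N) _]big_mkcond /= !mulr_sumr -big_split/=.
apply: eq_bigr => i _; rewrite (ramp_weightE _ x0)/= /B_ex (ltnNge (s i)).
set k := Num.truncn _; move: (N%:R * x - k%:R) => t.
move: (i < k)%N (i < k.+1)%N (i <= s i)%N => [] [] [];
  rewrite /= ?mulr0 ?mulr1 ?addr0 ?subr0 ?subrr //.
Qed.

End linear_statistic.

(** * From random permutations to finite sums *)

Section transfer.
Context (R : realType) (theta : R) (N : nat) d (T : measurableType d).
Context (P : probability T R) (sigma : T -> 'S_N).
Hypothesis Hsigma : ewens_permutation theta P sigma.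

Let sumE (g : 'S_N -> R) w :
  g (sigma w) = \sum_s g s * \1_(sigma @^-1` [set s]) w.
Proof.
rewrite (bigD1 (sigma w))//= indicE mem_set// mulr1 big1 ?addr0// => s /eqP ss.
by rewrite indicE memNset ?mulr0//= => h; apply: ss.
Qed.

Lemma measurable_ewens (g : 'S_N -> R) : measurable_fun setT (fun w => g (sigma w)).
Proof.
under eq_fun do rewrite sumE.
apply: measurable_sum => s; apply: measurable_funM => //.
apply: measurable_indic; exact: (Hsigma s).1.
Qed.

Lemma integral_ewens (g : 'S_N -> R) :
  (\int[P]_w (g (sigma w))%:E)%E = (Eewens theta g)%:E.
Proof.
under eq_integral do rewrite sumE -sumEFin.
have im s : P.-integrable setT (EFin \o \1_(sigma @^-1` [set s])).
  by apply: integrable_indic; exact: (Hsigma s).1.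
rewrite integral_sum//; last first.
  by move=> s; under eq_fun do rewrite EFinM; exact: (integrableZl measurableT _ (im s)).
rewrite /Eewens -sumEFin; apply: eq_bigr => s _.
under eq_integral do rewrite EFinM.
rewrite (integralZl measurableT (im s)) integral_indic//; last exact: (Hsigma s).1.
rewrite setIT; have [_ Es] := Hsigma s; rewrite [X in (_ * X)%E](_ : _ = (ewens theta s)%:E)//.
by rewrite muleC EFinM.
Qed.

Lemma Rintegral_ewens (g : 'S_N -> R) : \int[P]_w g (sigma w) = Eewens theta g.
Proof. by rewrite /Rintegral integral_ewens. Qed.

Lemma expectation_ewens (g : 'S_N -> R) : fine 'E_P[fun w => g (sigma w)]%E = Eewens theta g.
Proof. by rewrite unlock integral_ewens. Qed.

Lemma integrable_ewens (g : 'S_N -> R) :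
  P.-integrable setT (EFin \o (fun w => g (sigma w))).
Proof.
apply: (@integrable_bounded_prob _ _ _ _ _ (\sum_s `|g s|)).
  exact: measurable_ewens.
by move=> w; rewrite (bigD1 (sigma w))//= lerDl sumr_ge0.
Qed.

End transfer.

Section summable_moments.
Context (R : realType) d (T : measurableType d) (P : probability T R).

(** The series of the X_n has a finite integral, hence is finite almost everywhere and its terms
    tend to 0. Only the individual integrals enter, so the joint law is arbitrary. *)
Lemma ae_cvg0_summable (X : nat -> T -> R) (C : R) :
  (forall n, measurable_fun setT (X n)) -> (forall n w, 0 <= X n w) ->
  (forall n, \int[P]_w (X n w)%:E <= (C / (n.+1%:R * n.+2%:R))%:E)%E ->
  {ae P, forall w, X n w @[n --> \oo] --> 0}.
Proof.
move=> mX X0 XC.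
have mE n : measurable_fun setT (fun w => (X n w)%:E) by exact/measurable_EFinP.
have X0E n w : setT w -> (0 <= (X n w)%:E)%E by rewrite lee_fin.
pose g w := (\sum_(0 <= n <oo) (X n w)%:E)%E.
have C0 : 0 <= C.
  have : (0 <= (C / (1%:R * 2%:R))%:E)%E.
    by apply: le_trans (XC 0); apply: integral_ge0 => w _; rewrite lee_fin.
  by rewrite lee_fin pmulr_lge0// invr_gt0 mulr_gt0.
have gC : (\int[P]_w g w <= C%:E)%E.
  rewrite integral_nneseries//.
  apply: lime_le; first by apply: is_cvg_nneseries => n _ _; apply: integral_ge0 => w; exact: X0E.
  apply: nearW => n.
  apply: (@le_trans _ _ (\sum_(0 <= k < n) (C / (k.+1%:R * k.+2%:R))%:E)%E).
    by apply: lee_sum => k _; exact: XC.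
  rewrite sumEFin lee_fin.
  (* The bound is assumed in this form, rather than as C / n^2, in order to telescope. *)
  have -> : \sum_(0 <= k < n) C / (k.+1%:R * k.+2%:R) = C - C / n.+1%:R.
    elim: n => [|n IH]; first by rewrite big_geq// divr1 subrr.
    rewrite big_nat_recr//= IH -[n.+2%:R]natr1.
    have k0 : 0 < n.+1%:R :> R by [].
    move: (n.+1%:R : R) k0 => k k0; have k1 : 0 < k + 1 by rewrite addr_gt0.
    by field; rewrite !gt_eqF.
  by rewrite gerBl divr_ge0.
have ig : P.-integrable setT g.
  apply/integrableP; split.
    apply: (@ge0_emeasurable_sum _ _ _ setT (fun n w => (X n w)%:E) xpredT) => //.
    by move=> k w Tw _; exact: X0E.
  apply: le_lt_trans (ltry C); apply: le_trans gC.
  rewrite le_eqVlt; apply/orP; left; apply/eqP; apply: eq_integral => w _.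
  by rewrite gee0_abs//; apply: nneseries_ge0 => n _ _; rewrite lee_fin.
have := integrable_ae measurableT ig; apply: filterS => w /(_ I) gw.
apply: cvg_series_cvg_0; apply: nondecreasing_is_cvgn.
  by apply/nondecreasing_seqP => n; rewrite seriesEnat/= big_nat_recr//= lerDl.
exists (fine (g w)) => _ [n _ <-]; rewrite -lee_fin fineK//.
rewrite seriesEnat/= -sumEFin; apply: nneseries_lim_ge => k _ _.
by rewrite lee_fin.
Qed.

End summable_moments.

Section ewens_limits.
Variables (R : realType) (theta : R).
Hypothesis theta_gt0 : 0 < theta.

Lemma Eewens_Fwexc N (x : R) : 0 <= x -> Eewens theta (fun s : 'S_N => Fwexc s x) =
  N%:R^-1 * (\sum_(i < N) ramp_weight N x i -
    Eewens theta (fun s : 'S_N => deficits (ramp_weight N x) s)).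
Proof.
move=> x0; under eq_Eewens do rewrite Fwexc_ramp//.
by rewrite EewensZ EewensB Eewens_cst.
Qed.

Lemma Fwexc_centered N (s : 'S_N) (x : R) : 0 <= x ->
  Fwexc s x - Eewens theta (fun s : 'S_N => Fwexc s x) =
  - (deficits (ramp_weight N x) s -
     Eewens theta (fun s : 'S_N => deficits (ramp_weight N x) s)) / N%:R.
Proof. by move=> x0; rewrite Eewens_Fwexc// Fwexc_ramp//; ring. Qed.

Lemma norm_ramp_weight_le1 N (x : R) i : `|ramp_weight N x i| <= 1.
Proof. by rewrite ger0_norm ?ramp_weight_ge0 ?ramp_weight_le1. Qed.

Lemma Eewens_Fwexc_pow4_le n (x : R) : 0 <= x ->
  Eewens theta (fun s : 'S_n.+1 =>
    (Fwexc s x - Eewens theta (fun s : 'S_n.+1 => Fwexc s x)) ^+ 4) <=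
  22 * 4 ^+ 4 / (n.+1%:R * n.+2%:R).
Proof.
move=> x0; have E4 (d y : R) : (- d / y) ^+ 4 = y ^- 4 * d ^+ 4.
  by rewrite exprMn exprVn; ring.
under eq_Eewens do rewrite Fwexc_centered// E4.
rewrite EewensZ; have k1 : 1 <= n.+1%:R :> R by rewrite ler1n.
have H := pow4_deficits_le theta_gt0 n.+1 (norm_ramp_weight_le1 n.+1 x).
have k4 : 0 <= n.+1%:R ^- 4 :> R by rewrite invr_ge0 exprn_ge0.
apply: (le_trans (ler_wpM2l k4 H)); rewrite -[n.+2%:R]natr1.
move: (n.+1%:R : R) k1 {H k4} => k k1.
have k0 : 0 < k by lra.
have kS : 0 < k + 1 by lra.
(* The constant doubles from 11 to 22 because k + 1 <= 2 k. *)
rewrite (_ : k ^- 4 * _ = 11 * 4 ^+ 4 / (k * k)); last by field; rewrite gt_eqF.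
rewrite ler_pdivrMr ?mulr_gt0// mulrAC ler_pdivlMr ?mulr_gt0//.
have : k <= k * k by rewrite ler_peMr// ltW.
by lra.
Qed.

Lemma cvg_mean_Fwexc (x : R) : 0 <= x <= 1 ->
  Eewens theta (fun s : 'S_n => Fwexc s x) @[n --> \oo] --> (1 - (1 - x) ^+ 2) / 2.
Proof.
move=> x01; rewrite -(cvg_shiftn 2)/=.
have x0 : 0 <= x by case/andP: x01.
apply: cvg_trans (mean_wexc_limit theta_gt0 x01).
apply: near_eq_cvg; apply: nearW => n.
rewrite addn2 Eewens_Fwexc// Eewens_deficits//; congr (_ * _).
rewrite mulr_suml -sumrB; apply: eq_bigr => i _; by rewrite mulrBr mulr1 mulrA.
Qed.

Lemma qformN r (K : 'I_r -> 'I_r -> R) t : qform K (fun i => - t i) = qform K t.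
Proof. by apply: eq_bigr => i _; apply: eq_bigr => j _; rewrite mulrNN. Qed.

(** The weights change with n but are bounded by one constant [A], so the error of [Eewens_cos_clt]
    tends to 0 and only the variance remains to be followed. *)
Lemma cvg_Eewens_cos r (t x : 'I_r -> R) c : (forall i, 0 <= x i <= 1) ->
  let a n i := \sum_l t l * ramp_weight n.+2 (x l) i in
  Eewens theta (fun s : 'S_n.+2 => cos ((deficits (a n) s -
    Eewens theta (fun s : 'S_n.+2 => deficits (a n) s)) / Num.sqrt n.+2%:R + c))
  @[n --> \oo] --> expR (- (qform (fun i j => Kwexc (x i) (x j)) t / 2)) * cos c.
Proof.
move=> x01 a; set u := fun n => Eewens _ _.
pose v n := expR (- (var_deficits theta (a n) n.+2 / n.+2%:R / 2)) * cos c.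
pose A := \sum_l `|t l| + 1.
have A0 : 0 < A by rewrite ltr_wpDl// sumr_ge0.
have aA n i : `|a n i| <= A.
  apply: (le_trans (ler_norm_sum _ _ _)); apply: ler_wpDr => //.
  apply: ler_sum => l _; rewrite normrM; apply: ler_piMr => //.
  exact: norm_ramp_weight_le1.
have sqrt_ge (M : R) : \forall n \near \oo, M <= Num.sqrt n.+2%:R.
  exists (Num.truncn (M ^+ 2)) => // n /= hn.
  apply: (le_trans (ler_norm M)); rewrite -sqrtr_sqr ler_sqrt// ltW//.
  apply: (lt_le_trans (truncnS_gt _)); rewrite ler_nat.
  exact: leq_trans hn _.
have uv : u n - v n @[n --> \oo] --> 0.
  apply/cvgrPdist_le => e e0; near=> n.
  have q0 : 0 < Num.sqrt n.+2%:R :> R by rewrite sqrtr_gt0.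
  rewrite sub0r normrN; apply: (le_trans (Eewens_cos_clt theta_gt0 A0 (aA n) c _ q0 _ _)) => //.
  - by rewrite sqr_sqrtr.
  - by near: n; exact: sqrt_ge.
  - rewrite ler_pdivrMr// mulrC -ler_pdivrMr//; near: n; exact: sqrt_ge.
have vL : v n @[n --> \oo] --> expR (- (qform (fun i j => Kwexc (x i) (x j)) t / 2)) * cos c.
  apply: cvgM; last exact: cvg_cst.
  apply: continuous_cvg; first exact: continuous_expR.
  by apply: cvgN; apply: cvgM; [exact: cvg_var_deficits|exact: cvg_cst].
have h : u n - v n + v n @[n --> \oo] -->
    0 + expR (- (qform (fun i j => Kwexc (x i) (x j)) t / 2)) * cos c.
  exact: cvgD.
by move: h; under eq_fun do rewrite subrK; rewrite add0r.
Unshelve. all: by end_near. Qed.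

End ewens_limits.

Section strong_law.
Variables (R : realType) (theta : R).
Hypothesis theta_gt0 : 0 < theta.

Theorem wexc_strong_law d (T : measurableType d) (P : probability T R)
    (sigma : forall N : nat, T -> 'S_N) :
  (forall N, (0 < N)%N -> ewens_permutation theta P (sigma N)) ->
  forall x : R, 0 <= x <= 1 ->
  {ae P, forall w, Fwexc (sigma N w) x @[N --> \oo] --> (1 - (1 - x) ^+ 2) / 2}.
Proof.
move=> Hs x x01; have x0 : 0 <= x by case/andP: x01.
pose m N := Eewens theta (fun s : 'S_N => Fwexc s x).
pose h N (s : 'S_N.+1) := (Fwexc s x - m N.+1) ^+ 4.
have := @ae_cvg0_summable _ _ _ P (fun n w => h n (sigma n.+1 w)) (22 * 4 ^+ 4).
case=> [n|n w|n|]; [|exact: exprn_even_ge0| |].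
- exact: (measurable_ewens (Hs n.+1 isT)).
- rewrite (integral_ewens (Hs n.+1 isT)) lee_fin; exact: Eewens_Fwexc_pow4_le.
move=> A [mA A0 sA]; exists A; split => // w Nw; apply: sA => /= hw; apply: Nw => /=.
(* The law of [sigma N] is given for positive N only. *)
rewrite -(cvg_shiftn 1)/=.
have dev : Fwexc (sigma n.+1 w) x - m n.+1 @[n --> \oo] --> 0.
  apply/cvgrPdist_lt => e e0; move/cvgrPdist_lt: hw => /(_ _ (exprn_gt0 4 e0)).
  apply: filterS => n /=; rewrite !sub0r !normrN normrX ltr_pXn2r// nnegrE//.
  exact: ltW.
have mL : m n.+1 @[n --> \oo] --> (1 - (1 - x) ^+ 2) / 2.
  have := cvg_mean_Fwexc theta_gt0 x01; rewrite -(cvg_shiftn 1)/=.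
  by under eq_fun do rewrite addn1.
have H : Fwexc (sigma n.+1 w) x - m n.+1 + m n.+1 @[n --> \oo] --> 0 + (1 - (1 - x) ^+ 2) / 2.
  exact: cvgD.
by move: H; under eq_fun do rewrite subrK -addn1; rewrite add0r.
Qed.

End strong_law.

Section central_limit.
Variables (R : realType) (theta : R).
Hypothesis theta_gt0 : 0 < theta.

Definition zwexc N (x : R) (s : 'S_N) : R := Num.sqrt N%:R *
  (Fwexc s x - Eewens theta (fun s : 'S_N => Fwexc s x)).

Lemma zwexcE N (x : R) (s : 'S_N) : 0 <= x ->
  zwexc x s = - (deficits (ramp_weight N x) s -
     Eewens theta (fun s : 'S_N => deficits (ramp_weight N x) s)) / Num.sqrt N%:R.
Proof.
move=> x0; rewrite /zwexc Fwexc_centered//; case: N s => [|n] s.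
  by rewrite sqrtr0 mul0r invr0 mulr0.
set q := Num.sqrt _; have q0 : q != 0 by rewrite gt_eqF// sqrtr_gt0.
have <- : q ^+ 2 = n.+1%:R by rewrite sqr_sqrtr.
by field.
Qed.

Lemma Zwexc_ewens N d (T : measurableType d) (P : probability T R) (sigma : T -> 'S_N)
  (x : R) : ewens_permutation theta P sigma ->
  Zwexc P sigma x = (fun w => zwexc x (sigma w)).
Proof.
move=> Hs; apply/funext => w; rewrite /Zwexc /zwexc.
by rewrite (expectation_ewens Hs (fun s => Fwexc s x)).
Qed.

Lemma Eewens_zwexc_sqr_le N (x : R) : 0 <= x ->
  Eewens theta (fun s : 'S_N => zwexc x s ^+ 2) <= 16.
Proof.
move=> x0; have E2 (y z : R) : (- y / z) ^+ 2 = z ^- 2 * y ^+ 2.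
  by rewrite exprMn exprVn; ring.
under eq_Eewens do rewrite zwexcE// E2.
rewrite EewensZ sqr_sqrtr//.
have := var_deficits_le theta_gt0 N (norm_ramp_weight_le1 N x); rewrite /var_deficits.
move: (Eewens _ _) => V HV; have N0 : 0 <= N%:R^-1 :> R by rewrite invr_ge0.
apply: (le_trans (ler_wpM2l N0 HV)); rewrite mulrA.
have [->|n0] := eqVneq N 0; first by rewrite invr0 !mul0r.
by rewrite mulVf ?pnatr_eq0//; lra.
Qed.

(** Weak excedances are the complement of deficits, whence the weights with [- t]; the sign
    disappears from the limit by [qformN]. *)
Lemma sum_zwexc N r (t x : 'I_r -> R) (s : 'S_N) : (forall i, 0 <= x i) ->
  let a i := \sum_l - t l * ramp_weight N (x l) i in
  \sum_l t l * zwexc (x l) s =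
  (deficits a s - Eewens theta (fun s : 'S_N => deficits a s)) / Num.sqrt N%:R.
Proof.
move=> x0 a.
have E (s' : 'S_N) : deficits a s' = \sum_l - t l * deficits (ramp_weight N (x l)) s'.
  rewrite /deficits; under eq_bigr do rewrite mulr_suml.
  rewrite exchange_big/=; apply: eq_bigr => l _; rewrite mulr_sumr.
  by apply: eq_bigr => i _; rewrite mulrA.
have -> : Eewens theta (fun s : 'S_N => deficits a s) =
    \sum_l - t l * Eewens theta (fun s : 'S_N => deficits (ramp_weight N (x l)) s).
  under eq_Eewens do rewrite E.
  rewrite /Eewens; under eq_bigr do rewrite mulr_sumr.
  rewrite exchange_big/=; apply: eq_bigr => l _; rewrite mulr_sumr.
  by apply: eq_bigr => i _; rewrite mulrCA.
rewrite E -sumrB mulr_suml; apply: eq_bigr => l _; rewrite zwexcE//; ring.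
Qed.

Theorem wexc_clt (d : nat -> measure_display) (T : forall N : nat, measurableType (d N))
    (P : forall N : nat, probability (T N) R) (sigma : forall N : nat, T N -> 'S_N) :
  (forall N : nat, (0 < N)%N -> ewens_permutation theta (P N) (sigma N)) ->
  forall (r : nat) (x : 'I_r -> R), (forall i, 0 <= x i <= 1) ->
  exists (d' : measure_display) (T' : measurableType d')
      (P' : probability T' R) (G : 'I_r -> {RV P' >-> R}),
    [/\ gaussian_vector G,
        forall i, 'E_P'[G i]%E = 0%E,
        forall i j, covariance P' (G i) (G j) = (Kwexc (x i) (x j))%:E &
        cvg_in_distribution P (fun N i => Zwexc (P N) (sigma N) (x i)) P' G].
Proof.
move=> Hs r x x01; have x0 i : 0 <= x i by case/andP: (x01 i).
pose K i j := Kwexc (x i) (x j).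
have sK i j : K i j = K j i by exact: KwexcC.
have pK t : 0 <= qform K t by exact: (qform_Kwexc_ge0 theta_gt0).
have [d' [T' [P' [Y HY]]]] := gaussian_exists sK pK.
have mY i : measurable_fun setT (Y i) by exact: HY.1.
pose G i : {RV P' >-> R} := @mfun_Sub _ _ T' R (Y i) (mem_set (mY i)).
have GY i : G i = Y i :> (T' -> R) by [].
exists d', T', P', G; split.
- exact: (gaussian_cos_vector pK HY GY).
- exact: (gaussian_cos_expectation pK HY GY).
- exact: (gaussian_cos_covariance sK pK HY GY).
have mE dU (U : measurableType dU) (Q : probability U R) (g : U -> R) :
    ('E_Q[g] = \int[Q]_w (g w)%:E)%E by rewrite unlock.
pose Z N i := Zwexc (P N) (sigma N) (x i).
(* Nothing is assumed about [sigma 0]. *)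
have Z0 i : Z 0%N i = cst 0 by apply/funext => w; rewrite /Z /Zwexc sqrtr0 mul0r.
have ZS n i : Z n.+1 i = (fun w => zwexc (x i) (sigma n.+1 w)).
  exact: Zwexc_ewens (Hs n.+1 isT).
have mZ N i : measurable_fun setT (Z N i).
  case: N => [|n]; first by rewrite Z0; exact: measurable_cst.
  by rewrite ZS; exact: (measurable_ewens (Hs n.+1 isT)).
move=> f cf [M fM].
have ifE dU (U : measurableType dU) (Q : probability U R) (V : 'I_r -> U -> R) :
    (forall i, measurable_fun setT (V i)) ->
    Q.-integrable setT (EFin \o (fun w => f (\row_i V i w))).
  move=> mV; apply: (@integrable_bounded_prob _ _ _ _ _ M) => //.
  exact: (measurable_continuous_row mV cf fM).
have fin dU (U : measurableType dU) (Q : probability U R) (V : 'I_r -> U -> R) :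
    (forall i, measurable_fun setT (V i)) ->
    ('E_Q[fun w => f (\row_i V i w)] = (\int[Q]_w f (\row_i V i w))%:E)%E.
  by move=> mV; rewrite mE fineK//; apply: integrable_fin_num => //; exact: ifE.
rewrite fin//.
have -> : (fun N => 'E_(P N)[fun w => f (\row_i Zwexc (P N) (sigma N) (x i) w)]%E) =
    (fun N => (\int[P N]_w f (\row_i Z N i w))%:E).
  by apply/funext => N; exact: (fin _ _ (P N) (Z N)).
apply: cvg_EFin; first exact: nearW.
pose B := 16 + \sum_i `|K i i|.
apply: (@cvg_Rintegral_continuous _ _ _ _ _ Z _ _ _ Y B _ _ _ _ _ _ _ f M) => //.
- move=> N i; case: N => [|n].
    by rewrite Z0; apply: (@integrable_bounded_prob _ _ _ _ _ 0) => [|w];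
      [by apply: measurable_funX; exact: measurable_cst|rewrite expr0n normr0].
  by rewrite ZS; exact: (integrable_ewens (Hs n.+1 isT) (fun s => zwexc (x i) s ^+ 2)).
- exact: (integrable_gaussian_cos_sqr pK HY).
- move=> N i; apply: (@le_trans _ _ 16); last by rewrite lerDl sumr_ge0.
  case: N => [|n].
    by rewrite Z0; under eq_Rintegral do rewrite expr0n/=; rewrite Rintegral_prob_cst.
  rewrite ZS (Rintegral_ewens (Hs n.+1 isT) (fun s => zwexc (x i) s ^+ 2)).
  exact: Eewens_zwexc_sqr_le.
- move=> i; rewrite (gaussian_cos_sqr sK pK HY) (le_trans (ler_norm _))//.
  by rewrite /B (bigD1 i)//= addrCA lerDl addr_ge0// sumr_ge0.
(* The exact variance is available from size 2 on, hence the shift. *)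
move=> t c; rewrite (HY.2 t c) -(cvg_shiftn 2)/= -qformN.
pose a n i := \sum_l - t l * ramp_weight n.+2 (x l) i.
have E n : \int[P (n + 2)%N]_w cos (\sum_i t i * Z (n + 2)%N i w + c) =
    Eewens theta (fun s : 'S_n.+2 => cos ((deficits (a n) s -
      Eewens theta (fun s : 'S_n.+2 => deficits (a n) s)) / Num.sqrt n.+2%:R + c)).
  rewrite addn2 -(Rintegral_ewens (Hs n.+2 isT)); apply: eq_Rintegral => w _.
  rewrite -sum_zwexc//; congr (cos (_ + _)).
  by apply: eq_bigr => i _; rewrite ZS.
by under eq_fun do rewrite E; exact: cvg_Eewens_cos.
Qed.

End central_limit.

Theorem theorem1p2 (R : realType) (theta : R) (theta_gt0 : 0 < theta) :
  (forall (d : measure_display) (T : measurableType d) (P : probability T R)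
      (sigma : forall N : nat, T -> 'S_N),
    (forall N : nat, (0 < N)%N -> ewens_permutation theta P (sigma N)) ->
    forall x : R, 0 <= x <= 1 ->
    {ae P, forall w : T,
      Fwexc (sigma N w) x @[N --> \oo] --> (1 - (1 - x) ^+ 2) / 2})
  /\
  (forall (d : nat -> measure_display) (T : forall N : nat, measurableType (d N))
      (P : forall N : nat, probability (T N) R)
      (sigma : forall N : nat, T N -> 'S_N),
    (forall N : nat, (0 < N)%N -> ewens_permutation theta (P N) (sigma N)) ->
    forall (r : nat) (x : 'I_r -> R), (forall i, 0 <= x i <= 1) ->
    exists (d' : measure_display) (T' : measurableType d')
        (P' : probability T' R) (G : 'I_r -> {RV P' >-> R}),
      [/\ gaussian_vector G,
          forall i, 'E_P'[G i]%E = 0%E,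
          forall i j, covariance P' (G i) (G j) = (Kwexc (x i) (x j))%:E &
          cvg_in_distribution P (fun N i => Zwexc (P N) (sigma N) (x i)) P' G]).
Proof. by split; [exact: wexc_strong_law|exact: wexc_clt]. Qed.
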